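(* Let $k\ge 1$ and $f\in L^1_s(\mathbb{X}^k)$. Then $\mathbb{E}|U(f;\eta)|<\infty$ and $$\mathbb{E}\,U(f;\eta)=\int_{\mathbb{X}^k} f(\mathbf{x}_k)\,d\mu^k(\mathbf{x}_k).$$ If furthermore $U(f;\eta)\in L^2(\mathbb{P})$, then $$\operatorname{Var}(U(f;\eta))=\sum_{n=1}^k n!\,\|h_n\|^2,$$ where, for $1\le n\le k$ and $\mathbf{x}_n\in\mathbb{X}^n$, $$h_n(\mathbf{x}_n)=\binom{k}{n}\int_{\mathbb{X}^{k-n}} f(\mathbf{x}_n,\mathbf{x}_{k-n})\,d\mu^{k-n}(\mathbf{x}_{k-n}),$$ and $\|h_n\|$ is the $L^2(\mathbb{X}^n;\mu^n)$-norm of $h_n$.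
   Context: $\mathbb{X}$ is a Polish space with its Borel $\sigma$-algebra, $\mu$ is a non-atomic locally finite measure on $\mathbb{X}$, and $\eta$ is a Poisson point process (Poisson measure) on $\mathbb{X}$ with intensity measure $\mu$. $L^1_s(\mathbb{X}^k)$ is the space of symmetric measurable functions $\mathbb{X}^k\to\mathbb{R}$ that are integrable with respect to $\mu^k$. The $U$-statistic of order $k$ with kernel $f$ is $U(f;\eta)=\sum_{\mathbf{x}_k\in\eta^k_{\neq}} f(\mathbf{x}_k)$, where $\eta^k_{\neq}$ is the set of $k$-tuples $\mathbf{x}_k=(x_1,\dots,x_k)$ of distinct points of $\eta$; it equals $0$ if $\eta$ has fewer than $k$ points. For $n=k$ the integral in the definition of $h_n$ is absent, i.e. $h_k=f$. *)

(* Defs.v *)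
From HB Require Import structures.
From mathcomp Require Import all_boot all_order all_algebra all_fingroup.
From mathcomp Require Import all_classical all_reals all_analysis.
From mathcomp Require Import measurable_realfun.
Import Order.TTheory GRing.Theory Num.Theory.
Import numFieldNormedType.Exports.

Set Implicit Arguments.
Unset Strict Implicit.
Unset Printing Implicit Defensive.

Local Open Scope classical_set_scope.
Local Open Scope ring_scope.
Local Open Scope ereal_scope.

Definition is_metric (R : realType) (T : Type) (dist : T -> T -> R) : Prop :=
  [/\ forall x y, dist x y = 0%R <-> x = y,
      forall x y, dist x y = dist y x
    & forall x y z, (dist x z <= dist x y + dist y z)%R].

(* The metric is only asserted to exist; R supplies its values. *)
Definition polish (R : realType) (T : topologicalType) : Prop :=
  (exists2 D : set T, countable D & dense D) /\
  exists dist : T -> T -> R,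
    [/\ is_metric dist,
        forall x (A : set T), nbhs x A <->
          exists2 e : R, (0 < e)%R & [set y | (dist x y < e)%R] `<=` A
      & forall u : nat -> T,
          (forall e : R, (0 < e)%R ->
             \forall m & n \near \oo, (dist (u m) (u n) < e)%R) ->
          exists l : T, u @ \oo --> l].

(* Measurable types of the library are pointed, hence ptopologicalType. *)
Notation borel T := (g_sigma_algebraType (@open T)).

Definition locally_finite (R : realType) (T : ptopologicalType)
    (mu : set (borel T) -> \bar R) : Prop :=
  forall x : T, exists2 U : set T, open_nbhs x U & mu U < +oo.

Section measures.
Context {d : measure_display} {T : measurableType d} {R : realType}.
Implicit Type mu : set T -> \bar R.

Definition atom mu (A : set T) : Prop :=
  [/\ measurable A, 0 < mu A
    & forall B, measurable B -> B `<=` A -> mu B < mu A -> mu B = 0].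

Definition non_atomic mu : Prop := forall A, ~ atom mu A.

(* The product measure mu^n on n-tuples, built from the library's product
   set function \x, whose definition needs no sigma-finiteness; it is a
   measure as soon as mu is a sigma-finite one.  mu^0 is the unit mass at the
   empty tuple. *)
Fixpoint power_measure mu (n : nat) : set (n.-tuple T) -> \bar R :=
  if n is m.+1 then
    pushforward (mu \x @power_measure mu m)
      (fun p : T * m.-tuple T => [tuple of p.1 :: p.2])
  else \d_[tuple].
Arguments power_measure mu n _ : clear implicits.

Definition symmetric_kernel (k : nat) (f : k.-tuple T -> R) : Prop :=
  forall (s : 'S_k) (x : k.-tuple T), f [tuple tnth x (s i) | i < k] = f x.

(* k-tuples of pairwise distinct points (i.e. point masses) of a counting
   measure. *)
Definition distinct_tuples (k : nat) (m : set T -> \bar R) : set (k.-tuple T) :=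
  [set x : k.-tuple T | uniq x /\ forall i : 'I_k, 0 < m [set tnth x i]].
Arguments distinct_tuples k m _ : clear implicits.

(* Sum of f over the distinct k-tuples, as the positive part minus the
   negative part; when one of these is infinite the value is 0. *)
Definition Ustat (k : nat) (f : k.-tuple T -> R) (m : set T -> \bar R) : R :=
  fine (\esum_(x in distinct_tuples k m) (EFin \o f)^\+ x
        - \esum_(x in distinct_tuples k m) (EFin \o f)^\- x).

(* The variable n ranges over 'I_k.+1 so that the concatenation of an n-tuple
   and a (k - n)-tuple can be cast to a k-tuple.  Where the inner integral is
   not finite the value is 0. *)
Definition hkernel mu (k : nat) (f : k.-tuple T -> R) (n : 'I_k.+1)
    (x : n.-tuple T) : R :=
  ('C(k, n)%:R * fine (\int[power_measure mu (k - n)]_y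
     (f (tcast (subnKC (leq_ord n)) [tuple of x ++ y]))%:E))%R.

Definition sq_L2norm mu (n : nat) (h : n.-tuple T -> R) : \bar R :=
  \int[power_measure mu n]_x (`|h x| ^+ 2)%:E.

End measures.
Arguments power_measure {d T R} mu n _.
Arguments distinct_tuples {d T R} k m _.
Arguments hkernel {d T R} mu {k} f n x.

Definition locally_finite_counting (R : realType) (T : ptopologicalType)
    (m : {measure set (borel T) -> \bar R}) : Prop :=
  locally_finite m /\
  forall A, measurable A -> m A = +oo \/ exists j : nat, m A = j%:R%:E.

(* Not the library's poisson_pmf, which is constantly 1 at rate 0. *)
Definition poisson_weight (R : realType) (rate : R) (j : nat) : R :=
  (rate ^+ j / j`!%:R * expR (- rate))%R.

(* A random measure on T is a kernel from the probability space to T.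
   Poisson counts are only required on sets of finite intensity: for
   sigma-finite mu, eta A = +oo a.s. when mu A = +oo then follows. *)
Definition poisson_process (R : realType) (d : measure_display)
    (Omega : measurableType d) (P : probability Omega R) (T : ptopologicalType)
    (mu : {measure set (borel T) -> \bar R})
    (eta : R.-ker Omega ~> borel T) : Prop :=
  [/\ forall w, locally_finite_counting (eta w),
      forall A, measurable A -> mu A < +oo -> forall j : nat,
        P [set w | eta w A = j%:R%:E] = (poisson_weight (fine (mu A)) j)%:E
    & forall (n : nat) (A : 'I_n -> set (borel T)),
        (forall i, measurable (A i)) -> trivIset setT A ->
        forall B : 'I_n -> set (\bar R), (forall i, measurable (B i)) ->
          P [set w | forall i, B i (eta w (A i))] =
          \prod_(i < n) P [set w | B i (eta w (A i))]].

(* Main.v *)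
(* For nonnegative F the expectation of the sum of F over the distinct n-tuples
   of eta is the integral of F against mu^n (Mecke): the points of eta are
   a.s. simple, the formula on boxes of pairwise disjoint sets is independence,
   and such boxes determine measures off the diagonals, which are mu^n-null.
   The product of two such sums expands according to the common points of the
   two tuples, so that E (S_F S_G) is the sum over r of r! times the integral
   of (exp D F) (exp D G) against mu^r, where D h z = (|z| + 1) int h (z, y) dmu.
   Here exp D f is h_r on r-tuples, and this would be the variance formula if
   the sums of f^+ and f^- were square integrable.  Since only U is, one cuts
   exp D f^+ and exp D f^- down to a set of finite mass on which both are
   bounded and applies exp (- D) to the result.  The corresponding sums W_j
   satisfy the formula, their second moments converge to its right-hand side,
   and E |U - W_j| -> 0; the two inequalities between E U^2 and the limit
   follow from 2 U W_j <= U^2 + W_j^2 and from a cut-off of U. *)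
Require Import Defs.
From HB Require Import structures.
From mathcomp Require Import all_boot all_order all_algebra all_fingroup.
From mathcomp Require Import all_classical all_reals all_analysis.
From mathcomp Require Import measurable_realfun.
From mathcomp Require Import zify ring lra.
Import Order.TTheory GRing.Theory Num.Theory.
Import numFieldNormedType.Exports.

Set Implicit Arguments.
Unset Strict Implicit.
Unset Printing Implicit Defensive.

Local Open Scope classical_set_scope.
Local Open Scope ring_scope.
Local Open Scope ereal_scope.

(** * Iterated integrals *)

(** The obstacle is that [f] is only integrable: the sums of f^+ and f^- are almost surely finite
    but may have infinite second moments, so that E U^2 cannot be found by expanding the square of
    their difference. Truncating [f] itself would not help, because the sections of a truncated [f]
    are not controlled by those of [f]. Truncating exp D f and going back by exp (- D) gives instead
    a kernel, now with components of all orders up to k, whose chaos kernels are exactly the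
    truncated h_n. This is why kernels are functions on lists of every length and not on k-tuples: D
    lowers the order by one, hence is nilpotent on kernels vanishing at long lists, and exp (- D) is
    a finite sum. Integrals take values in [0, +oo]; signed objects are therefore carried as pairs
    of nonnegative kernels, exp (- D) is split into its even and odd parts, and identities have
    their negative terms moved to the other side, to be cancelled only once they are known to be
    finite. The term r = 0 of the second moment is (E U)^2, which the variance removes. *)

Section sequence_functions.
Context {R : realType} {d : measure_display} {T : measurableType d}.
Implicit Types F G : seq T -> \bar R.

(** A function on lists stands for one function on each power of the space. Lists rather than tuples
    keep concatenation free of casts; measurability is asked length by length. *)
Definition mseq F := forall n, measurable_fun [set: n.-tuple T] (fun t : n.-tuple T => F t).

Lemma mseq_comp d' (S : measurableType d') (g : S -> seq T) n F : mseq F ->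
  (forall s, size (g s) = n) ->
  (forall i, (i < n)%N -> measurable_fun setT (fun s => nth point (g s) i)) ->
  measurable_fun setT (fun s => F (g s)).
Proof.
move=> mF sg mg.
have sg' s : size (g s) == n by rewrite sg.
pose h s := Tuple (sg' s).
rewrite (_ : (fun _ => _) = (fun t : n.-tuple T => F t) \o h)//.
apply: measurableT_comp; first exact: mF.
apply/measurable_fun_tnthP => i.
rewrite (_ : _ \o h = (fun s => nth point (g s) i)); first exact: mg.
by apply/funext => s/=; rewrite (tnth_nth point).
Qed.

Lemma measurable_nth n i :
  measurable_fun [set: n.-tuple T] (fun t : n.-tuple T => nth point t i).
Proof.
case: (ltnP i n) => ni.
  rewrite (_ : (fun _ => _) = (@tnth n T ^~ (Ordinal ni))); first exact: measurable_tnth.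
  by apply/funext => t; rewrite (tnth_nth point).
rewrite (_ : (fun _ => _) = cst point)//.
by apply/funext => t; rewrite nth_default// size_tuple.
Qed.

Lemma mseq_cons F a : mseq F -> mseq (fun s => F (a :: s)).
Proof.
move=> mF n; apply: (mseq_comp (n := n.+1)) => //.
  by move=> s; rewrite /= size_tuple.
by case=> [|i] ni /=; [exact: measurable_cst|exact: measurable_nth].
Qed.

Lemma mseq_catl F x : mseq F -> mseq (fun s => F (x ++ s)).
Proof. by elim: x F => // a x ih F mF; apply: ih (mseq_cons _ _). Qed.

Lemma measurable_cons_pair F n : mseq F ->
  measurable_fun [set: T * n.-tuple T] (fun p : T * n.-tuple T => F (p.1 :: p.2)).
Proof.
move=> mF; apply: (mseq_comp (n := n.+1)) => //.
  by move=> s; rewrite /= size_tuple.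
case=> [|i] ni /=; first exact: measurable_fst.
by apply: (measurableT_comp (measurable_nth _)); exact: measurable_snd.
Qed.

Lemma measurable_rcons_pair F n : mseq F ->
  measurable_fun [set: n.-tuple T * T] (fun p : n.-tuple T * T => F (rcons p.1 p.2)).
Proof.
move=> mF; apply: (mseq_comp (n := n.+1)) => //.
  by move=> s; rewrite size_rcons size_tuple.
move=> i ni /=; have [iltn|ilen] := ltnP i n.
  rewrite (_ : (fun _ => _) = (fun t : n.-tuple T => nth point t i) \o fst); last first.
    by apply/funext => s /=; rewrite nth_rcons size_tuple iltn.
  by apply: (measurableT_comp (measurable_nth _)); exact: measurable_fst.
rewrite (_ : (fun _ => _) = snd); first exact: measurable_snd.
by apply/funext => s /=; rewrite nth_rcons size_tuple ltnNge ilen/= (_ : i == n)//; lia.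
Qed.

Lemma mseqD F G : mseq F -> mseq G -> mseq (fun s => F s + G s).
Proof. by move=> mF mG n; apply: emeasurable_funD; [exact: mF|exact: mG]. Qed.

Lemma mseqM F G : mseq F -> mseq G -> mseq (fun s => F s * G s).
Proof. by move=> mF mG n; apply: emeasurable_funM; [exact: mF|exact: mG]. Qed.

Lemma mseq_cst c : mseq (cst c).
Proof. by move=> n; exact: measurable_cst. Qed.

Lemma mseq_sum (I : Type) (r : seq I) (P : pred I) (F : I -> seq T -> \bar R) :
  (forall i, P i -> mseq (F i)) -> mseq (fun s => \sum_(i <- r | P i) F i s).
Proof.
move=> mF; elim: r => [|i r ih].
  by under eq_fun do rewrite big_nil; exact: mseq_cst.
have [Pi|/negbTE Pi] := boolP (P i); under eq_fun do rewrite big_cons Pi; last exact: ih.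
by apply: (mseqD (mF _ Pi) ih).
Qed.

End sequence_functions.

Section iterated_integral.
Context {R : realType} {d : measure_display} {T : measurableType d}.
Variable mu : {sigma_finite_measure set T -> \bar R}.
Implicit Types F G : seq T -> \bar R.

(** Integration against the n-th power of [mu] by recursion on the first variable; only the values
    of F at lists of length n matter. [integral_power_measure] identifies it with the integral
    against the product measure. *)
Fixpoint itint n F : \bar R :=
  if n is m.+1 then \int[mu]_x itint m (fun s => F (x :: s)) else F [::].

Lemma itint_ge0 n F : (forall s, 0 <= F s) -> 0 <= itint n F.
Proof.
elim: n F => [|n ih] F F0 /=; first exact: F0.
by apply: integral_ge0 => x _; exact: ih.
Qed.

Lemma eq_itint n F G : (forall s, size s = n -> F s = G s) -> itint n F = itint n G.
Proof.
elim: n F G => [|n ih] F G FG /=; first exact: FG.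
by apply: eq_integral => x _; apply: ih => s sn; apply: FG; rewrite /= sn.
Qed.

(** By Tonelli, one integration at a time. The prefix grows at its right end ([rcons]), so that the
    induction hypothesis already speaks of the longer prefix. *)
Lemma mseq_itint n F : mseq F -> (forall s, 0 <= F s) ->
  mseq (fun s => itint n (fun t => F (s ++ t))).
Proof.
move=> mF F0; elim: n => [|n ih] m /=.
  by under eq_fun do rewrite cats0; exact: mF.
have := @measurable_fun_fubini_tonelli_F _ _ _ _ _ mu _
  (measurable_rcons_pair (n := m) ih) (fun p => itint_ge0 _ (fun s => F0 _)).
apply: eq_measurable_fun => s _; rewrite /fubini_F.
by apply: eq_integral => x _; apply: eq_itint => t _; rewrite cat_rcons.
Qed.

Lemma measurable_itint n F : mseq F -> (forall s, 0 <= F s) ->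
  measurable_fun setT (fun x => itint n (fun t => F (x :: t))).
Proof.
move=> mF F0; apply: (mseq_comp (F := fun s => itint n (fun t => F (s ++ t)))
  (g := fun x => [:: x]) (n := 1%N)) => //; first exact: mseq_itint.
by case=> // _; exact: measurable_id.
Qed.

Lemma itint_add n m F : itint (n + m) F = itint n (fun s => itint m (fun t => F (s ++ t))).
Proof.
elim: n F => [|n ih] F //=.
by apply: eq_integral => x _; rewrite ih.
Qed.

Lemma itintD n F G : mseq F -> (forall s, 0 <= F s) -> mseq G -> (forall s, 0 <= G s) ->
  itint n (fun s => F s + G s) = itint n F + itint n G.
Proof.
elim: n F G => [|n ih] F G mF F0 mG G0 //=.
rewrite -ge0_integralD//; first last.
- exact: measurable_itint.
- by move=> x _; exact: itint_ge0.
- exact: measurable_itint.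
- by move=> x _; exact: itint_ge0.
by apply: eq_integral => x _; rewrite ih//; exact: mseq_cons.
Qed.

Lemma itint0 n : itint n (fun=> 0) = 0.
Proof. by elim: n => //= n ih; under eq_integral do rewrite ih; rewrite integral0. Qed.

Lemma itint_sum n (I : Type) (r : seq I) (P : pred I) (F : I -> seq T -> \bar R) :
  (forall i, P i -> mseq (F i)) -> (forall i s, P i -> 0 <= F i s) ->
  itint n (fun s => \sum_(i <- r | P i) F i s) = \sum_(i <- r | P i) itint n (F i).
Proof.
move=> mF F0; elim: r => [|i r ih].
  by rewrite big_nil -[RHS](itint0 n); apply: eq_itint => s _; rewrite big_nil.
rewrite big_cons; case: ifPn => Pi; last first.
  by rewrite -ih; apply: eq_itint => s _; rewrite big_cons (negbTE Pi).
rewrite -ih -itintD//; [|exact: mF|by move=> s; exact: F0|exact: mseq_sum|].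
- by apply: eq_itint => s _; rewrite big_cons Pi.
- by move=> s; apply: sume_ge0 => j; exact: F0.
Qed.

Lemma itintZl n c F : mseq F -> (forall s, 0 <= F s) -> 0 <= c ->
  itint n (fun s => c * F s) = c * itint n F.
Proof.
move=> + + c0; elim: n F => [|n ih] F mF F0 //=.
rewrite -ge0_integralZl//; last 2 first.
- exact: measurable_itint.
- by move=> x _; exact: itint_ge0.
by apply: eq_integral => x _; rewrite ih//; exact: mseq_cons.
Qed.

Lemma le_itint n F G : mseq F -> mseq G -> (forall s, 0 <= F s) ->
  (forall s, size s = n -> F s <= G s) -> itint n F <= itint n G.
Proof.
move=> mF mG F0 FG.
(* The order is known only at length n; replacing G by the maximum leaves its integral unchanged and
   gives an order valid at all lists, and nonnegativity with it. *)
pose H s := maxe (F s) (G s).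
have -> : itint n G = itint n H by apply: eq_itint => s sn; rewrite /H max_r// FG.
have mH : mseq H by move=> m; apply: measurable_maxe; [exact: mF|exact: mG].
have FH s : F s <= H s by rewrite le_max lexx.
move: H mH FH => {mG FG}.
elim: n F mF F0 => [|n ih] F mF F0 H mH FH /=; first exact: FH.
apply: ge0_le_integral => //.
- by move=> x _; exact: itint_ge0.
- exact: measurable_itint.
- by apply: measurable_itint => // s; exact: le_trans (FH s).
- move=> x _; apply: ih => //; exact: mseq_cons.
Qed.

Lemma itint_swap n F : mseq F -> (forall s, 0 <= F s) ->
  \int[mu]_a itint n (fun s => F (a :: s)) = itint n (fun s => \int[mu]_a F (a :: s)).
Proof.
elim: n F => [//|n ih] F mF F0 /=.
(* The induction hypothesis moves [a] past n variables; inserting [b] in second place makes it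
   applicable behind [b]. The value at the empty list is immaterial. *)
pose G b s := if s is a :: s' then F [:: a, b & s'] else 0.
have mG b : mseq (G b).
  case=> [|m].
    by apply: (eq_measurable_fun (cst 0)) => // s _; rewrite tuple0.
  have : measurable_fun setT (fun s : m.+1.-tuple T =>
      F [:: nth point s 0, b & behead s]).
    apply: (mseq_comp (n := m.+2)) => //.
      by move=> s; rewrite /= size_behead size_tuple.
    case=> [|[|i]] _ /=; [exact: measurable_nth|exact: measurable_cst|].
    by under eq_fun do rewrite nth_behead; exact: measurable_nth.
  by apply: eq_measurable_fun => s _ /=; case/tupleP: s.
transitivity (\int[mu]_b \int[mu]_a itint n (fun s => F [:: a, b & s])).
  apply: (@fubini_tonelli _ _ _ _ _ mu mu (fun p => itint n (fun s => F [:: p.1, p.2 & s]))).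
    apply: (mseq_comp (F := fun s => itint n (fun t => F (s ++ t)))
      (g := fun p : T * T => [:: p.1; p.2]) (n := 2%N)) => //.
      exact: mseq_itint.
    by case=> [|[]]// _ /=; [exact: measurable_fst|exact: measurable_snd].
  by move=> p; exact: itint_ge0.
apply: eq_integral => b _.
by have := ih (G b) (mG b); rewrite /G; apply => -[|a s].

Qed.

End iterated_integral.

(** * Powers of a measure *)

Section sigma_finite_pack.
Context {d : measure_display} {T : measurableType d} {R : realType}.
Variables (m : {measure set T -> \bar R}) (sm : sigma_finite setT m).

(** The proof argument is a phantom: it only lets a sigma-finite structure be attached to [m], and
    the result stays convertible with [m]. *)
Definition as_sigma_finite of sigma_finite setT m : set T -> \bar R := m.

HB.instance Definition _ := Measure.copy (as_sigma_finite sm) m.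
HB.instance Definition _ := Measure_isSigmaFinite.Build _ _ _ (as_sigma_finite sm) sm.

End sigma_finite_pack.

Section power_measure.
Context {R : realType} {d : measure_display} {T : measurableType d}.
Variable mu : {sigma_finite_measure set T -> \bar R}.

Lemma measurable_tuple_cons n :
  measurable_fun setT (fun p : T * n.-tuple T => [tuple of p.1 :: p.2]).
Proof. by apply: measurable_cons; [exact: measurable_fst|exact: measurable_snd]. Qed.

Lemma measurable_tuple_uncons n :
  measurable_fun setT (fun t : n.+1.-tuple T => (thead t, [tuple of behead t])).
Proof.
apply: measurable_fun_pair; last exact: measurable_behead.
exact: measurable_tnth.
Qed.

(** The covering sets are transported as preimages under the measurable left inverse [g]; these pull
    back along [f] to the original cover. *)
Lemma sigma_finite_pushforward d1 d2 (T1 : measurableType d1) (T2 : measurableType d2)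
    (m : {measure set T1 -> \bar R}) (f : T1 -> T2) (g : T2 -> T1) :
  measurable_fun setT f -> measurable_fun setT g -> cancel f g ->
  sigma_finite setT m -> sigma_finite setT (pushforward m f).
Proof.
move=> mf mg fg [F TF Foo]; exists (fun k => g @^-1` F k).
  by rewrite -preimage_bigcup -TF preimage_setT.
move=> k; have [mFk Fkoo] := Foo k; split.
  by rewrite -[X in measurable X]setTI; exact: mg.
rewrite /pushforward -comp_preimage (_ : g \o f = id)//.
by apply/funext => x /=; rewrite fg.
Qed.

Lemma sigma_finite_product d1 d2 (T1 : measurableType d1) (T2 : measurableType d2)
    (m1 : {sigma_finite_measure set T1 -> \bar R})
    (m2 : {sigma_finite_measure set T2 -> \bar R}) : sigma_finite setT (m1 \x m2).
Proof.
have /sigma_finiteP[F [TF ndF Foo]] := sigma_finiteT m1.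
have /sigma_finiteP[G [TG ndG Goo]] := sigma_finiteT m2.
exists (fun n => F n `*` G n).
  apply/seteqP; split => // -[x y] _.
  have [n _ Fnx] : (\bigcup_i F i) x by rewrite -TF.
  have [m _ Gmy] : (\bigcup_i G i) y by rewrite -TG.
  exists (maxn n m) => //; split => /=.
  - by apply: (subsetPset _ _ (ndF n _ (leq_maxl n m))).
  - by apply: (subsetPset _ _ (ndG m _ (leq_maxr n m))).
move=> k; have [mF ?] := Foo k; have [mG ?] := Goo k.
split; first exact: measurableX.
by rewrite product_measure1E// lte_mul_pinfty// ge0_fin_numE.
Qed.

(** [power_measure] is a bare set function; rewriting with this equality replaces it by a bundled
    measure, to which the theorems on integration apply. *)
Lemma power_measure_pack n : exists m : {sigma_finite_measure set (n.-tuple T) -> \bar R},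
  power_measure mu n = m.
Proof.
elim: n => [|n [m mE]].
  by exists \d_[tuple].
have mc := @measurable_tuple_cons n.
pose pm : {measure set (n.+1.-tuple T) -> \bar R} :=
  pushforward (mu \x m) (fun p : T * n.-tuple T => [tuple of p.1 :: p.2]).
have spm : sigma_finite setT (pm mc).
  apply: (sigma_finite_pushforward mc (measurable_tuple_uncons (n := n))).
    by move=> [x t] /=; congr (_, _); apply/val_inj.
  exact: sigma_finite_product.
by exists (as_sigma_finite spm); rewrite /= mE.
Qed.

Lemma integral_power_measure n F : mseq F -> (forall s, 0 <= F s) ->
  \int[power_measure mu n]_(t in setT) F (tval t) = itint mu n F.
Proof.
move=> mF F0; elim: n F mF F0 => [|n ih] F mF F0 /=.
  by rewrite integral_dirac//; [rewrite diracT mul1e|exact: mF].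
have [m mE] := power_measure_pack n; rewrite mE.
rewrite ge0_integral_pushforward//; [|exact: measurable_tuple_cons|exact: mF].
rewrite preimage_setT.
rewrite (fubini_tonelli1 (fun p : T * n.-tuple T => F (p.1 :: p.2)))//; last first.
  exact: measurable_cons_pair.
rewrite /fubini_F.
by apply: eq_integral => x _; rewrite -ih ?mE//; apply: mseq_cons.
Qed.

Lemma measurable_box n (B : 'I_n -> set T) : (forall i, measurable (B i)) ->
  measurable [set t | forall i, B i (tnth t i)].
Proof.
move=> mB.
rewrite (_ : [set _ | _] = \bigcap_(i in [set: 'I_n]) ((@tnth n T)^~ i @^-1` B i)).
  apply: fin_bigcap_measurable => // i _.
  by rewrite -[X in measurable X]setTI; exact: measurable_tnth.
by apply/seteqP; split => t /=; [move=> h i _; exact: h|move=> h i; exact: h].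
Qed.

End power_measure.

(** * Sums over distinct tuples *)

Section distinct_sums.
Context {R : realType} {T : choiceType}.
Implicit Types (F G : seq T -> \bar R) (A : set T).

(** The recursion removes each chosen point from the set and runs parallel to that of [itint];
    [dsum_esum] compares it with the sum over tuples without repetition. *)
Fixpoint dsum n F A : \bar R :=
  if n is m.+1 then \esum_(x in A) dsum m (fun s => F (x :: s)) (A `\ x)
  else F [::].

Lemma dsumS n F A :
  dsum n.+1 F A = \esum_(x in A) dsum n (fun s => F (x :: s)) (A `\ x).
Proof. by []. Qed.

Definition symmetric F := forall s t, perm_eq s t -> F s = F t.

Lemma symmetric_cons F a : symmetric F -> symmetric (fun s => F (a :: s)).
Proof. by move=> sF s t st; apply: sF; rewrite perm_cons. Qed.

Lemma dsum_ge0 n F A : (forall s, 0 <= F s) -> 0 <= dsum n F A.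
Proof.
elim: n F A => [|n ih] F A F0 /=; first exact: F0.
by apply: esum_ge0 => x _; exact: ih.
Qed.

Lemma eq_dsum n F G A : (forall s, size s = n -> F s = G s) -> dsum n F A = dsum n G A.
Proof.
elim: n F G A => [|n ih] F G A FG /=; first exact: FG.
by apply: eq_esum => x _; apply: ih => s sn; apply: FG; rewrite /= sn.
Qed.

Lemma dsumD n F G A : (forall s, 0 <= F s) -> (forall s, 0 <= G s) ->
  dsum n (fun s => F s + G s) A = dsum n F A + dsum n G A.
Proof.
elim: n F G A => [|n ih] F G A F0 G0 //=.
rewrite -esumD => [|x _|x _]; [|exact: dsum_ge0|exact: dsum_ge0].
by apply: eq_esum => x _; rewrite ih.
Qed.

Lemma le_esum1 (I : choiceType) (A : set I) (a : I -> \bar R) i : A i ->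
  (forall j, 0 <= a j) -> a i <= \esum_(j in A) a j.
Proof.
move=> Ai a0; apply: esum_ge; exists [set i]; last by rewrite fsbig_set1.
by split => // _ ->.
Qed.

Lemma esumZl (I : choiceType) (A : set I) (c : \bar R) (a : I -> \bar R) :
  0 <= c -> (forall i, 0 <= a i) ->
  \esum_(i in A) (c * a i) = c * \esum_(i in A) a i.
Proof.
move=> + a0; case: c => [c c0|_|//]; last first.
  (* For an infinite constant both sides are 0 or +oo, according to whether all terms vanish. *)
  have [a_eq0|/existsNP[i /not_implyP[Ai /eqP ai]]] := pselect (forall i, A i -> a i = 0).
    by rewrite !esum1 ?mule0// => i Ai; rewrite a_eq0 ?mule0.
  have ai0 : 0 < a i by rewrite lt0e ai a0.
  rewrite [RHS]gt0_mulye; last exact: lt_le_trans (le_esum1 Ai a0).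
  apply/eqP; rewrite eq_le leey/=.
  have := @le_esum1 _ A (fun i => +oo * a i) i Ai; rewrite gt0_mulye//; apply.
  by move=> j; rewrite mule_ge0.
rewrite /esum -ereal_supZl//; last first.
  by apply/set0P; exists 0; exists set0; [exact: fsets_set0|rewrite fsbig_set0].
congr ereal_sup; apply/seteqP; split => x /=.
  move=> [X AX <-]; exists (\sum_(i \in X) a i); last by rewrite ge0_mule_fsumr.
  by exists X.
by move=> [_ [X AX <-] <-]; exists X => //; rewrite ge0_mule_fsumr.
Qed.

Lemma dsumZl n (c : \bar R) F A : 0 <= c -> (forall s, 0 <= F s) ->
  dsum n (fun s => c * F s) A = c * dsum n F A.
Proof.
move=> c0; elim: n F A => [|n ih] F A F0 //=.
rewrite -esumZl// => [|x]; last exact: dsum_ge0.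
by apply: eq_esum => x _; rewrite ih.
Qed.

Lemma dsum0 n A : dsum n (fun=> 0) A = 0.
Proof. by elim: n A => // n ih A /=; apply: esum1 => x _; exact: ih. Qed.

Lemma esum_nneseries (I : choiceType) (A : set I) (a : nat -> I -> \bar R) :
  (forall n i, 0 <= a n i) ->
  \esum_(i in A) \sum_(n <oo) a n i = \sum_(n <oo) \esum_(i in A) a n i.
Proof.
move=> a0; rewrite nneseries_esumT; last by move=> n; exact: esum_ge0.
under eq_esum do rewrite nneseries_esumT//.
rewrite esum_esum// esum_esum//.
rewrite (reindex_esum ([set: nat] `*`` (fun=> A)) _ (fun p => (p.2, p.1)))//.
split => [[n i]|[n i] [m j] _ _|[i n]] /=; rewrite ?inE//=.
- by case.
- by case=> -> ->.
- by move=> [Ai _]; exists (n, i).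
Qed.

Lemma dsum_nneseries n (F : nat -> seq T -> \bar R) A : (forall j s, 0 <= F j s) ->
  dsum n (fun s => \sum_(j <oo) F j s) A = \sum_(j <oo) dsum n (F j) A.
Proof.
elim: n F A => [|n ih] F A F0 //=.
rewrite -esum_nneseries => [|j x]; last exact: dsum_ge0.
by apply: eq_esum => x _; rewrite ih.
Qed.

Lemma dsum_esum n F A : (forall s, 0 <= F s) ->
  \esum_(t in [set t : n.-tuple T | uniq t /\ forall i, A (tnth t i)]) F t = dsum n F A.
Proof.
elim: n F A => [|n ih] F A F0 /=.
  rewrite (_ : [set _ | _] = [set [tuple]]); last first.
    by apply/seteqP; split => t /=; [rewrite [t]tuple0|move=> ->; split => // -[]].
  by rewrite esum_set1.
under [RHS]eq_esum do rewrite -ih//.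
rewrite esum_esum => [|x t _ _ //].
rewrite (reindex_esum (A `*`` (fun x => [set t : n.-tuple T | uniq t /\
    forall i, (A `\ x) (tnth t i)])) _ (fun p => [tuple of p.1 :: p.2]))//.
split=> /=.
- move=> [x t] /= [Ax [ut tA]]; split; last first.
    move=> i; case: (unliftP ord0 i) => [j ->|->]; last by rewrite tnth0.
    by rewrite tnthS; have [] := tA j.
  rewrite ut andbT; apply/negP => /tnthP[i xE].
  by have [_ /=] := tA i; rewrite xE.
- by move=> [x t] [y s] _ _ /= [-> /val_inj ->].
- move=> t [ut tA]; exists (thead t, [tuple of behead t]); last first.
    by rewrite [RHS]tuple_eta.
  split=> /=; first exact: tA.
  move: ut tA; case/tupleP: t => x t /=; rewrite theadE => /andP[xt ut] tA.
  split=> [|i]; first by [].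
  have := tA (lift ord0 i); rewrite tnthS => At; rewrite (tnth_nth x)/=.
  split; first by move: At; rewrite (tnth_nth x).
  by move=> xE; move: xt; rewrite -xE mem_nth// size_tuple.
Qed.

Lemma esum_setD1 (I : choiceType) (A : set I) a (f : I -> \bar R) : A a ->
  (forall i, 0 <= f i) ->
  \esum_(i in A) f i = f a + \esum_(i in A `\ a) f i.
Proof.
move=> Aa f0; rewrite (esumID [set a])// setIidr; last by move=> _ ->.
by rewrite esum_set1// setDE.
Qed.

Lemma setD1A (A : set T) a b : (A `\ a) `\ b = (A `\ b) `\ a.
Proof. by apply/seteqP; split => x /= [[? ?] ?]. Qed.

(** A tuple through [a] has it at one of n + 1 positions, and by symmetry it may be moved to the
    front. *)
Lemma dsumS_setD1 n F A a : A a -> (forall s, 0 <= F s) -> symmetric F ->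
  dsum n.+1 F A = dsum n.+1 F (A `\ a) +
    n.+1%:R%:E * dsum n (fun s => F (a :: s)) (A `\ a).
Proof.
elim: n F A => [|n ih] F A Aa F0 sF.
  rewrite dsumS (esum_setD1 Aa) => [|x]; last exact: dsum_ge0.
  by rewrite addeC [1%:R%:E * _]mul1e.
rewrite dsumS (esum_setD1 Aa) => [|x]; last exact: dsum_ge0.
rewrite (_ : \esum_(i in A `\ a) _ = dsum n.+2 F (A `\ a) +
    n.+1%:R%:E * dsum n.+1 (fun s => F (a :: s)) (A `\ a)).
  rewrite addeCA; congr (_ + _).
  rewrite [in RHS]mulrS EFinD ge0_muleDl ?lee_fin//.
  by rewrite mul1e.
rewrite !dsumS -esumZl ?lee_fin// => [|x]; last exact: dsum_ge0.
rewrite -esumD => [|x _|x _]; last 2 first.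
- exact: dsum_ge0.
- by rewrite mule_ge0 ?lee_fin//; exact: dsum_ge0.
apply: eq_esum => x [Ax xa].
have Axa : (A `\ x) a by split => // ax; apply: xa; rewrite ax.
rewrite (ih _ _ Axa)//; last exact: symmetric_cons.
rewrite setD1A; congr (_ + _ * _).
apply: eq_dsum => s _; apply: sF.
by rewrite (perm_catCA [:: x] [:: a] s).
Qed.

Fixpoint masks k : seq bitseq :=
  if k is k'.+1 then [seq false :: m | m <- masks k'] ++ [seq true :: m | m <- masks k']
  else [:: [::]].

(** The list [s] enumerates the union of the points of two tuples: its first k entries form the
    first tuple, and the second consists of the marked ones among them followed by the rest. *)
Definition overlap k F G (m : bitseq) (s : seq T) : \bar R :=
  F (take k s) * G (mask m (take k s) ++ drop k s).

(* Expands the product of two sums over distinct tuples according to which of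
   the [k] points of the first tuple also occur in the second one; those are
   marked by [m] and occupy [l ^_ count id m] possible positions. *)
Lemma dsum_mul k l F G A : (forall s, 0 <= F s) -> (forall s, 0 <= G s) -> symmetric G ->
  dsum k F A * dsum l G A = \sum_(m <- masks k) (l ^_ (count id m))%:R%:E *
    dsum (k + (l - count id m)) (overlap k F G m) A.
Proof.
elim: k l F G A => [|k ih] l F G A F0 G0 sG.
  rewrite big_seq1 /= ffactn0 mul1e add0n subn0 -dsumZl//.
  by apply: eq_dsum => s _; rewrite /overlap take0 drop0.
rewrite dsumS muleC -esumZl//; [|exact: dsum_ge0|by move=> a; exact: dsum_ge0].
have step a : A a -> dsum l G A * dsum k (fun s => F (a :: s)) (A `\ a) =
    \sum_(m <- masks k.+1) (l ^_ (count id m))%:R%:E *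
      dsum (k + (l - count id m)) (fun s => overlap k.+1 F G m (a :: s)) (A `\ a).
  move=> Aa; rewrite /= big_cat !big_map /=.
  under [X in _ = X + _]eq_bigr do rewrite add0n.
  rewrite -(ih l (fun s => F (a :: s)) G)//.
  case: l => [|l].
    rewrite [X in _ + X]big1 ?adde0; first by rewrite muleC.
    by move=> m _; rewrite add1n ffact0n mul0e.
  (* Second tuples avoiding [a] and second tuples through [a]: these correspond to the masks
     beginning with [false] and with [true]. *)
  rewrite (dsumS_setD1 _ Aa)// ge0_muleDl; last 2 first.
  - exact: dsum_ge0.
  - by rewrite mule_ge0 ?lee_fin//; exact: dsum_ge0.
  rewrite muleC; congr (_ + _).
  rewrite -muleA [dsum l _ _ * _]muleC (ih l (fun s => F (a :: s)) (fun s => G (a :: s)))//; last first.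
    exact: symmetric_cons.
  rewrite ge0_sume_distrr => [|m _]; last first.
    by rewrite mule_ge0 ?lee_fin//; apply: dsum_ge0 => s; rewrite mule_ge0.
  apply: eq_bigr => m _; rewrite add1n ffactSS subSS muleA natrM EFinM.
  by [].
rewrite (eq_esum step) esum_sum; last first.
  by move=> a m _ _; rewrite mule_ge0 ?lee_fin//; apply: dsum_ge0 => s; rewrite mule_ge0.
apply: eq_bigr => m _; rewrite esumZl ?lee_fin//.
by move=> a; apply: dsum_ge0 => s; rewrite mule_ge0.
Qed.

End distinct_sums.

(** * Integrals over pairs of overlapping tuples *)

Section overlap_integral.
Context {R : realType} {d : measure_display} {T : measurableType d}.
Variable mu : {sigma_finite_measure set T -> \bar R}.
Implicit Types F G : seq T -> \bar R.

(** An operation natural in the type of the entries only rearranges positions, so on lists of length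
    n it is determined by its value at the index list [iota 0 n]. *)
Lemma mseq_reindex F (h : forall (U : Type), seq U -> seq U) :
  (forall (U V : Type) (f : U -> V) s, h V (map f s) = map f (h U s)) ->
  mseq F -> mseq (fun s => F (h T s)).
Proof.
move=> hmap mF n.
have hE (t : n.-tuple T) : h T t = map (nth point t) (h nat (iota 0 n)).
  by rewrite -hmap -[in iota 0 n](size_tuple t) map_nth_iota0// take_size.
under eq_fun do rewrite hE.
apply: (mseq_comp (n := size (h nat (iota 0 n)))) => // [s|i ni]; first by rewrite size_map.
under eq_fun do rewrite (nth_map 0%N)//.
exact: measurable_nth.
Qed.

Lemma mseq_behead F : mseq F -> mseq (fun s => F (behead s)).
Proof.
by apply: (mseq_reindex (h := fun U => @behead U)) => U V f s; rewrite behead_map.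
Qed.

Lemma mseq_overlap k F G m : mseq F -> mseq G -> mseq (overlap k F G m).
Proof.
move=> mF mG; apply: mseqM.
  by apply: (mseq_reindex (h := fun U => @take U k)) => // U V f s; rewrite map_take.
apply: (mseq_reindex (h := fun U s => mask m (take k s) ++ drop k s)) => // U V f s.
by rewrite map_cat map_mask map_take map_drop.
Qed.

Lemma overlap_ge0 k F G m s : (forall s, 0 <= F s) -> (forall s, 0 <= G s) ->
  0 <= overlap k F G m s.
Proof. by move=> F0 G0; rewrite mule_ge0. Qed.

(** Contribution of the pairs formed by a k-tuple and an l-tuple with r points in common, up to the
    number of ways to place these points. *)
Definition joint_section k l F G r : \bar R :=
  itint mu r (fun z => itint mu (k - r) (fun y => F (z ++ y)) *
                       itint mu (l - r) (fun y => G (z ++ y))).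

Lemma natE_ge0 n : 0 <= (n%:R : R)%:E.
Proof. by rewrite lee_fin. Qed.

(** The masks are split by their first bit, that is, by whether the first point [a] of the first
    tuple also belongs to the second. *)
Lemma itint_overlap_step k l F G :
  mseq F -> mseq G -> (forall s, 0 <= F s) -> (forall s, 0 <= G s) ->
  \sum_(m <- masks k.+1) (l ^_ (count id m))%:R%:E *
    itint mu (k.+1 + (l - count id m)) (overlap k.+1 F G m) =
  \int[mu]_a \sum_(m <- masks k) (l ^_ (count id m))%:R%:E *
    itint mu (k + (l - count id m)) (overlap k (fun s => F (a :: s)) G m) +
  l%:R%:E * \int[mu]_a \sum_(m <- masks k) (l.-1 ^_ (count id m))%:R%:E *
    itint mu (k + (l.-1 - count id m)) (overlap k (fun s => F (a :: s)) (fun s => G (a :: s)) m).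
Proof.
move=> mF mG F0 G0 /=.
have o0 m s : 0 <= overlap k.+1 F G m s by exact: overlap_ge0.
have mo n m : measurable_fun setT (fun a => itint mu n (fun s => overlap k.+1 F G m (a :: s))).
  by apply: measurable_itint => //; exact: mseq_overlap.
rewrite big_cat !big_map /=; congr (_ + _).
  rewrite (@ge0_integral_sum _ _ _ mu _ measurableT _ (fun m a => (l ^_ (count id m))%:R%:E *
    itint mu (k + (l - count id m)) (fun s => overlap k.+1 F G (false :: m) (a :: s)))).
  - apply: eq_bigr => m _; rewrite ge0_integralZl ?natE_ge0//.
    by move=> a _; exact: itint_ge0.
  - by move=> m; apply: emeasurable_funM => //; exact: measurable_cst.
  - by move=> m a _; rewrite mule_ge0 ?natE_ge0//; exact: itint_ge0.
case: l => [|l].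
  by rewrite mul0e big1// => m _; rewrite add1n ffact0n mul0e.
rewrite (@ge0_integral_sum _ _ _ mu _ measurableT _ (fun m a => (l ^_ (count id m))%:R%:E *
    itint mu (k + (l - count id m)) (fun s => overlap k.+1 F G (true :: m) (a :: s)))).
- rewrite ge0_sume_distrr => [|m _]; last first.
    apply: integral_ge0 => a _; rewrite mule_ge0 ?natE_ge0//; exact: itint_ge0.
  apply: eq_bigr => m _; rewrite ge0_integralZl ?natE_ge0//; last first.
    by move=> a _; exact: itint_ge0.
  by rewrite add1n ffactSS subSS natrM EFinM muleA.
- by move=> m; apply: emeasurable_funM => //; exact: measurable_cst.
- by move=> m a _; rewrite mule_ge0 ?natE_ge0//; exact: itint_ge0.
Qed.

Lemma itint_overlap k l F G :
  mseq F -> mseq G -> (forall s, 0 <= F s) -> (forall s, 0 <= G s) ->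
  symmetric F -> symmetric G ->
  \sum_(m <- masks k) (l ^_ (count id m))%:R%:E *
    itint mu (k + (l - count id m)) (overlap k F G m) =
  \sum_(r < k.+1) ('C(k, r) * l ^_ r)%:R%:E * joint_section k l F G r.
Proof.
elim: k l F G => [|k ih] l F G mF mG F0 G0 sF sG.
  rewrite big_seq1 big_ord1 /= ffactn0 bin0 mul1e muln1 mul1e add0n subn0.
  rewrite /joint_section /= !subn0 -itintZl//.
  by apply: eq_itint => s _; rewrite /overlap take0 drop0.
pose X r := joint_section k.+1 l F G r.
rewrite itint_overlap_step//.
(* In [P] the first entry is a point of the first tuple only, hence the [behead] in the argument of
   G; in [Q] it is common to both tuples. *)
pose P r s := itint mu (k - r) (fun y => F (s ++ y)) *
  itint mu (l - r) (fun y => G (behead s ++ y)).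
pose Q r s := itint mu (k - r) (fun y => F (s ++ y)) *
  itint mu (l.-1 - r) (fun y => G (s ++ y)).
have P0 r s : 0 <= P r s by rewrite mule_ge0//; apply: itint_ge0.
have Q0 r s : 0 <= Q r s by rewrite mule_ge0//; apply: itint_ge0.
have mP r : mseq (P r).
  apply: mseqM; first exact: mseq_itint.
  exact: (mseq_behead (F := fun s => itint mu (l - r) (fun y => G (s ++ y)))
    (mseq_itint mu (l - r) mG G0)).
have mQ r : mseq (Q r) by apply: mseqM; exact: mseq_itint.
have mcs (S : nat -> seq T -> \bar R) (c : nat -> nat) : (forall r, mseq (S r)) ->
    (forall r s, 0 <= S r s) ->
    \int[mu]_a (\sum_(r < k.+1) (c r)%:R%:E * itint mu r (fun s => S r (a :: s))) =
    \sum_(r < k.+1) (c r)%:R%:E * \int[mu]_a itint mu r (fun s => S r (a :: s)).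
  move=> mS S0; rewrite (@ge0_integral_sum _ _ _ mu _ measurableT _ (fun (r : 'I_k.+1) a =>
    (c r)%:R%:E * itint mu r (fun s => S r (a :: s)))).
  - apply: eq_bigr => r _; rewrite ge0_integralZl ?natE_ge0//.
      exact: measurable_itint.
    by move=> a _; exact: itint_ge0.
  - move=> r; apply: emeasurable_funM; [exact: measurable_cst|exact: measurable_itint].
  - by move=> r a _; rewrite mule_ge0 ?natE_ge0//; exact: itint_ge0.
rewrite (eq_integral (fun a => \sum_(r < k.+1) ('C(k, r) * l ^_ r)%:R%:E *
    itint mu r (fun s => P r (a :: s)))); last first.
  by move=> a _; apply: ih => //; [apply: mseq_cons|apply: symmetric_cons].
rewrite [in X in _ + _ * X](eq_integral (fun a => \sum_(r < k.+1) ('C(k, r) * l.-1 ^_ r)%:R%:E *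
    itint mu r (fun s => Q r (a :: s)))); last first.
  move=> a _; apply: ih => //; [exact: mseq_cons|exact: mseq_cons|exact: symmetric_cons|].
  exact: symmetric_cons.
rewrite (mcs P (fun r => 'C(k, r) * l ^_ r)%N)// (mcs Q (fun r => 'C(k, r) * l.-1 ^_ r)%N)//.
have PX (r : 'I_k.+1) : \int[mu]_a itint mu r (fun s => P r (a :: s)) = X r.
  rewrite itint_swap//; apply: eq_itint => z _; rewrite /P /=.
  rewrite ge0_integralZr//; last 3 first.
  - apply: (mseq_comp (F := fun s => itint mu (k - r) (fun y => F (s ++ y)))
      (g := fun a => a :: z) (n := (size z).+1)) => //; first exact: mseq_itint.
    by case=> [|i] _ /=; [exact: measurable_id|exact: measurable_cst].
  - by move=> a _; exact: itint_ge0.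
  - exact: itint_ge0.
  congr (_ * _); rewrite (subSn (ltn_ord r : r <= k)%N) /=; apply: eq_integral => a _.
  by apply: eq_itint => s _; apply: sF; rewrite -cat_cons (perm_catCA [:: a] z s).
have QX (r : 'I_k.+1) : (0 < l)%N -> \int[mu]_a itint mu r (fun s => Q r (a :: s)) = X r.+1.
  move=> l0; rewrite /X /joint_section /= subSS.
  by rewrite (_ : l - r.+1 = l.-1 - r)%N//; lia.
rewrite [RHS]big_ord_recl bin0 ffactn0 mul1n mul1e -/(X 0%N).
rewrite [X in _ = _ + X] (eq_bigr (fun i : 'I_k.+1 => ('C(k, i.+1) * l ^_ i.+1)%:R%:E * X i.+1 +
    ('C(k, i) * l ^_ i.+1)%:R%:E * X i.+1)); last first.
  move=> i _; rewrite lift0 -/(X i.+1) binS mulnDl natrD EFinD ge0_muleDl ?natE_ge0//.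
rewrite big_split /= addeA; congr (_ + _).
  rewrite (eq_bigr (fun r : 'I_k.+1 => ('C(k, r) * l ^_ r)%:R%:E * X r)); last by move=> r _; rewrite PX.
  rewrite big_ord_recl /= bin0 ffactn0 mul1n mul1e; congr (_ + _).
  by rewrite big_ord_recr /= bin_small// mul0n mul0e adde0.
(* For l = 0 the arithmetic with [l.-1] breaks down, but both sides carry a factor 0. *)
have [->|l0] := posnP l.
  by rewrite mul0e big1// => i _; rewrite ffact0n muln0 mul0e.
rewrite ge0_sume_distrr => [|r _]; last first.
  by rewrite mule_ge0 ?natE_ge0//; apply: integral_ge0 => a _; exact: itint_ge0.
apply: eq_bigr => r _; rewrite QX// muleA -EFinM -natrM mulnCA.
by rewrite -ffactnS.
Qed.

End overlap_integral.

(** * Integer-valued measures on countably based spaces *)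

Section atomic_measures.
Context {R : realType} {d : measure_display} {T : measurableType d}.

Lemma integral_set1_atom (nu : {measure set T -> \bar R}) x h :
  measurable [set x] -> measurable_fun setT h -> (forall y, 0 <= h y) ->
  \int[nu]_(y in [set x]) h y = h x * nu [set x].
Proof.
move=> mx mh h0; rewrite -(@integral_cst _ _ _ nu _ mx).
by apply: eq_integral => y /[!inE] ->.
Qed.

(** An enumeration of D cuts it into fibres that are empty or singletons, over which both sides are
    countably additive. *)
Lemma ge0_integral_atomic (nu : {measure set T -> \bar R}) (D : set T) h :
  (forall x, measurable [set x : T]) -> countable D -> nu (~` D) = 0 ->
  measurable_fun setT h -> (forall y, 0 <= h y) ->
  \int[nu]_y h y = \esum_(x in D) (h x * nu [set x]).
Proof.
move=> m1 cD nuD mh h0; have mD : measurable D by exact: countable_measurable.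
rewrite (ge0_negligible_integral (measurableC mD))// setDE setCK setTI.
have /countable_injP[f finj] := cD.
pose F n := D `&` f @^-1` [set n].
have F1 n x : F n x -> F n = [set x].
  move=> [Dx /= fx]; apply/seteqP; split => [y [Dy /= fy]|_ ->//].
  by apply: finj; rewrite ?inE// fx fy.
have DF : D = \bigcup_n F n.
  by apply/seteqP; split => [x Dx|x [n _ []//]]; exists (f x).
have tF : trivIset setT F.
  by move=> i j _ _ [x [[_ /= <-] [_ /= <-]]].
have mF n : measurable (F n).
  have [->//|/set0P[x Fx]] := eqVneq (F n) set0.
  by rewrite (F1 _ _ Fx).
rewrite [in LHS]DF ge0_integral_bigcup//; last exact: measurable_funTS.
rewrite [in RHS]DF nneseries_sum_bigcup// => [|x]; last by rewrite mule_ge0.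
apply: eq_eseriesr => n _.
have [->|/set0P[x Fx]] := eqVneq (F n) set0.
  by rewrite integral_set0 esum_set0.
by rewrite (F1 _ _ Fx) integral_set1_atom// esum_set1// mule_ge0.
Qed.

End atomic_measures.

Section point_base.
Context {d : measure_display} {T : measurableType d}.
Variable V : nat -> set T.

(** The trace of a second countable Hausdorff topology on which the measure theory below relies;
    only countably many sets occur, so that what is built from them is measurable. *)
Definition point_base :=
  [/\ forall i, measurable (V i),
      forall x y, x <> y -> exists i j, [/\ V i x, V j y & V i `&` V j = set0],
      forall x, exists i, V i x
    & forall x i j, V i x -> V j x -> exists l, V l x /\ V l `<=` V i `&` V j].

Hypothesis bV : point_base.

Lemma measurable_base i : measurable (V i).
Proof. by case: bV => + _ _ _; exact. Qed.

Lemma measurable_point (x : T) : measurable [set x].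
Proof.
have [mV sV _ _] := bV.
rewrite (_ : [set x] = \bigcap_n (if pselect (V n x) then V n else setT)).
  by apply: bigcapT_measurable => n; case: pselect => ? /=; [exact: mV|exact: measurableT].
apply/seteqP; split => [_ -> n _|y h]; first by case: pselect.
apply: contrapT => yx; have [i [j [Vi Vj ij]]] := sV y x yx.
have := h j I; case: pselect => // Vjx' Vjy.
by rewrite -[False]/((set0 : set T) y) -ij; split.
Qed.

(** The complement is the union of the countably many rectangles whose sides are disjoint members of
    the family. *)
Lemma measurable_diagonal : measurable [set p : T * T | p.1 = p.2].
Proof.
have [mV sV _ _] := bV.
rewrite -[X in measurable X]setCK; apply: measurableC.
pose sep (p : nat * nat) := if pselect (V p.1 `&` V p.2 = set0)
  then V p.1 `*` V p.2 else set0.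
rewrite (_ : ~` _ = \bigcup_p sep p).
  apply: countable_bigcupT_measurable => [|p]; first exact: countableP.
  by rewrite /sep; case: pselect => ?; [exact: measurableX|exact: measurable0].
apply/seteqP; split => [[x y] /= xy|[x y] [[i j] _]].
  have [i [j [Vi Vj ij]]] := sV _ _ xy; exists (i, j) => //=.
  by rewrite /sep; case: pselect.
rewrite /sep; case: pselect => //= ij [/= Vix Vjy] xy.
by rewrite -[False]/((set0 : set T) y) -ij; split => //; rewrite -xy.
Qed.

Lemma measurable_uniq n : measurable [set t : n.-tuple T | uniq t].
Proof.
rewrite (_ : [set _ | _] = \bigcap_(p in [set p : 'I_n * 'I_n | p.1 != p.2])
    (fun t => (tnth t p.1, tnth t p.2)) @^-1` (~` [set p : T * T | p.1 = p.2])).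
  apply: fin_bigcap_measurable => // -[i j] _ /=.
  rewrite -[X in measurable X]setTI; apply: measurable_fun_pair => //.
  - exact: measurable_tnth.
  - exact: measurable_tnth.
  - by apply: measurableC; exact: measurable_diagonal.
apply/seteqP; split => [t /= ut [i j] /= ij e|t /= h].
  by move/negP: ij; apply; rewrite (tuple_uniqP t ut _ _ e).
by apply/tuple_uniqP => i j e; apply/eqP/negPn/negP => ij; exact: (h (i, j) ij).
Qed.

(** Neighbourhoods of x decreasing to the singleton {x}, by [bigcap_approx]; each contains a member
    of the base around x, by [sub_approx]. *)
Definition approx (x : T) n : set T :=
  \bigcap_(i in `I_n) (if pselect (V i x) then V i else setT).

Lemma approxP x n y : approx x n y <-> forall i, (i < n)%N -> V i x -> V i y.
Proof.
split=> [h i /h|h i iltn /=]; first by case: pselect.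
by case: pselect => // Vix; exact: h.
Qed.

Lemma measurable_approx x n : measurable (approx x n).
Proof.
have [mV _ _ _] := bV.
by apply: fin_bigcap_measurable => // i _; case: pselect => ? /=; [exact: mV|exact: measurableT].
Qed.

Lemma sub_approx x n : exists l, V l x /\ V l `<=` approx x n.
Proof.
have [mV _ eV iV] := bV.
elim: n => [|n [l [Vlx lsub]]].
  by have [l Vlx] := eV x; exists l; split => // y _ i.
have [Vnx|Vnx] := pselect (V n x).
  have [l' [Vl'x l'sub]] := iV x l n Vlx Vnx; exists l'; split => // y /l'sub[Vly Vny].
  apply/approxP => i; rewrite ltnS leq_eqVlt => /orP[/eqP -> //|ni Vix].
  by have /approxP := lsub _ Vly; apply.
exists l; split => // y Vly; apply/approxP => i; rewrite ltnS leq_eqVlt => /orP[/eqP -> //|ni Vix].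
by have /approxP := lsub _ Vly; apply.
Qed.

Lemma bigcap_approx (x : T) : \bigcap_n approx x n = [set x].
Proof.
have [_ sV _ _] := bV.
apply/seteqP; split => [y h|_ -> n _]; last exact/approxP.
apply: contrapT => yx; have [i [j [Vi Vj ij]]] := sV y x yx.
have /approxP/(_ j (ltnSn j) Vj) Vjy := h j.+1 I.
by rewrite -[False]/((set0 : set T) y) -ij; split.
Qed.

Section counting.
Context {R : realType}.
Variable m : {measure set T -> \bar R}.

Definition base_finite := forall x, exists i, V i x /\ m (V i) < +oo.
Definition integer_valued :=
  forall A, measurable A -> m A = +oo \/ exists j : nat, m A = j%:R%:E.
Definition support : set T := [set x | 0 < m [set x]].

Hypotheses (fm : base_finite) (im : integer_valued).

(** From some index on the masses of the sets [approx x n] are natural numbers and do not increase,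
    so a least one is attained; beyond it only null sets are removed, and in the limit everything
    but x has been removed. *)
Lemma isolating_base (x : T) : exists l, [/\ V l x, m (V l) < +oo & m (V l `\ x) = 0].
Proof.
have [mV _ _ _] := bV.
have [i0 [Vi0x Vi0oo]] := fm x.
have fin n : (i0 < n)%N -> m (approx x n) < +oo.
  move=> i0n; apply: le_lt_trans Vi0oo; apply: le_measure; rewrite ?inE//.
  - exact: measurable_approx.
  - by move=> y /approxP; apply.
pose P j := `[< exists2 n, (i0 < n)%N & m (approx x n) = j%:R%:E >].
have exP : exists j, P j.
  have [e|[j mj]] := im (measurable_approx x i0.+1).
    by have := fin i0.+1 (ltnSn _); rewrite e.
  by exists j; apply/asboolP; exists i0.+1.
have [j /asboolP[n i0n mn] jmin] := ex_minnP exP.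
have mn' k : m (approx x n `\` approx x (n + k)) = 0.
  have sub : approx x (n + k) `<=` approx x n.
    by move=> y /approxP h; apply/approxP => i ni; apply: h; rewrite ltn_addr.
  rewrite measureD; [|exact: measurable_approx|exact: measurable_approx|exact: fin].
  rewrite (setIidr sub).
  have i0nk : (i0 < n + k)%N by rewrite ltn_addr.
  have [e|[j' mj']] := im (measurable_approx x (n + k)).
    by have := fin _ i0nk; rewrite e.
  have jj' : (j <= j')%N by apply: jmin; apply/asboolP; exists (n + k)%N.
  have : m (approx x (n + k)) <= m (approx x n).
    by apply: le_measure => //; rewrite inE; exact: measurable_approx.
  rewrite mn mj' lee_fin ler_nat => j'j.
  transitivity (j%:R%:E - j'%:R%:E : \bar R); first by congr (_ - _).
  have -> : j = j' by apply/eqP; rewrite eqn_leq jj'.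
  by rewrite subee.
have [l [Vlx lsub]] := sub_approx x n; exists l; split => //.
  apply: le_lt_trans (fin _ i0n); apply: le_measure; rewrite ?inE//.
  exact: measurable_approx.
have mz : m.-negligible (\bigcup_k (approx x n `\` approx x (n + k))).
  apply: negligible_bigcup => k; apply/negligibleP; last exact: mn'.
  by apply: measurableD; exact: measurable_approx.
apply/negligibleP; first by apply: measurableD; [exact: mV|exact: measurable_point].
apply: negligibleS mz => y [/lsub yn yx].
have : ~ (\bigcap_k approx x k) y by rewrite bigcap_approx.
move=> /existsNP[k /not_implyP[_ yk]]; exists k => //; split => //.
by move=> /approxP h; apply: yk; apply/approxP => i ik; apply: h; rewrite ltn_addl.
Qed.

(** The indices of isolating sets inject the support into [nat]: a second atom sharing the set of x
    would lie in its null part. *)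
Lemma countable_support : countable support.
Proof.
apply/countable_injP.
have /choice[f fP] := isolating_base.
exists f => x y /[!inE] sx sy fxy.
apply: contrapT => xy; have [Vx _ mx] := fP x; have [Vy _ my] := fP y.
have : m [set x] <= m (V (f y) `\ y).
  apply: le_measure; rewrite ?inE; first exact: measurable_point.
    by apply: measurableD; [exact: measurable_base|exact: measurable_point].
  by move=> _ ->; split => //; rewrite -fxy.
by rewrite my; apply/negP; rewrite -ltNge.
Qed.

Lemma measurable_support : measurable support.
Proof. by apply: countable_measurable => //; [exact: measurable_point|exact: countable_support]. Qed.

(** Around a point that is not an atom the isolating set itself is null, and there are only
    countably many base sets. *)
Lemma measure_supportC : m (~` support) = 0.
Proof.
pose W i := if pselect (m (V i) = 0) then V i else set0.
apply/negligibleP; first by apply: measurableC; exact: measurable_support.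
apply: (@negligibleS _ _ _ m (\bigcup_i W i)).
  move=> x /negP; rewrite -leNgt => mx0.
  have [l [Vlx loo lx]] := isolating_base x; exists l => //.
  rewrite /W; case: pselect => // h; exfalso; apply: h.
  apply/eqP; rewrite eq_le measure_ge0 andbT.
  rewrite -(setD1K Vlx) (le_trans (measureU2 _ _ _))//; [exact: measurable_point| |].
    by apply: measurableD; [exact: measurable_base|exact: measurable_point].
  by rewrite [X in _ + X]lx adde0.
apply: negligible_bigcup => i; rewrite /W; case: pselect => [e|?].
  by apply/negligibleP => //; exact: measurable_base.
exact: negligible_set0.
Qed.

End counting.

End point_base.

(** * Measurability of sums over the support *)

Section kernel_comp.
Context {R : realType} {d d' d'' : measure_display} {Z : measurableType d''}
  {X : measurableType d} {Y : measurableType d'}.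
Variables (k : R.-fker X ~> Y) (g : Z -> X) (mg : measurable_fun setT g).

(** Reparametrizes [k] along [g], so that integrands may depend on a parameter z richer than the
    source of the kernel; the measurability of [g] is an argument for the sake of the kernel
    structure. *)
Definition kernel_comp of measurable_fun setT g : Z -> {measure set Y -> \bar R} := k \o g.

Let measurable_kernel_comp U : measurable U -> measurable_fun setT (kernel_comp mg ^~ U).
Proof.
by move=> mU; exact: (measurableT_comp (measurable_kernel k _ mU) mg).
Qed.

HB.instance Definition _ := isKernel.Build _ _ _ _ _ (kernel_comp mg) measurable_kernel_comp.

Let kernel_comp_uub : measure_fam_uub (kernel_comp mg).
Proof. by have [r kr] := measure_uub k; exists r => z; exact: kr. Qed.

HB.instance Definition _ := Kernel_isFinite.Build _ _ _ _ _ (kernel_comp mg) kernel_comp_uub.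

Lemma measurable_integral_kernel_comp (h : Z * Y -> \bar R) :
  measurable_fun setT h -> (forall p, 0 <= h p) ->
  measurable_fun setT (fun z => \int[k (g z)]_y h (z, y)).
Proof.
by move=> mh h0; exact: (measurable_fun_integral_finite_kernel h (kernel_comp mg)).
Qed.

End kernel_comp.

Section support_sums.
Context {R : realType} {d : measure_display} {T : measurableType d}.
Context {dO : measure_display} {Omega : measurableType dO}.
Variable V : nat -> set T.
Hypothesis bV : point_base V.
Variable eta : R.-ker Omega ~> T.
Hypotheses (feta : forall w, base_finite V (eta w)) (ieta : forall w, integer_valued (eta w)).

Let idx N : nat * nat := odflt (0, 0)%N (unpickle N).

(** With [idx N] equal to (i, j), the set V i is charged only if its mass is at most j, so that
    division by j + 1 bounds the N-th term of the series below by 2^-N. *)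
Let weight N w : R :=
  if eta w (V (idx N).1) <= (idx N).2%:R%:E then (2^-1 ^+ N / (idx N).2.+1%:R)%R else 0%R.

Let weight_ge0 N w : (0 <= weight N w)%R.
Proof. by rewrite /weight; case: ifP => // _; rewrite divr_ge0// exprn_ge0. Qed.

Let measurable_weight N : measurable_fun setT (weight N).
Proof.
apply: measurable_fun_ifT => //.
apply: (measurable_fun_bool true); rewrite setTI.
rewrite (_ : _ @^-1` _ = [set w | eta w (V (idx N).1) <= (idx N).2%:R%:E]).
  rewrite -[X in measurable X]setTI; apply: emeasurable_fun_infty_c => //.
  exact/measurable_kernel/measurable_base.
by apply/seteqP; split.
Qed.

(* A finite kernel with the same support as [eta], which need not be
   [s]-finite a priori: the covering sets of finite [eta w]-mass depend
   on [w]. *)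
Definition bounded_kernel (w : Omega) : {measure set T -> \bar R} :=
  mseries (fun N => mscale (NngNum (weight_ge0 N w))
    (mrestr (eta w) (measurable_base bV (idx N).1))) 0.

Lemma bounded_kernelE w A :
  bounded_kernel w A = \sum_(N <oo) (weight N w)%:E * eta w (A `&` V (idx N).1).
Proof. by []. Qed.

Lemma measurable_bounded_kernel A : measurable A ->
  measurable_fun setT (bounded_kernel ^~ A).
Proof.
move=> mA; under eq_fun do rewrite bounded_kernelE.
apply: ge0_emeasurable_sum => [N w _ _|N _].
  by rewrite mule_ge0 ?lee_fin.
apply: emeasurable_funM; first exact/measurable_EFinP.
by apply: measurable_kernel; apply: measurableI => //; exact: measurable_base.
Qed.

Lemma bounded_kernel_le w : bounded_kernel w setT <= 2%:E.
Proof.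
rewrite bounded_kernelE.
have h N : (weight N w)%:E * eta w (setT `&` V (idx N).1) <= (2^-1 ^+ N)%:E.
  rewrite setTI /weight; case: ifPn => h; last first.
    by rewrite mul0e lee_fin exprn_ge0.
  apply: (@le_trans _ _ ((2^-1 ^+ N / (idx N).2.+1%:R)%R%:E * (idx N).2%:R%:E)).
    by rewrite lee_wpmul2l// lee_fin divr_ge0// exprn_ge0.
  rewrite -EFinM lee_fin -mulrA ler_piMr// ?exprn_ge0//.
  by rewrite mulrC ler_pdivrMr// mul1r ler_nat.
apply: lime_le.
  by apply: is_cvg_nneseries => N _ _; rewrite mule_ge0 ?lee_fin.
apply: nearW => n; apply: (@le_trans _ _ (2 - 2 * 2^-1 ^+ n)%R%:E); last first.
  by rewrite lee_fin gerBl mulr_ge0// exprn_ge0.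
elim: n => [|n ih]; first by rewrite big_nil expr0 mulr1 subrr.
rewrite big_nat_recr//=; apply: le_trans (leeD ih (h n)) _.
by rewrite -EFinD lee_fin exprS; lra.
Qed.

HB.instance Definition _ := isKernel.Build _ _ _ _ _ bounded_kernel
  (fun A mA => @measurable_bounded_kernel A mA).

Lemma bounded_kernel_uub : measure_fam_uub bounded_kernel.
Proof.
by exists 3%R => w; apply: le_lt_trans (bounded_kernel_le w) _; rewrite lte_fin; lra.
Qed.

HB.instance Definition _ := Kernel_isFinite.Build _ _ _ _ _ bounded_kernel bounded_kernel_uub.

Lemma bounded_kernel_point w x :
  (0 < bounded_kernel w [set x]) = (0 < eta w [set x]).
Proof.
have m1 := measurable_point bV.
apply/idP/idP => h.
  rewrite lt0e measure_ge0 andbT; apply/eqP => e; move: h.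
  rewrite bounded_kernelE eseries0 ?ltxx// => N _ _.
  rewrite (_ : eta w _ = 0) ?mule0//; apply/eqP; rewrite eq_le measure_ge0 andbT -e.
  by apply: le_measure; rewrite ?inE//; apply: measurableI => //; exact: measurable_base.
have [i [Vix ioo]] := feta w x.
have [e|[j ej]] := ieta w (measurable_base bV i); first by rewrite e in ioo.
pose N := pickle (i, j).
have Nij : idx N = (i, j) by rewrite /idx pickleK.
have w0 : (0 < weight N w)%R.
  by rewrite /weight Nij /= ej lexx divr_gt0// exprn_gt0.
apply: (@lt_le_trans _ _ ((weight N w)%:E * eta w ([set x] `&` V (idx N).1))).
  by rewrite mule_gt0// Nij setIidl// => _ ->.
rewrite bounded_kernelE.
apply: (le_trans _ (nneseries_lim_ge N.+1 _)) => [|n _ _]; last by rewrite mule_ge0 ?lee_fin.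
by rewrite big_nat_recr//= leeDr// sume_ge0// => n _; rewrite mule_ge0 ?lee_fin.
Qed.

Lemma bounded_kernel_supportC w : bounded_kernel w (~` support (eta w)) = 0.
Proof.
rewrite bounded_kernelE eseries0// => N _ _.
rewrite (_ : eta w _ = 0) ?mule0//; apply/eqP; rewrite eq_le measure_ge0 andbT.
rewrite -(measure_supportC bV (feta w) (ieta w)).
have mS : measurable (~` support (eta w)).
  by apply: measurableC; exact: (measurable_support bV (feta w) (ieta w)).
by apply: le_measure; rewrite ?inE//; apply: measurableI => //; exact: measurable_base.
Qed.

Let zeta : R.-fker Omega ~> T := bounded_kernel.

Let zeta_fin w x : zeta w [set x] \is a fin_num.
Proof.
rewrite ge0_fin_numE// (le_lt_trans _ (ltry 2))//.
apply: le_trans (bounded_kernel_le w); apply: le_measure; rewrite ?inE//.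
exact: (measurable_point bV).
Qed.

(** The mass of a varying point is the integral of the indicator of the diagonal, which depends
    measurably on the parameter. *)
Let measurable_zeta_point : measurable_fun setT (fun p : Omega * T => zeta p.1 [set p.2]).
Proof.
pose h (p : (Omega * T) * T) : \bar R := (\1_[set q : T * T | q.1 = q.2] (p.1.2, p.2))%:E.
have mh : measurable_fun setT h.
  apply/measurable_EFinP; apply: measurableT_comp.
    by apply: measurable_indic; exact: (measurable_diagonal bV).
  apply: measurable_fun_pair; last exact: measurable_snd.
  by apply: (measurableT_comp (f := snd)); [exact: measurable_snd|exact: measurable_fst].
have h0 p : 0 <= h p by rewrite lee_fin.
have := measurable_integral_kernel_comp zeta measurable_fst mh h0.
apply: eq_measurable_fun => -[w x] _ /=.
rewrite -[in RHS](setIT [set x]) -integral_indic//; last exact: (measurable_point bV).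
apply: eq_integral => y _; rewrite /h /= !indicE; congr ((nat_of_bool _)%:R%:E).
by apply/idP/idP => /set_mem /= xy; apply/mem_set => /=.
Qed.

(** The sum is the integral, against the finite kernel with the same support, of h divided by the
    mass of the point; such integrals depend measurably on parameters. *)
Lemma measurable_support_esum dZ (Z : measurableType dZ) (g : Z -> Omega)
    (h : Z * T -> \bar R) : measurable_fun setT g ->
  measurable_fun setT h -> (forall p, 0 <= h p) ->
  measurable_fun setT (fun z => \esum_(x in support (eta (g z))) h (z, x)).
Proof.
move=> mg mh h0; have m1 := measurable_point bV.
(* The exponent -1 gives the reciprocal; it matters only at points of the support, where the mass is
   positive. *)
pose H (p : Z * T) := h p * (powR (fine (zeta (g p.1) [set p.2])) (-1))%:E.
have H0 p : 0 <= H p by rewrite mule_ge0// lee_fin powR_ge0.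
have mH : measurable_fun setT H.
  apply: emeasurable_funM => //; apply/measurable_EFinP.
  apply: (measurableT_comp (f := @powR R ^~ (-1))%R); first exact: measurable_powR.
  apply: (measurableT_comp (f := @fine R)); first exact: fine_measurable.
  apply: (measurableT_comp (f := fun p : Omega * T => zeta p.1 [set p.2])
    (g := fun p : Z * T => (g p.1, p.2))); first exact: measurable_zeta_point.
  apply: measurable_fun_pair; last exact: measurable_snd.
  by apply: measurableT_comp => //; exact: measurable_fst.
have := measurable_integral_kernel_comp zeta mg mH H0.
apply: eq_measurable_fun => z _ /=.
have mHz : measurable_fun setT (fun x => H (z, x)).
  by apply: (measurableT_comp (f := H)) => //; exact: pair1_measurable.
rewrite (ge0_integral_atomic (nu := bounded_kernel (g z)) m1
  (countable_support bV (feta (g z)) (ieta (g z))) (bounded_kernel_supportC (g z)) mHz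
  (fun x => H0 (z, x))).
apply: eq_esum => x sx; rewrite /H /=.
have zx0 : 0 < zeta (g z) [set x] by rewrite bounded_kernel_point.
rewrite -muleA -[X in _ * (_ * X)](fineK (zeta_fin _ _)) -EFinM powR_inv1.
  by rewrite mulVf ?mule1// gt_eqF// fine_gt0// zx0 ltey_eq zeta_fin.
by rewrite fine_ge0// ltW.
Qed.

(** The prefix records the points already chosen; the induction is on the number of points still to
    be summed. *)
Lemma measurable_dsum_prefix n m (F : seq T -> \bar R) : mseq F -> (forall s, 0 <= F s) ->
  measurable_fun setT (fun p : Omega * m.-tuple T =>
    dsum n (fun s => F (p.2 ++ s)) (support (eta p.1) `\` [set` (p.2 : seq T)])).
Proof.
move=> mF F0; elim: n m => [|n ih] m.
  apply: (mseq_comp (g := fun p : Omega * m.-tuple T => p.2 ++ [::]) (n := m) mF).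
    by move=> p; rewrite cats0 size_tuple.
  move=> i im; under eq_fun do rewrite cats0.
  by apply: (measurableT_comp (measurable_nth _)); exact: measurable_snd.
(* Zero at the points of the prefix, so that the sum over the remaining points becomes a sum over
   the whole support. *)
pose h (q : (Omega * m.-tuple T) * T) := if q.2 \in (q.1.2 : seq T) then 0 else
  dsum n (fun s => F (rcons q.1.2 q.2 ++ s))
    (support (eta q.1.1) `\` [set` rcons q.1.2 q.2]).
have h0 q : 0 <= h q by rewrite /h; case: ifP => // _; apply: dsum_ge0.
have mh : measurable_fun setT h.
  apply: measurable_fun_ifT => //.
    apply: (measurable_fun_bool true); rewrite setTI.
    rewrite (_ : _ @^-1` _ = \bigcup_(i in [set: 'I_m])
        (fun q : (Omega * m.-tuple T) * T => (tnth q.1.2 i, q.2)) @^-1` [set q | q.1 = q.2]).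
      apply: fin_bigcup_measurable => // i _.
      rewrite -[X in measurable X]setTI; apply: measurable_fun_pair => //.
      - apply: (measurableT_comp (measurable_tnth i)).
        by apply: (measurableT_comp (f := snd)); [exact: measurable_snd|exact: measurable_fst].
      - exact: (measurable_diagonal bV).
    apply/seteqP; split => q /=; first by move/tnthP => [i e]; exists i => //=; rewrite e.
    by move=> [i _ e]; apply/tnthP; exists i; exact: (esym e).
  pose G (q : (Omega * m.-tuple T) * T) : Omega * m.+1.-tuple T :=
    (q.1.1, [tuple of rcons q.1.2 q.2]).
  apply: (measurableT_comp (f := fun p : Omega * m.+1.-tuple T => dsum n (fun s =>
     F (p.2 ++ s)) (support (eta p.1) `\` [set` (p.2 : seq T)])) (g := G)); first exact: ih.
  apply: measurable_fun_pair => /=.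
    by apply: (measurableT_comp (f := fst)); [exact: measurable_fst|exact: measurable_fst].
  apply/measurable_fun_tnthP => i.
  rewrite (_ : _ \o _ = fun q : (Omega * m.-tuple T) * T => nth point (rcons q.1.2 q.2) i); last first.
    by apply/funext => q /=; rewrite (tnth_nth point).
  have [im|mi] := ltnP i m.
    under eq_fun do rewrite nth_rcons size_tuple im.
    apply: (measurableT_comp (measurable_nth _)).
    by apply: (measurableT_comp (f := snd)); [exact: measurable_snd|exact: measurable_fst].
  have -> : nat_of_ord i = m by apply/eqP; rewrite eqn_leq mi -ltnS ltn_ord.
  under eq_fun do rewrite nth_rcons size_tuple ltnn eqxx.
  exact: measurable_snd.
have := measurable_support_esum measurable_fst mh h0.
apply: eq_measurable_fun => -[w t] _ /=.
rewrite setDE esum_mkcondr; apply: eq_esum => x sx; rewrite /h /=.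
have [xt|xt] := boolP (x \in (t : seq T)).
  by rewrite memNset//= => /(_ xt).
rewrite mem_set/=; last by move/negP: xt.
rewrite -setDE.
have -> : support (eta w) `\` [set` rcons t x] = (support (eta w) `\` [set` t]) `\ x.
  apply/seteqP; split => y /=; rewrite mem_rcons inE.
    by move=> [sy /negP]; rewrite negb_or => /andP[/eqP yx /negP yt].
  by move=> [[sy yt] yx]; split => // /orP[/eqP|].
by apply: eq_dsum => s _; rewrite cat_rcons.
Qed.

Lemma measurable_dsum_support n (F : seq T -> \bar R) : mseq F -> (forall s, 0 <= F s) ->
  measurable_fun setT (fun w => dsum n F (support (eta w))).
Proof.
move=> mF F0; pose g w : Omega * 0.-tuple T := (w, [tuple]).
have mg : measurable_fun setT g.
  by apply: measurable_fun_pair; [exact: measurable_id|exact: measurable_cst].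
have gE w : [set` ((g w).2 : seq T)] = set0 by apply/seteqP; split.
rewrite (_ : (fun _ => _) = (fun p : Omega * 0.-tuple T => dsum n (fun s => F (p.2 ++ s))
    (support (eta p.1) `\` [set` (p.2 : seq T)])) \o g).
  by apply: measurableT_comp => //; exact: measurable_dsum_prefix.
by apply/funext => w; rewrite /comp gE setD0.
Qed.

End support_sums.

(** * Uniqueness of functionals on tuples *)

Section functionals.
Context {R : realType} {d : measure_display} {S : measurableType d}.
Implicit Types (f : S -> \bar R) (L : (S -> \bar R) -> \bar R).

(** An abstract form of integration against a measure, shared by expected sums over distinct tuples
    and by iterated integrals. *)
Definition nonneg_functional L :=
  [/\ forall f, (forall x, 0 <= f x) -> 0 <= L f,
      forall g : nat -> S -> \bar R, (forall n, measurable_fun setT (g n)) ->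
        (forall n x, 0 <= g n x) ->
        L (fun x => \sum_(n <oo) g n x) = \sum_(n <oo) L (g n)
    & forall (c : R) f, (0 <= c)%R -> measurable_fun setT f -> (forall x, 0 <= f x) ->
        L (fun x => c%:E * f x) = c%:E * L f].

Lemma nneseries2 (a : nat -> \bar R) : (forall n, (2 <= n)%N -> a n = 0) ->
  (forall n, 0 <= a n) -> \sum_(n <oo) a n = a 0%N + a 1%N.
Proof.
move=> a2 a0; rewrite (nneseries_split _ 2%N)//.
rewrite eseries0 ?adde0 => [|n n2 _]; last by rewrite a2.
by rewrite !big_nat_recr//= big_geq// add0e.
Qed.

Section representation.
Variable L : (S -> \bar R) -> \bar R.
Hypothesis fL : nonneg_functional L.

Let L0 : L (fun=> 0) = 0.
Proof.
have [_ _ LZ] := fL.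
transitivity (L (fun=> 0%:E * 0)); first by congr L; apply/funext => x; rewrite mul0e.
by rewrite LZ// mul0e.
Qed.

Let LD f g : measurable_fun setT f -> (forall x, 0 <= f x) ->
  measurable_fun setT g -> (forall x, 0 <= g x) ->
  L (fun x => f x + g x) = L f + L g.
Proof.
move=> mf f0 mg g0; have [L_ge0 LS _] := fL.
pose h n : S -> \bar R := if n is 0%N then f else if n is 1%N then g else fun=> 0.
have h0 n x : 0 <= h n x by case: n => [|[]]/=.
have h2 n : (2 <= n)%N -> h n = fun=> 0 by case: n => [|[]].
rewrite -[RHS](@nneseries2 (fun n => L (h n))); last 2 first.
- by move=> n /h2 ->.
- by move=> n; exact: L_ge0.
rewrite -LS//; last by case=> [|[|n]] /=; [exact: mf|exact: mg|exact: measurable_cst].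
by congr L; apply/funext => x; rewrite (@nneseries2 (fun n => h n x))// => n /h2 ->.
Qed.

Definition functional_measure of nonneg_functional L := fun A : set S => L (EFin \o \1_A).

Let mL := functional_measure fL.

Let mL0 : mL set0 = 0.
Proof. by rewrite /mL -[RHS]L0; congr L; apply/funext => x /=; rewrite indic0. Qed.

Let mL_ge0 A : 0 <= mL A.
Proof. by have [+ _ _] := fL; apply => x; rewrite lee_fin. Qed.

Let mL_sigma_additive : semi_sigma_additive mL.
Proof.
move=> F mF tF mUF; have [L_ge0 LS _] := fL.
have -> : mL (\bigcup_n F n) = \sum_(n <oo) mL (F n).
  rewrite -LS => [|n|n x]; last 2 first.
  - by apply/measurable_EFinP; exact: measurable_indic.
  - by rewrite lee_fin.
  by congr L; apply/funext => x /=; rewrite indic_bigcup.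
by apply: is_cvg_nneseries => n _ _; exact: mL_ge0.
Qed.

HB.instance Definition _ := isMeasure.Build _ _ _ mL mL0 mL_ge0 mL_sigma_additive.

Let L_sum (I : Type) (r : seq I) (f : I -> S -> \bar R) :
  (forall i, measurable_fun setT (f i)) -> (forall i x, 0 <= f i x) ->
  L (fun x => \sum_(i <- r) f i x) = \sum_(i <- r) L (f i).
Proof.
move=> mf f0; elim: r => [|i r ih].
  by rewrite big_nil -[RHS]L0; congr L; apply/funext => x; rewrite big_nil.
rewrite big_cons -ih -LD//.
- by congr L; apply/funext => x; rewrite big_cons.
- exact: emeasurable_sum.
- by move=> x; exact: sume_ge0.
Qed.

Import HBSimple HBNNSimple.

Let L_simple (e : {sfun S >-> R}) : (forall x, 0 <= e x)%R ->
  L (EFin \o e) = \int[mL]_x (e x)%:E.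
Proof.
move=> e0; have [L_ge0 LS LZ] := fL.
have mfe r : measurable_fun setT (EFin \o \1_(e @^-1` [set r]) : S -> \bar R).
  by apply/measurable_EFinP; apply: measurable_indic; exact: measurable_sfunP.
(* The maximum makes the coefficient nonnegative for every r; it changes nothing on the range of
   [e]. *)
pose r1 r x := (Num.max 0 r)%R%:E * (\1_(e @^-1` [set r]) x)%:E.
have mr r : measurable_fun setT (r1 r) by apply: measurable_funeM; exact: mfe.
have r0 r x : 0 <= r1 r x by rewrite mule_ge0 ?lee_fin// le_max lexx.
have eE x : (e x)%:E = \sum_(r <- finmap.enum_fset (fset_set (range e))) r1 r x.
  rewrite fimfunE -fsumEFin//= fsbig_finite//= !big_seq.
  apply: eq_bigr => r; rewrite in_fset_set// => /set_mem[y _ <-].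
  by rewrite /r1 max_r.
have -> : EFin \o e = (fun x => \sum_(r <- finmap.enum_fset (fset_set (range e))) r1 r x) by apply/funext.
rewrite L_sum//; under [RHS]eq_integral do rewrite eE.
rewrite ge0_integral_sum//; apply: eq_bigr => r _.
rewrite (LZ _ _ _ (mfe r)) ?le_max ?lexx//.
have -> : \int[mL]_x r1 r x =
    (Num.max 0 r)%R%:E * \int[mL]_x (EFin \o \1_(e @^-1` [set r])) x.
  apply: ge0_integralZl_EFin => //; first exact: mfe.
  by rewrite le_max lexx.
  by rewrite integral_indic ?setIT//; exact: measurable_sfunP.
by move=> x; rewrite lee_fin.
Qed.

(** A nonnegative measurable function is the series of the increments of its increasing simple
    approximations; the functional is additive over such series and agrees with the integral on
    simple functions. *)
Lemma functional_integral : exists m : {measure set S -> \bar R},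
  (forall A, m A = L (EFin \o \1_A)) /\
  forall f, measurable_fun setT f -> (forall x, 0 <= f x) -> L f = \int[m]_x f x.
Proof.
exists mL; split=> // f mf f0; have [L_ge0 LS LZ] := fL.
pose g := nnsfun_approx measurableT mf.
pose e n : {sfun S >-> R} := if n is k.+1 then ((g k.+1 : {sfun S >-> R}) - (g k : {sfun S >-> R}))%R else (g 0%N : {sfun S >-> R}).
have e0 n x : (0 <= e n x)%R.
  case: n => [|n] /=; first by [].
  by rewrite subr_ge0; exact/lefP/nd_nnsfun_approx.
have me n : measurable_fun setT (EFin \o e n) by exact/measurable_EFinP.
have fE x : f x = \sum_(n <oo) (EFin \o e n) x.
  apply/esym/cvg_lim => //.
  rewrite (_ : (fun n => _) = fun n => if n is k.+1 then (g k x)%:E else 0).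
    rewrite -cvg_shiftS /=; apply: cvg_nnsfun_approx => //.
  apply/funext; case=> [|n]; first by rewrite big_nil.
  elim: n => [|n ih]; first by rewrite big_nat1.
  by rewrite big_nat_recr//= ih -EFinD addrC subrK.
have -> : f = fun x => \sum_(n <oo) (EFin \o e n) x by apply/funext.
have e0' n x : 0 <= (EFin \o e n) x by rewrite lee_fin.
rewrite (LS _ me e0') integral_nneseries//.
by apply: eq_eseriesr => n _; rewrite L_simple.
Qed.

End representation.
End functionals.

(** * Functionals determined by their values on boxes *)

Section box_uniqueness.
Context {R : realType} {d : measure_display} {T : measurableType d}.
Implicit Types (F G : seq T -> \bar R) (B D : nat -> set T).

Definition seqlift n (f : n.-tuple T -> \bar R) (s : seq T) : \bar R :=
  oapp f 0 (insub s : option (n.-tuple T)).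

Lemma seqliftE n (f : n.-tuple T -> \bar R) (t : n.-tuple T) : seqlift f t = f t.
Proof. by rewrite /seqlift valK. Qed.

Lemma seqlift0 n (f : n.-tuple T -> \bar R) s : size s != n -> seqlift f s = 0.
Proof. by move=> sn; rewrite /seqlift insubF//; apply/negbTE. Qed.

Lemma seqlift_ge0 n (f : n.-tuple T -> \bar R) s :
  (forall t, 0 <= f t) -> 0 <= seqlift f s.
Proof. by move=> f0; rewrite /seqlift; case: insub => //= t. Qed.

Lemma mseq_seqlift n (f : n.-tuple T -> \bar R) : measurable_fun setT f -> mseq (seqlift f).
Proof.
move=> mf m; have [<-|mn] := eqVneq n m.
  by under eq_fun do rewrite seqliftE.
rewrite (_ : (fun _ => _) = cst 0)//.
by apply/funext => t; rewrite seqlift0// size_tuple eq_sym.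
Qed.

Definition box B n : set (n.-tuple T) := [set t | forall i : 'I_n, B i (tnth t i)].

Fixpoint boxf B (s : seq T) : \bar R :=
  if s is x :: s' then (\1_(B 0%N) x)%:E * boxf (fun i => B i.+1) s' else 1.

Lemma boxf_ge0 B s : 0 <= boxf B s.
Proof. by elim: s B => //= x s ih B; rewrite mule_ge0// lee_fin. Qed.

Lemma boxfE B n (t : n.-tuple T) : boxf B t = (\1_(box B (n := n)) t)%:E.
Proof.
elim: n B t => [|n ih] B t.
  by rewrite tuple0 /= indicE mem_set// => -[].
case/tupleP: t => x t /=; rewrite ih !indicE -EFinM; congr (_%:E).
rewrite -natrM mulnb; congr ((nat_of_bool _)%:R); apply/andP/idP.
  move=> [/set_mem B0 /set_mem h]; apply/mem_set => i.
  case: (unliftP ord0 i) => [j ->|->]; last by rewrite tnth0.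
  by rewrite tnthS; have := h j.
move/set_mem => h; split; apply/mem_set; first by have := h ord0; rewrite tnth0.
by move=> i; have := h (lift ord0 i); rewrite tnthS.
Qed.

Lemma boxf_mul B D s : boxf B s * boxf D s = boxf (fun i => B i `&` D i) s.
Proof.
elim: s B D => [|x s ih] B D /=; first by rewrite mul1e.
rewrite muleACA ih; congr (_ * _).
by rewrite -EFinM indicI.
Qed.

Lemma mseq_boxf B : (forall i, measurable (B i)) -> mseq (boxf B).
Proof.
move=> mB n; under eq_fun do rewrite boxfE.
apply/measurable_EFinP; apply: measurable_indic.
exact: (measurable_box (B := fun i : 'I_n => B i)).
Qed.

Definition seq_functional n (L : (seq T -> \bar R) -> \bar R) :=
  [/\ forall F G, (forall s, size s = n -> F s = G s) -> L F = L G,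
      forall F, (forall s, 0 <= F s) -> 0 <= L F,
      forall g : nat -> seq T -> \bar R, (forall j, mseq (g j)) ->
        (forall j s, 0 <= g j s) ->
        L (fun s => \sum_(j <oo) g j s) = \sum_(j <oo) L (g j)
    & forall (c : R) F, (0 <= c)%R -> mseq F -> (forall s, 0 <= F s) ->
        L (fun s => c%:E * F s) = c%:E * L F].

Lemma seq_functional_lift n L D : (forall i, measurable (D i)) -> seq_functional n L ->
  nonneg_functional (fun f : n.-tuple T -> \bar R => L (fun s => seqlift f s * boxf D s)).
Proof.
move=> mD [L_eq L_ge0 L_series L_scale]; split.
- by move=> f f0; apply: L_ge0 => s; rewrite mule_ge0 ?boxf_ge0//; exact: seqlift_ge0.
- move=> g mg g0; rewrite -L_series; last 2 first.
  + by move=> j; apply: mseqM; [exact: mseq_seqlift|exact: mseq_boxf].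
  + by move=> j s; rewrite mule_ge0 ?boxf_ge0//; exact: seqlift_ge0.
  apply: L_eq => s /eqP sn; rewrite -[s]/(tval (Tuple sn)) !seqliftE.
  rewrite nneseries_esumT// muleC -esumZl ?boxf_ge0//.
  rewrite nneseries_esumT => [|j]; last by rewrite mule_ge0 ?boxf_ge0//; exact: seqlift_ge0.
  by apply: eq_esum => j _; rewrite seqliftE muleC.
- move=> c f c0 mf f0; rewrite -L_scale//.
  + apply: L_eq => s /eqP sn; rewrite -[s]/(tval (Tuple sn)) !seqliftE.
    by rewrite muleA.
  + by apply: mseqM; [exact: mseq_seqlift|exact: mseq_boxf].
  + by move=> s; rewrite mule_ge0 ?boxf_ge0//; exact: seqlift_ge0.
Qed.

Lemma tuple_measurable_boxes n : @measurable _ (n.-tuple T) =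
  <<s [set C | exists2 B : nat -> set T, (forall i, measurable (B i)) & C = box B (n := n)] >>.
Proof.
apply/seteqP; split; last first.
  apply: smallest_sub; first exact: sigma_algebra_measurable.
  move=> _ [B mB ->].
  exact: (measurable_box (B := fun i : 'I_n => B i)).
apply: smallest_sub; first exact: smallest_sigma_algebra.
move=> C; rewrite -bigcup_seq /= => -[i _ [A mA <-]].
apply: sub_sigma_algebra; exists (fun j => if j == i :> nat then A else setT).
  by move=> j; case: ifP.
apply/seteqP; split => t.
  by move=> [_ At] j; case: ifPn => // /eqP/val_inj ->.
by move=> /(_ i); rewrite eqxx.
Qed.

(** Boxes are stable under intersection and generate the sigma-algebra. The weight [boxf D] makes
    the represented measures finite, as the uniqueness of measures requires. *)
Lemma box_uniqueness n L1 L2 D : (forall i, measurable (D i)) ->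
  seq_functional n L1 -> seq_functional n L2 -> L1 (boxf D) < +oo ->
  (forall B, (forall i, measurable (B i)) ->
    L1 (boxf (fun i => B i `&` D i)) = L2 (boxf (fun i => B i `&` D i))) ->
  forall F, mseq F -> (forall s, 0 <= F s) ->
  L1 (fun s => F s * boxf D s) = L2 (fun s => F s * boxf D s).
Proof.
move=> mD sL1 sL2 L1oo L12 F mF F0.
have [m1 [m1E m1I]] := functional_integral (seq_functional_lift mD sL1).
have [m2 [m2E m2I]] := functional_integral (seq_functional_lift mD sL2).
pose f (t : n.-tuple T) := F t.
have FE L : seq_functional n L ->
    L (fun s => F s * boxf D s) = L (fun s => seqlift f s * boxf D s).
  move=> [L_eq _ _ _]; apply: L_eq => s /eqP sn.
  by rewrite -[s]/(tval (Tuple sn)) seqliftE.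
rewrite (FE _ sL1) (FE _ sL2) (m1I f (mF n) (fun t => F0 t)) (m2I f (mF n) (fun t => F0 t)).
have boxE L B : seq_functional n L ->
    L (fun s => seqlift (EFin \o \1_(box B (n := n))) s * boxf D s) =
    L (boxf (fun i => B i `&` D i)).
  move=> [L_eq _ _ _]; apply: L_eq => s /eqP sn.
  by rewrite -[s]/(tval (Tuple sn)) seqliftE -boxf_mul /= -boxfE.
apply: eq_measure_integral => A mA _.
apply: (measure_unique _ (fun=> box (fun=> setT) (n := n)) (tuple_measurable_boxes n)) => //.
- move=> _ _ [B mB ->] [C mC ->]; exists (fun i => B i `&` C i).
    by move=> i; exact: measurableI.
  by apply/seteqP; split => t /=; [move=> [h k] i; split|move=> h; split => i; have [] := h i].
- by move=> i; exists (fun=> setT).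
- by apply/seteqP; split => // t _; exists 0%N.
- by move=> _ [B mB ->]; rewrite m1E m2E !boxE// L12.
- move=> _; rewrite m1E boxE//; apply: le_lt_trans L1oo.
  rewrite le_eqVlt; apply/orP; left; apply/eqP; congr L1; congr boxf.
  by apply/funext => i; rewrite setTI.
Qed.

End box_uniqueness.

(** * Functionals determined away from the diagonals *)

Section off_diagonal_uniqueness.
Context {R : realType} {d : measure_display} {T : measurableType d}.
Variable V : nat -> set T.
Hypothesis bV : point_base V.
Implicit Types (F : seq T -> \bar R).

(** Two different entries are separated at some stage of their decreasing neighbourhoods; the
    largest stage over all pairs serves for every entry. *)
Lemma separating_base n (t : n.-tuple T) : uniq t ->
  exists l : n.-tuple nat, (forall i, V (tnth l i) (tnth t i)) /\
    forall i j, i != j -> V (tnth l i) `&` V (tnth l j) = set0.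
Proof.
move=> ut; have [_ sV _ _] := bV.
have /choice[K KP] : forall p : 'I_n * 'I_n, exists K, p.1 != p.2 ->
    approx V (tnth t p.1) K `&` approx V (tnth t p.2) K = set0.
  move=> [i j] /=; have [->|ij] := eqVneq i j; first by exists 0%N.
  have tij : tnth t i <> tnth t j by move=> e; rewrite (tuple_uniqP t ut _ _ e) eqxx in ij.
  have [a [b [Va Vb ab]]] := sV _ _ tij; exists (maxn a b).+1 => _.
  apply/seteqP; split => // x [/approxP xa /approxP xb]; rewrite -ab; split.
  - by apply: xa => //; rewrite ltnS leq_maxl.
  - by apply: xb => //; rewrite ltnS leq_maxr.
pose M := \max_p K p.
have /choice[f fP] : forall i, exists l, V l (tnth t i) /\ V l `<=` approx V (tnth t i) M.
  by move=> i; exact: (sub_approx bV).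
exists [tuple f i | i < n]; split => [i|i j ij]; rewrite !tnth_mktuple.
  by have [] := fP i.
have sub i' : V (f i') `<=` approx V (tnth t i') (K (i, j)).
  have [_ s] := fP i'; move=> x /s /approxP h; apply/approxP => a aK.
  by apply: h; apply: leq_trans aK _; exact: leq_bigmax.
by rewrite -subset0 -(KP (i, j) ij) => x [/sub xi /sub xj].
Qed.

(** Countably many boxes with pairwise disjoint sides taken from the base cover the tuples of
    distinct entries. Made disjoint, they cut the integrand into pieces each living in one such box,
    where [box_uniqueness] applies. *)
Lemma off_diagonal_uniqueness n (L1 L2 : (seq T -> \bar R) -> \bar R) :
  seq_functional n L1 -> seq_functional n L2 ->
  (forall F, mseq F -> (forall s, 0 <= F s) -> L1 F = L1 (fun s => F s * (uniq s)%:R%:E)) ->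
  (forall F, mseq F -> (forall s, 0 <= F s) -> L2 F = L2 (fun s => F s * (uniq s)%:R%:E)) ->
  (forall B : nat -> set T, (forall i, measurable (B i)) ->
    (forall i j, (i < n)%N -> (j < n)%N -> i != j -> B i `&` B j = set0) ->
    (forall i, exists l, B i `<=` V l) ->
    L1 (boxf B) = L2 (boxf B) /\ L1 (boxf B) < +oo) ->
  forall F, mseq F -> (forall s, 0 <= F s) -> L1 F = L2 F.
Proof.
move=> sL1 sL2 u1 u2 L12 F mF F0.
pose D (l : n.-tuple nat) i : set T := V (nth 0%N l i).
pose pd (l : n.-tuple nat) := forall i j, i != j -> V (tnth l i) `&` V (tnth l j) = set0.
pose W j : set (n.-tuple T) :=
  if (unpickle j : option (n.-tuple nat)) is Some l then
    if pselect (pd l) then box (D l) (n := n) else set0 else set0.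
have mD l i : measurable (D l i) by exact: (measurable_base bV).
have mW j : measurable (W j).
  rewrite /W; case: unpickle => // l; case: pselect => ? /=; last exact: measurable0.
  exact: (measurable_box (B := fun i : 'I_n => D l i)).
have mU j : measurable (seqDU W j).
  by rewrite /seqDU; apply: measurableD => //; apply: bigsetU_measurable.
have UW : \bigcup_j seqDU W j = [set t | uniq t].
  rewrite -seqDU_bigcup_eq; apply/seteqP; split => t /=.
    move=> [j _]; rewrite /W; case: unpickle => // l; case: pselect => // pdl h.
    apply/tuple_uniqP => i i' e; apply/eqP/negPn/negP => ii'.
    rewrite -[False]/((set0 : set T) (tnth t i)) -(pdl _ _ ii').
    have := h i; have := h i'; rewrite /D -!tnth_nth -e.
    by split.
  move=> /separating_base[l [lt pdl]]; exists (pickle l) => //.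
  by rewrite /W pickleK; case: pselect => // _ i; rewrite /D -tnth_nth.
pose f j (t : n.-tuple T) := F t * (\1_(seqDU W j) t)%:E.
have f0 j t : 0 <= f j t by rewrite mule_ge0 ?lee_fin.
have mf j : measurable_fun setT (f j).
  by apply: emeasurable_funM; [exact: mF|apply/measurable_EFinP; exact: measurable_indic].
have main L : seq_functional n L -> L (fun s => F s * (uniq s)%:R%:E) =
    \sum_(j <oo) L (seqlift (f j)).
  move=> [L_eq _ L_series _]; rewrite -L_series; last 2 first.
  - by move=> j; exact: mseq_seqlift.
  - by move=> j s; exact: seqlift_ge0.
  apply: L_eq => s /eqP sn; rewrite -[s]/(tval (Tuple sn)).
  under eq_eseriesr do rewrite seqliftE.
  pose t := Tuple sn; have i0 j : 0 <= (\1_(seqDU W j) t)%:E :> \bar R by rewrite lee_fin.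
  rewrite nneseries_esumT => [|j]; last exact: f0.
  rewrite /f (@esumZl _ _ _ (F t) (fun j => (\1_(seqDU W j) t)%:E))// -nneseries_esumT//.
  congr (_ * _); rewrite -(indic_bigcup t (@trivIset_seqDU _ W)).
  rewrite UW indicE; congr (_%:R%:E); congr nat_of_bool.
  by apply/idP/idP => [us|/set_mem //]; apply/mem_set.
rewrite u1// u2// !main//; apply: eq_eseriesr => j _.
have vanish L : seq_functional n L -> W j = set0 -> L (seqlift (f j)) = 0.
  move=> [L_eq _ _ L_scale] Wj0.
  transitivity (L (fun s => 0%:E * seqlift (f j) s)); last first.
    rewrite L_scale ?mul0e//; first exact: mseq_seqlift.
    by move=> s; exact: seqlift_ge0.
  apply: L_eq => s /eqP sn; rewrite -[s]/(tval (Tuple sn)) seqliftE /f.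
  by rewrite /seqDU Wj0 set0D indic0 mule0 mul0e.
case Wj : (unpickle j : option (n.-tuple nat)) => [l|]; last first.
  by rewrite !vanish// /W Wj.
have [pdl|npdl] := pselect (pd l); last by rewrite !vanish// /W Wj; case: pselect.
have restrict L : seq_functional n L ->
    L (seqlift (f j)) = L (fun s => seqlift (f j) s * boxf (D l) s).
  move=> [L_eq _ _ _]; apply: L_eq => s /eqP sn; rewrite -[s]/(tval (Tuple sn)).
  rewrite seqliftE /f boxfE /seqDU /W Wj; case: pselect => // ? /=.
  rewrite -muleA -EFinM; congr (_ * _%:E).
  set A := _ `\` _; pose B := box (D l) (n := n).
  have {1}-> : A = A `&` B by rewrite setIidl// => ? [].
  by rewrite indicI.
have Dd i i' : (i < n)%N -> (i' < n)%N -> i != i' -> D l i `&` D l i' = set0.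
  move=> ni ni' ii'.
  by have := pdl (Ordinal ni) (Ordinal ni') ii'; rewrite !(tnth_nth 0%N).
rewrite !restrict//; apply: (box_uniqueness (mD l) sL1 sL2).
- have [|_ //] := L12 (D l) (mD l) Dd.
  by move=> i; exists (nth 0%N l i).
- move=> B mB; have [|||-> //] := L12 (fun i => B i `&` D l i).
  + by move=> i; exact: measurableI.
  + move=> i i' ni ni' ii'; rewrite setIACA (Dd _ _ ni ni' ii') setI0//.
  + by move=> i; exists (nth 0%N l i) => x [].
- exact: mseq_seqlift.
- by move=> s; exact: seqlift_ge0.
Qed.

End off_diagonal_uniqueness.

(** * Poisson counts *)

Section poisson_weight.
Context {R : realType}.
Implicit Types rate : R.

Lemma poisson_weight_ge0 rate j : (0 <= rate)%R -> (0 <= poisson_weight rate j)%R.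
Proof. by move=> r0; rewrite /poisson_weight mulr_ge0 ?expR_ge0// divr_ge0// exprn_ge0. Qed.

Lemma nneseries_poisson_weight rate : (0 <= rate)%R ->
  \sum_(j <oo) (poisson_weight rate j)%:E = 1.
Proof.
move=> r0.
have e0 j : 0 <= (rate ^+ j / j`!%:R)%:E :> \bar R.
  by rewrite lee_fin divr_ge0// exprn_ge0.
under eq_eseriesr do rewrite /poisson_weight EFinM muleC.
rewrite nneseries_esumT => [|j]; last by rewrite mule_ge0// lee_fin expR_ge0.
rewrite esumZl ?lee_fin ?expR_ge0// -nneseries_esumT//.
have -> : \sum_(j <oo) (rate ^+ j / j`!%:R)%:E = (expR rate)%:E :> \bar R.
  rewrite expRE -EFin_lim; last first.
    rewrite /pseries; under eq_fun do rewrite mulrC.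
    exact: is_cvg_series_exp_coeff.
  apply/congr_lim/funext => n /=; rewrite /pseries /series /= -sumEFin//.
  by apply: eq_bigr => i _; rewrite mulrC.
by rewrite -EFinM expRN mulVf// gt_eqF// expR_gt0.
Qed.

Lemma poisson_weightS rate j :
  (j.+1%:R * poisson_weight rate j.+1 = rate * poisson_weight rate j)%R.
Proof.
rewrite /poisson_weight factS natrM exprS; field.
by rewrite nat1r !pnatr_eq0 -lt0n fact_gt0.
Qed.

Lemma nneseries_poisson_mean rate : (0 <= rate)%R ->
  \sum_(j <oo) j%:R%:E * (poisson_weight rate j)%:E = rate%:E.
Proof.
move=> r0; have w0 j := poisson_weight_ge0 j r0.
rewrite (nneseries_split _ 1%N) => [|j _]; last by rewrite mule_ge0 ?lee_fin.
rewrite big_nat1 mul0e add0e add0n -(@nneseries_addn _ (fun j => j%:R%:E * (poisson_weight rate j)%:E) 1%N).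
  under eq_eseriesr do rewrite addn1 -EFinM poisson_weightS EFinM.
  rewrite nneseries_esumT => [|j]; last by rewrite mule_ge0 ?lee_fin.
  by rewrite esumZl ?lee_fin// -nneseries_esumT// nneseries_poisson_weight// mule1.
by move=> j; rewrite mule_ge0 ?lee_fin.
Qed.

(** The left side is the probability of at least two points. Multiplying exp (- rate) >= 1 - rate by
    1 + rate gives the lower bound 1 - rate ^ 2 for the two weights. *)
Lemma poisson_weight_ge2 rate : (0 <= rate)%R ->
  (1 - (poisson_weight rate 0 + poisson_weight rate 1) <= rate ^+ 2)%R.
Proof.
move=> r0; have e1 := expR_ge1Dx (- rate).
have e2 : (0 <= rate * (expR (- rate) - (1 + - rate)))%R by rewrite mulr_ge0// subr_ge0.
rewrite /poisson_weight expr0 expr1 !fact0 /= !divr1 mul1r.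
by move: e1 e2; move: (expR _) => e; rewrite expr2; lra.
Qed.

End poisson_weight.
Lemma prode_ge0 (R : realType) (I : Type) (r : seq I) (P : pred I) (f : I -> \bar R) :
  (forall i, P i -> 0 <= f i) -> 0 <= \prod_(i <- r | P i) f i.
Proof. by move=> f0; elim/big_rec : _ => // i x Pi x0; rewrite mule_ge0// f0. Qed.

Lemma emeasurable_prod d (S : measurableType d) (R : realType) (I : Type) (r : seq I)
    (P : pred I) (f : I -> S -> \bar R) : (forall i, measurable_fun setT (f i)) ->
  measurable_fun setT (fun w => \prod_(i <- r | P i) f i w).
Proof.
move=> mf; elim: r => [|i r ih]; first by under eq_fun do rewrite big_nil; exact: measurable_cst.
have [Pi|/negbTE Pi] := boolP (P i); under eq_fun do rewrite big_cons Pi; last exact: ih.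
exact: emeasurable_funM.
Qed.

Section counts.
Context {R : realType} {d : measure_display} {T : measurableType d}.
Context {dO : measure_display} {Omega : measurableType dO} (P : probability Omega R).
Variable mu : {sigma_finite_measure set T -> \bar R}.
Variable eta : R.-ker Omega ~> T.

Definition poisson_counts := forall A, measurable A -> mu A < +oo -> forall j : nat,
  P [set w | eta w A = j%:R%:E] = (poisson_weight (fine (mu A)) j)%:E.

Definition independent_counts := forall (n : nat) (A : 'I_n -> set T),
  (forall i, measurable (A i)) -> trivIset setT A ->
  forall B : 'I_n -> set (\bar R), (forall i, measurable (B i)) ->
    P [set w | forall i, B i (eta w (A i))] = \prod_(i < n) P [set w | B i (eta w (A i))].

Hypotheses (ieta : forall w, integer_valued (eta w)).
Hypotheses (pois : poisson_counts) (indep : independent_counts).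

Lemma measurable_count A (B : set (\bar R)) : measurable A -> measurable B ->
  measurable [set w | B (eta w A)].
Proof.
by move=> mA mB; rewrite -[X in measurable X]setTI; exact: (measurable_kernel eta A mA).
Qed.

Let mu_ge0 A : (0 <= fine (mu A))%R. Proof. by rewrite fine_ge0. Qed.

(** The Poisson weights sum to 1, so that the natural values already exhaust the probability. *)
Lemma count_fin A : measurable A -> mu A < +oo -> {ae P, forall w, eta w A < +oo}.
Proof.
move=> mA Aoo.
have mE j : measurable [set w | eta w A = j%:R%:E].
  exact: (measurable_count (B := [set j%:R%:E])).
pose E := \bigcup_j [set w | eta w A = j%:R%:E].
have mUE : measurable E by exact: bigcupT_measurable.
have PE : P E = 1.
  rewrite measure_semi_bigcup//.
  - rewrite -(nneseries_poisson_weight (mu_ge0 A)).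
    by apply: eq_eseriesr => j _; exact: pois.
  - move=> i j _ _ [w [/= -> /eqP]].
    by rewrite eqe eqr_nat => /eqP.
exists (~` E); split; first exact: measurableC.
- by rewrite probability_setC// PE subee.
- move=> w /= /negP; rewrite -leNgt leye_eq => /eqP woo [j _ /=].
  by rewrite woo.
Qed.

(** The class of functions to which independence, given for events, extends by countable additivity;
    it contains a version of the counts themselves, [count_value]. *)
Definition countable_valued (phi : \bar R -> \bar R) := exists (c : nat -> R) (B : nat -> set (\bar R)),
  [/\ forall j, (0 <= c j)%R, forall j, measurable (B j)
    & phi = fun y => \sum_(j <oo) (c j)%:E * (\1_(B j) y)%:E].

Let term_ge0 (c : nat -> R) (B : nat -> set (\bar R)) j y : (forall j, (0 <= c j)%R) ->
  0 <= (c j)%:E * (\1_(B j) y)%:E.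
Proof. by move=> c0; rewrite mule_ge0 ?lee_fin. Qed.

Lemma countable_valued_ge0 phi y : countable_valued phi -> 0 <= phi y.
Proof. by move=> [c [B [c0 mB ->]]]; apply: nneseries_ge0 => j _ _; exact: term_ge0. Qed.

Lemma measurable_indic_count A (B : set (\bar R)) : measurable A -> measurable B ->
  measurable_fun setT (fun w => (\1_B (eta w A))%:E : \bar R).
Proof.
move=> mA mB; apply/measurable_EFinP.
apply: (measurableT_comp (f := \1_B : \bar R -> R)); first exact: measurable_indic.
exact: measurable_kernel.
Qed.

Lemma measurable_countable_valued phi A : countable_valued phi -> measurable A ->
  measurable_fun setT (fun w => phi (eta w A)).
Proof.
move=> [c [B [c0 mB ->]]] mA; apply: ge0_emeasurable_sum => [j w _ _|j _].
  exact: term_ge0.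
by apply: measurable_funeM; exact: measurable_indic_count.
Qed.

Lemma integral_indic_count A B : measurable A -> measurable B ->
  \int[P]_w (\1_B (eta w A))%:E = P [set w | B (eta w A)].
Proof.
move=> mA mB; have mE := measurable_count mA mB.
transitivity (\int[P]_w (\1_[set w | B (eta w A)] w)%:E); last by rewrite integral_indic// setIT.
by apply: eq_integral => w _; rewrite !indicE; congr (_%:R%:E).
Qed.

Lemma integralZ_indic_count (c : R) A B : (0 <= c)%R -> measurable A -> measurable B ->
  \int[P]_w (c%:E * (\1_B (eta w A))%:E) = c%:E * P [set w | B (eta w A)].
Proof.
move=> c0 mA mB; rewrite -integral_indic_count//.
by apply: ge0_integralZl; rewrite ?lee_fin//; exact: measurable_indic_count.
Qed.

Lemma countable_valued_indic B : measurable B -> countable_valued (fun y => (\1_B y)%:E : \bar R).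
Proof.
move=> mB; exists (fun j => (j == 0%N)%:R), (fun=> B); split => //.
apply/funext => y; rewrite nneseries2 => [|j j2|j]; last 2 first.
- by rewrite (_ : (j == 0%N) = false) ?mul0e//; lia.
- by rewrite mule_ge0 ?lee_fin.
by rewrite mul1e mul0e adde0.
Qed.

(** Induction on the number m of leading factors that need not be indicators. For m = 0 this is
    independence of events; the step expands the last of these factors into its series of
    indicators. *)
Lemma expectation_prod n (A : 'I_n -> set T) (phi : 'I_n -> \bar R -> \bar R) :
  (forall i, measurable (A i)) -> trivIset setT A -> (forall i, countable_valued (phi i)) ->
  \int[P]_w \prod_(i < n) phi i (eta w (A i)) = \prod_(i < n) \int[P]_w phi i (eta w (A i)).
Proof.
move=> mA tA.
suff H m : (forall phi : 'I_n -> \bar R -> \bar R, (forall i, countable_valued (phi i)) ->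
    (forall i : 'I_n, (m <= i)%N -> exists2 B, measurable B & phi i = fun y => (\1_B y)%:E : \bar R) ->
    \int[P]_w \prod_(i < n) phi i (eta w (A i)) = \prod_(i < n) \int[P]_w phi i (eta w (A i))).
  by move=> cphi; apply: (H n) => // i; rewrite leqNgt ltn_ord.
elim: m {phi} => [|m ih] phi cphi iphi.
  have /choice[B BP] : forall i, exists B, measurable B /\ phi i = fun y => (\1_B y)%:E : \bar R.
    by move=> i; have [B mB e] := iphi i isT; exists B.
  have mB i : measurable (B i) by have [] := BP i.
  under [RHS]eq_bigr => i _.
    rewrite (eq_integral (fun w => (\1_(B i) (eta w (A i)))%:E)); last by move=> w _; have [_ ->] := BP i.
    rewrite integral_indic_count//; over.
  have mBA : measurable [set w | forall i, B i (eta w (A i))].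
    rewrite (_ : [set w | _] = \bigcap_(i in [set: 'I_n]) [set w | B i (eta w (A i))]).
      by apply: fin_bigcap_measurable => // i _; exact: measurable_count.
    by apply/seteqP; split => w /=; [move=> h i _; exact: h|move=> h i; exact: h].
  rewrite -indep//.
  transitivity (\int[P]_w (\1_[set w | forall i, B i (eta w (A i))] w)%:E); last first.
    by rewrite integral_indic// setIT.
  apply: eq_integral => w _; rewrite indicE.
  have [/set_mem h|h] := boolP (_ \in _).
    by rewrite big1// => i _; have [_ ->] := BP i; rewrite indicE mem_set//; exact: h.
  have /existsNP[i hi] : ~ forall i, B i (eta w (A i)) by move=> h'; move/negP: h; apply; apply/mem_set.
  by rewrite (bigD1 i)//=; have [_ ->] := BP i; rewrite indicE memNset// mul0e.
have [nm|mn] := leqP n m.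
  by apply: ih => // i; rewrite leqNgt (leq_trans (ltn_ord i) nm).
pose i0 := Ordinal mn.
have [c [B [c0 mB phiE]]] := cphi i0.
pose psi j i := if i == i0 then fun y => (\1_(B j) y)%:E : \bar R else phi i.
have cpsi j i : countable_valued (psi j i).
  by rewrite /psi; case: ifP => // _; exact: countable_valued_indic.
have psi_i0 j (r : 'I_n -> (\bar R -> \bar R) -> \bar R) :
    \prod_(i < n) r i (psi j i) = r i0 (fun y => (\1_(B j) y)%:E : \bar R) * \prod_(i < n | i != i0) r i (phi i).
  rewrite (bigD1 i0)//= {1}/psi eqxx; congr (_ * _).
  by apply: eq_bigr => i /negbTE ii0; rewrite /psi ii0.
have ihpsi j : \int[P]_w \prod_(i < n) psi j i (eta w (A i)) =
    \prod_(i < n) \int[P]_w psi j i (eta w (A i)).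
  apply: ih => // i mi; rewrite /psi; case: eqVneq => [_|ii0]; first by exists (B j).
  by apply: iphi; rewrite ltn_neqAle mi andbT; apply: contra ii0 => /eqP mE; apply/eqP/val_inj.
have mprod j : measurable_fun setT (fun w => \prod_(i < n) psi j i (eta w (A i))).
  by apply: emeasurable_prod => i; exact: measurable_countable_valued.
have prod0 j w : 0 <= \prod_(i < n) psi j i (eta w (A i)).
  by apply: prode_ge0 => i _; exact: countable_valued_ge0.
transitivity (\sum_(j <oo) (c j)%:E * \int[P]_w \prod_(i < n) psi j i (eta w (A i))).
  rewrite (eq_integral (fun w => \sum_(j <oo) (c j)%:E * \prod_(i < n) psi j i (eta w (A i)))).
    rewrite integral_nneseries//; last 2 first.
    - by move=> j; apply: measurable_funeM.
    - by move=> j w _; rewrite mule_ge0 ?lee_fin.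
    by apply: eq_eseriesr => j _; rewrite ge0_integralZl ?lee_fin.
  move=> w _; rewrite (bigD1 i0)//= phiE.
  set X := \prod_(_ < n | _) _.
  have X0 : 0 <= X by apply: prode_ge0 => i _; exact: countable_valued_ge0.
  rewrite muleC nneseries_esumT => [|j]; last exact: term_ge0.
  rewrite -esumZl// => [|j]; last exact: term_ge0.
  rewrite nneseries_esumT => [|j]; last by rewrite mule_ge0 ?lee_fin.
  apply: eq_esum => j _; rewrite (psi_i0 j (fun i f => f (eta w (A i)))).
  by rewrite muleCA [X * _]muleC.
rewrite [RHS](bigD1 i0)//= phiE.
set Y := \prod_(_ < n | _) _.
have Y0 : 0 <= Y.
  by apply: prode_ge0 => i _; apply: integral_ge0 => w _; exact: countable_valued_ge0.
have int0 j : 0 <= (c j)%:E * P [set w | B j (eta w (A i0))].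
  by rewrite mule_ge0 ?lee_fin.
rewrite integral_nneseries//; last 2 first.
- by move=> j; apply: measurable_funeM; exact: measurable_indic_count.
- by move=> j w _; exact: term_ge0.
under [in RHS]eq_eseriesr do rewrite integralZ_indic_count//.
rewrite muleC [in RHS]nneseries_esumT// -esumZl//.
rewrite nneseries_esumT => [|j]; last by rewrite mule_ge0 ?lee_fin//; apply: integral_ge0.
apply: eq_esum => j _; rewrite ihpsi (psi_i0 j (fun i f => \int[P]_w f (eta w (A i)))).
by rewrite integral_indic_count// muleA muleC.
Qed.

(** Equals y at natural numbers and 0 at +oo, hence agrees almost surely with a count of finite mean
    while being a countable combination of indicators. *)
Definition count_value (y : \bar R) : \bar R := \sum_(j <oo) j%:R%:E * (\1_[set j%:R%:E] y)%:E.

Lemma count_value_nat j : count_value j%:R%:E = j%:R%:E.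
Proof.
rewrite /count_value nneseries_esumT => [|i]; last by rewrite mule_ge0 ?lee_fin.
rewrite (esum_setD1 (a := j))//.
rewrite indicE mem_set// mule1 esum1 ?adde0// => i [_ /= ij].
by rewrite indicE memNset ?mule0//= => /eqP; rewrite eqe eqr_nat => /eqP/esym.
Qed.

Lemma countable_valued_count_value : countable_valued count_value.
Proof. by exists (fun j => j%:R), (fun j => [set j%:R%:E]); split. Qed.

Lemma count_valueE A : measurable A -> mu A < +oo ->
  {ae P, forall w, count_value (eta w A) = eta w A}.
Proof.
move=> mA Aoo; apply: filterS (count_fin mA Aoo) => w woo.
have [e|[j ->]] := ieta w mA; first by rewrite e in woo.
exact: count_value_nat.
Qed.

Lemma expectation_count_value A : measurable A -> mu A < +oo ->
  \int[P]_w count_value (eta w A) = mu A.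
Proof.
move=> mA Aoo; rewrite /count_value integral_nneseries//; last first.
  by move=> j; apply: measurable_funeM; exact: measurable_indic_count.
rewrite (@eq_eseriesr _ _ (fun j => j%:R%:E * (poisson_weight (fine (mu A)) j)%:E)); last first.
  by move=> j _; rewrite integralZ_indic_count// [X in _ * X]pois.
by rewrite nneseries_poisson_mean// fineK// ge0_fin_numE.
Qed.

Lemma expectation_prod_count n (A : 'I_n -> set T) :
  (forall i, measurable (A i)) -> (forall i, mu (A i) < +oo) -> trivIset setT A ->
  \int[P]_w \prod_(i < n) eta w (A i) = \prod_(i < n) mu (A i).
Proof.
move=> mA Aoo tA.
have := expectation_prod mA tA (fun=> countable_valued_count_value).
under [RHS]eq_bigr do rewrite expectation_count_value//.
move=> <-; apply: ge0_ae_eq_integral => //.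
- by apply: emeasurable_prod => i; exact: measurable_kernel.
- apply: emeasurable_prod => i; apply: measurable_countable_valued => //.
  exact: countable_valued_count_value.
- by move=> w _; apply: prode_ge0.
- by move=> w _; apply: prode_ge0 => i _; exact: (countable_valued_ge0 _ countable_valued_count_value).
have aeA i : {ae P, forall w, count_value (eta w (A i)) = eta w (A i)} by exact: count_valueE.
have := @filter_forall _ _ _ _ (ae_filter_ringOfSetsType P) aeA.
by apply: filterS => w h _; apply: eq_bigr => i _; rewrite h.
Qed.

End counts.

(** * Absence of multiple points *)

Section almost_surely_simple.
Context {R : realType} {d : measure_display} {T : measurableType d}.
Context {dO : measure_display} {Omega : measurableType dO} (P : probability Omega R).
Variable mu : {sigma_finite_measure set T -> \bar R}.
Variable eta : R.-ker Omega ~> T.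
Variable V : nat -> set T.
Hypotheses (bV : point_base V) (muV : forall i, mu (V i) < +oo).
Hypotheses (feta : forall w, base_finite V (eta w)) (ieta : forall w, integer_valued (eta w)).
Hypotheses (mu_point : forall x, mu [set x] = 0).
Hypothesis pois : poisson_counts P mu eta.

(* [heavy K A] contains the event that some point of [A] has multiplicity at
   least two; its probability is at most the [mu \x mu]-mass of [close K A],
   which decreases to a null subset of the diagonal. *)
Fixpoint heavy K (A : set T) : set Omega :=
  if K is K'.+1 then heavy K' (A `&` V K') `|` heavy K' (A `\` V K')
  else ~` ([set w | eta w A = 0%:R%:E] `|` [set w | eta w A = 1%:R%:E]).

Fixpoint close K (A : set T) : set (T * T) :=
  if K is K'.+1 then close K' (A `&` V K') `|` close K' (A `\` V K') else A `*` A.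

Lemma measurable_heavy K A : measurable A -> measurable (heavy K A).
Proof.
elim: K A => [|K ih] A mA /=.
  apply: measurableC; apply: measurableU.
  - exact: (measurable_count eta (B := [set 0%:R%:E])).
  - exact: (measurable_count eta (B := [set 1%:R%:E])).
have mV := measurable_base bV K.
by apply: measurableU; apply: ih; [exact: measurableI|exact: measurableD].
Qed.

Lemma measurable_close K A : measurable A -> measurable (close K A).
Proof.
elim: K A => [|K ih] A mA /=; first exact: measurableX.
have mV := measurable_base bV K.
by apply: measurableU; apply: ih; [exact: measurableI|exact: measurableD].
Qed.

Lemma closeP K A x y :
  close K A (x, y) <-> [/\ A x, A y & forall l, (l < K)%N -> (V l x <-> V l y)].
Proof.
elim: K A => [|K ih] A /=; first by split=> [[]|[]].
split=> [[]/ih[[Ax Vx] [Ay Vy] h]|[Ax Ay h]].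
- split=> // l; rewrite ltnS leq_eqVlt => /orP[/eqP -> //|]; exact: h.
- split=> // l; rewrite ltnS leq_eqVlt => /orP[/eqP -> //|]; exact: h.
- have hK := h K (ltnSn K).
  have h' l : (l < K)%N -> (V l x <-> V l y) by move=> lK; apply: h; rewrite ltnS ltnW.
  by have [Vx|Vx] := pselect (V K x); [left|right]; apply/ih; split => //; split => //;
    tauto.
Qed.

Lemma prob_heavy0 A : measurable A -> mu A < +oo -> P (heavy 0 A) <= mu A * mu A.
Proof.
move=> mA Aoo /=.
have m0 : measurable [set w | eta w A = 0%:R%:E] by exact: (measurable_count eta (B := [set 0%:R%:E])).
have m1 : measurable [set w | eta w A = 1%:R%:E] by exact: (measurable_count eta (B := [set 1%:R%:E])).
rewrite probability_setC; last exact: measurableU.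
rewrite measureU//; last first.
  by apply/seteqP; split => // w [/= -> /eqP]; rewrite eqe eqr_nat.
have Afin : mu A \is a fin_num by rewrite ge0_fin_numE.
have := pois mA Aoo 0%N; have := pois mA Aoo 1%N; move=> p1 p0.
rewrite [X in _ - (X + _)]p0 [X in _ - (_ + X)]p1.
have := poisson_weight_ge2 (fine_ge0 (measure_ge0 mu A)).
have -> : mu A * mu A = (fine (mu A) ^+ 2)%:E by rewrite expr2 EFinM fineK.
by rewrite -lee_fin EFinB EFinD.
Qed.

(** Cutting A by V K makes the event a union, over which the probability is subadditive, and the set
    of pairs a disjoint union, over which the product measure is additive; so the estimate for K = 0
    propagates. *)
Lemma prob_heavy K A : measurable A -> mu A < +oo -> P (heavy K A) <= (mu \x mu) (close K A).
Proof.
elim: K A => [|K ih] A mA Aoo.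
  by rewrite product_measure1E//; exact: prob_heavy0.
have mV := measurable_base bV K.
have mI : measurable (A `&` V K) by exact: measurableI.
have mD : measurable (A `\` V K) by exact: measurableD.
have lt1 : mu (A `&` V K) < +oo.
  by apply: le_lt_trans Aoo; apply: le_measure; rewrite ?inE//; exact: subIsetl.
have lt2 : mu (A `\` V K) < +oo.
  by apply: le_lt_trans Aoo; apply: le_measure; rewrite ?inE//; exact: subDsetl.
have -> : (mu \x mu) (close K.+1 A) =
    (mu \x mu) (close K (A `&` V K)) + (mu \x mu) (close K (A `\` V K)).
  apply: measureU; [exact: measurable_close|exact: measurable_close|].
  by apply/seteqP; split => // -[x y] [/closeP[[_ Vx] _ _] /closeP[[_ /(_ Vx)]]].
apply: le_trans (leeD (ih _ mI lt1) (ih _ mD lt2)).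
by apply: measureU2; exact: measurable_heavy.
Qed.

Lemma diagonal_null : (mu \x mu) [set p | p.1 = p.2] = 0.
Proof.
rewrite /product_measure1 integral0_eq// => x _ /=.
rewrite (_ : xsection _ x = [set x])//.
by apply/seteqP; split => y; rewrite /xsection /= inE /=.
Qed.

Lemma close_cvg0 A : measurable A -> mu A < +oo ->
  (mu \x mu) (close K A) @[K --> \oo] --> 0.
Proof.
move=> mA Aoo; rewrite -(_ : (mu \x mu) (\bigcap_K close K A) = 0).
  apply: nonincreasing_cvg_mu.
  - rewrite /= product_measure1E// lte_mul_pinfty// ge0_fin_numE//.
  - by move=> K; exact: measurable_close.
  - by apply: bigcapT_measurable => K; exact: measurable_close.
  - move=> m n mn; apply/subsetPset => -[x y] /closeP[Ax Ay h].
    by apply/closeP; split => // l lm; apply: h; exact: leq_trans lm mn.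
apply/eqP; rewrite eq_le measure_ge0 andbT -diagonal_null.
apply: le_measure; rewrite ?inE.
- by apply: bigcapT_measurable => K; exact: measurable_close.
- exact: (measurable_diagonal bV).
move=> [x y] h /=; apply: contrapT => xy.
have [_ sV _ _] := bV; have [i [j [Vi Vj ij]]] := sV x y xy.
have /closeP[_ _ /(_ i (ltnSn i)) [Vxy _]] := h i.+1 I.
by rewrite -[False]/((set0 : set T) y) -ij; split => //; exact: Vxy.
Qed.

Lemma sub_heavy K A x w : measurable A -> A x -> 1 < eta w [set x] -> heavy K A w.
Proof.
move=> + + x2; elim: K A => [|K ih] A mA Ax /=.
  have xA : eta w [set x] <= eta w A.
    apply: le_measure; rewrite ?inE//; first exact: (measurable_point bV).
    by move=> _ ->.
  have lt1 : 1 < eta w A by exact: lt_le_trans xA.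
  by move=> [|] /= e; move: lt1; rewrite e lte_fin; lra.
have mV := measurable_base bV K.
by have [Vx|Vx] := pselect (V K x); [left|right]; apply: ih => //;
  [exact: measurableI|exact: measurableD].
Qed.

Lemma simple_ae : {ae P, forall w, forall x, eta w [set x] <= 1}.
Proof.
pose N i := \bigcap_K heavy K (V i).
have mV i := measurable_base bV i.
have mN i : measurable (N i) by apply: bigcapT_measurable => K; exact: measurable_heavy.
have PN i : P.-negligible (N i).
  apply/negligibleP => //; apply/eqP; rewrite eq_le measure_ge0 andbT.
  apply: cvge_ge (close_cvg0 (mV i) (muV i)).
  apply: nearW => K; apply: le_trans (prob_heavy K (mV i) (muV i)).
  apply: le_measure; rewrite ?inE//; first exact: measurable_heavy.
  by move=> w; apply.
apply: negligibleS (negligible_bigcup PN) => w /existsNP[x /negP].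
rewrite -ltNge => x2; have [i [Vix _]] := feta w x.
by exists i => // K _; exact: sub_heavy x2.
Qed.

(** Almost surely all point masses are at most 1; being integers, the positive ones equal 1, and the
    measure is the counting measure of its support. *)
Lemma count_esum_ae : {ae P, forall w, forall B, measurable B ->
  \esum_(x in support (eta w)) (\1_B x)%:E = eta w B}.
Proof.
apply: filterS simple_ae => w w1 B mB.
have mS := measurable_support bV (feta w) (ieta w).
rewrite -(setIT B) -[RHS]integral_indic// setIT.
rewrite (@ge0_integral_atomic _ _ _ _ (support (eta w)))//; last 4 first.
- exact: (measurable_point bV).
- exact: (countable_support bV).
- exact: (measure_supportC bV).
- by apply/measurable_EFinP; exact: measurable_indic.
apply: eq_esum => x sx; rewrite (_ : eta w [set x] = 1) ?mule1//.
apply/eqP; rewrite eq_le w1 /=.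
have [->|[j ej]] := ieta w (measurable_point bV x); first by rewrite leey.
by move: sx; rewrite /support /= ej lte_fin ltr0n lee_fin ler1n.
Qed.

End almost_surely_simple.

(** * Expectations of sums over distinct tuples *)

(** As the sides are disjoint, a point used by one factor does not count for the others, and the
    requirement of distinctness becomes void. *)
Lemma dsum_boxf (R : realType) (d : measure_display) (T : measurableType d) n
    (B : nat -> set T) (A : set T) :
  (forall i j, (i < n)%N -> (j < n)%N -> i != j -> B i `&` B j = set0) ->
  dsum n (boxf B) A = \prod_(i < n) \esum_(x in A) (\1_(B i) x)%:E :> \bar R.
Proof.
elim: n B A => [|n ih] B A dB; first by rewrite big_ord0.
rewrite big_ord_recl dsumS.
set Y := \prod_(i < n) _.
have i0 i x : 0 <= (\1_(B i) x)%:E :> \bar R by rewrite lee_fin.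
have Y0 : 0 <= Y by apply: prode_ge0 => i _; exact: esum_ge0.
rewrite muleC -esumZl//; apply: eq_esum => x Ax.
rewrite [LHS](_ : _ = (\1_(B 0%N) x)%:E * dsum n (boxf (fun i => B i.+1)) (A `\ x)); last first.
  by rewrite -dsumZl// => s; exact: boxf_ge0.
rewrite muleC; have [B0x|B0x] := pselect (B 0%N x); last by rewrite indicE memNset// !mule0.
congr (_ * _); rewrite ih; last by move=> i j ni nj ij; exact: dB.
apply: eq_bigr => i _; rewrite lift0 (esum_setD1 Ax)//.
have nB : ~ B i.+1 x.
  move=> Bx; rewrite -[False]/((set0 : set T) x) -(dB 0%N i.+1)//.
  by rewrite ltnS ltn_ord.
by rewrite indicE memNset// add0e.
Qed.

Section iterated_integral_series.
Context {R : realType} {d : measure_display} {T : measurableType d}.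
Variable mu : {sigma_finite_measure set T -> \bar R}.
Implicit Types F : seq T -> \bar R.

Lemma itint_boxf n (B : nat -> set T) : (forall i, measurable (B i)) ->
  itint mu n (boxf B) = \prod_(i < n) mu (B i).
Proof.
elim: n B => [|n ih] B mB; first by rewrite big_ord0.
rewrite big_ord_recl /= (eq_integral (fun x => (\1_(B 0%N) x)%:E * itint mu n (boxf (fun i => B i.+1)))).
  rewrite ih// ge0_integralZr//; last 2 first.
  - by apply/measurable_EFinP; exact: measurable_indic.
  - exact: prode_ge0.
  by rewrite integral_indic// setIT.
move=> x _; rewrite -itintZl//; last by move=> s; exact: boxf_ge0.
exact: mseq_boxf.
Qed.

Lemma itint_nneseries n (g : nat -> seq T -> \bar R) : (forall j, mseq (g j)) ->
  (forall j s, 0 <= g j s) ->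
  itint mu n (fun s => \sum_(j <oo) g j s) = \sum_(j <oo) itint mu n (g j).
Proof.
elim: n g => [|n ih] g mg g0 //=.
rewrite -integral_nneseries//.
- by apply: eq_integral => x _; rewrite ih// => j; exact: mseq_cons.
- by move=> j; exact: measurable_itint.
- by move=> j x _; exact: itint_ge0.
Qed.

Lemma seq_functional_itint n : seq_functional n (itint mu n).
Proof.
split.
- exact: eq_itint.
- by move=> F F0; exact: itint_ge0.
- exact: itint_nneseries.
- by move=> c F c0 mF F0; rewrite itintZl.
Qed.

Hypothesis mu_point : forall x, mu [set x] = 0.
Hypothesis measurable_set1 : forall x : T, measurable [set x].

Lemma mseq_notin (x : T) : mseq (fun s : seq T => ((x \notin s)%:R : R)%:E).
Proof.
move=> n; apply/measurable_EFinP.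
rewrite (_ : (fun _ => _) = \1_(box (fun=> [set~ x]) (n := n))).
  apply: measurable_indic; apply: (measurable_box (B := fun _ : 'I_n => [set~ x])) => _.
  exact: measurableC.
apply/funext => t; rewrite indicE; congr ((nat_of_bool _)%:R).
apply/idP/idP => [xt|/set_mem h].
  by apply/mem_set => i /= e; move: xt; rewrite -e mem_tnth.
by apply/negP => /tnthP[i e]; apply: (h i); rewrite /= e.
Qed.

Lemma mseq_uniq : (forall n, measurable [set t : n.-tuple T | uniq t]) ->
  mseq (fun s : seq T => ((uniq s)%:R : R)%:E).
Proof.
move=> mu_uniq n; apply/measurable_EFinP.
rewrite (_ : (fun _ => _) = \1_[set t : n.-tuple T | uniq t]); first exact: (measurable_indic (mu_uniq n)).
apply/funext => t; rewrite indicE; congr ((nat_of_bool _)%:R).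
by apply/idP/idP => [?|/set_mem //]; apply/mem_set.
Qed.

(** In each variable only the null singleton {x} is excluded. *)
Lemma itint_notin n F x : mseq F -> (forall s, 0 <= F s) ->
  itint mu n (fun s => F s * (x \notin s)%:R%:E) = itint mu n F.
Proof.
elim: n F => [|n ih] F mF F0 /=; first by rewrite mule1.
have mi : measurable_fun setT (fun y => itint mu n (fun s => F (y :: s))) by exact: measurable_itint.
apply: ge0_ae_eq_integral => //.
- apply: (measurable_itint mu n (F := fun s => F s * (x \notin s)%:R%:E)).
    by apply: mseqM => //; exact: mseq_notin.
  by move=> s; rewrite mule_ge0// lee_fin.
- by move=> y _; apply: itint_ge0 => s; rewrite mule_ge0// lee_fin.
- by move=> y _; exact: itint_ge0.
exists [set x]; split; [exact: measurable_set1|exact: mu_point|] => y /= h; apply: contrapT => yx; apply: h => _.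
rewrite -(ih (fun s => F (y :: s)))//; last exact: mseq_cons.
apply: eq_itint => s _; rewrite inE negb_or (_ : x != y)//.
by apply/eqP => e; apply: yx.
Qed.

Lemma itint_uniq n F : (forall n, measurable [set t : n.-tuple T | uniq t]) ->
  mseq F -> (forall s, 0 <= F s) ->
  itint mu n F = itint mu n (fun s => F s * (uniq s)%:R%:E).
Proof.
move=> mu_uniq; elim: n F => [|n ih] F mF F0 /=; first by rewrite mule1.
apply: eq_integral => x _; rewrite ih//; last exact: mseq_cons.
rewrite -[LHS](itint_notin n x).
- apply: eq_itint => s _; rewrite -muleA -EFinM -natrM mulnb andbC.
  by [].
- by apply: mseqM; [exact: mseq_cons|exact: mseq_uniq].
- by move=> s; rewrite mule_ge0// lee_fin.
Qed.

End iterated_integral_series.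

Section expectation_dsum.
Context {R : realType} {d : measure_display} {T : measurableType d}.
Context {dO : measure_display} {Omega : measurableType dO} (P : probability Omega R).
Variable mu : {sigma_finite_measure set T -> \bar R}.
Variable eta : R.-ker Omega ~> T.
Variable V : nat -> set T.
Hypotheses (bV : point_base V) (muV : forall i, mu (V i) < +oo).
Hypotheses (feta : forall w, base_finite V (eta w)) (ieta : forall w, integer_valued (eta w)).
Hypotheses (mu_point : forall x, mu [set x] = 0).
Hypotheses (pois : poisson_counts P mu eta) (indep : independent_counts P eta).

Lemma expectation_dsum n F : mseq F -> (forall s, 0 <= F s) ->
  \int[P]_w dsum n F (support (eta w)) = itint mu n F.
Proof.
have mdsum := measurable_dsum_support bV feta ieta; move: F.
apply: (off_diagonal_uniqueness bV (n := n)
  (L1 := fun F => \int[P]_w dsum n F (support (eta w)))).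
- split.
  + by move=> F G FG; apply: eq_integral => w _; exact: eq_dsum.
  + by move=> F F0; apply: integral_ge0 => w _; exact: dsum_ge0.
  + move=> g mg g0; rewrite -integral_nneseries//.
    * by apply: eq_integral => w _; rewrite dsum_nneseries.
    * by move=> j; exact: mdsum.
    * by move=> j w _; exact: dsum_ge0.
  + move=> c F c0 mF F0; rewrite -ge0_integralZl ?lee_fin//.
    * by apply: eq_integral => w _; rewrite dsumZl ?lee_fin.
    * exact: mdsum.
    * by move=> w _; exact: dsum_ge0.
- exact: seq_functional_itint.
- move=> F mF F0; apply: eq_integral => w _; rewrite -!dsum_esum//; last first.
    by move=> s; rewrite mule_ge0 ?lee_fin.
  by apply: eq_esum => t [ut _]; rewrite ut mule1.
- move=> F mF F0; apply: itint_uniq => //; first exact: (measurable_point bV).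
  by move=> m; exact: (measurable_uniq bV).
- move=> B mB dB Bl.
  have Boo i : mu (B i) < +oo.
    have [l Bll] := Bl i; apply: le_lt_trans (muV l); apply: le_measure; rewrite ?inE//.
    exact: (measurable_base bV).
  have -> : \int[P]_w dsum n (boxf B) (support (eta w)) = itint mu n (boxf B).
    rewrite itint_boxf// -(expectation_prod_count ieta pois indep (A := fun i : 'I_n => B i))//; last first.
      apply/trivIsetP => i j _ _ ij; exact: dB.
    apply: ge0_ae_eq_integral => //.
    + by apply: mdsum; [exact: mseq_boxf|move=> s; exact: boxf_ge0].
    + by apply: emeasurable_prod => i; exact: measurable_kernel.
    + by move=> w _; apply: dsum_ge0 => s; exact: boxf_ge0.
    + by move=> w _; exact: prode_ge0.
    apply: filterS (count_esum_ae bV muV feta ieta mu_point pois) => w h _.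
    by rewrite dsum_boxf//; apply: eq_bigr => i _; exact: h.
  split => //; rewrite itint_boxf//.
  elim: n B mB Boo {dB Bl} => [|n ih] B mB Boo; first by rewrite big_ord0 ltry.
  rewrite big_ord_recl lte_mul_pinfty// ?ge0_fin_numE//.
  exact: (ih (fun i => B i.+1)).
Qed.

End expectation_dsum.

(** * Second moments *)

Section second_moment.
Context {R : realType} {d : measure_display} {T : measurableType d}.
Context {dO : measure_display} {Omega : measurableType dO} (P : probability Omega R).
Variable mu : {sigma_finite_measure set T -> \bar R}.
Variable A : Omega -> set T.
Implicit Types F G h : seq T -> \bar R.

(** From here on the process is an abstract random set, known only through this measurability and
    through the first moment formula that follows. *)
Hypothesis measurable_dsumA : forall n F, mseq F -> (forall s, 0 <= F s) ->
  measurable_fun setT (fun w => dsum n F (A w)).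
Hypothesis expectation_dsumA : forall n F, mseq F -> (forall s, 0 <= F s) ->
  \int[P]_w dsum n F (A w) = itint mu n F.

Lemma expectation_dsum_mul k l F G :
  mseq F -> mseq G -> (forall s, 0 <= F s) -> (forall s, 0 <= G s) ->
  symmetric F -> symmetric G ->
  \int[P]_w (dsum k F (A w) * dsum l G (A w)) =
  \sum_(r < k.+1) ('C(k, r) * l ^_ r)%:R%:E * joint_section mu k l F G r.
Proof.
move=> mF mG F0 G0 sF sG; rewrite -itint_overlap//.
under eq_integral do rewrite dsum_mul//.
have mo m : mseq (overlap k F G m) by exact: mseq_overlap.
have o0 m s : 0 <= overlap k F G m s by exact: overlap_ge0.
rewrite ge0_integral_sum//.
- apply: eq_bigr => m _; rewrite ge0_integralZl ?natE_ge0 ?expectation_dsumA//.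
  + exact: measurable_dsumA.
  + by move=> w _; exact: dsum_ge0.
- by move=> m; apply: measurable_funeM; exact: measurable_dsumA.
- by move=> m w _; rewrite mule_ge0 ?natE_ge0//; exact: dsum_ge0.
Qed.

Variable K : nat.

(** A family of nonnegative symmetric kernels of the orders 0 to K, stored as one function on
    lists. *)
Definition sym_kernel h :=
  [/\ forall s, 0 <= h s, mseq h, symmetric h & forall s, (K < size s)%N -> h s = 0].

Definition total_sum h w := \sum_(n < K.+1) dsum n h (A w).

(* On symmetric kernels, [section_op c] is [sum_m (c m) D^m / m!] for the
   operator [D h z = (|z| + 1) * int h (z, y) mu(dy)]; thus [c = 1] gives
   [exp D] and the signed sequence [c m = (-1)^m] its inverse. *)
Definition section_op (c : nat -> nat) h z : \bar R :=
  \sum_(m < K.+1) (c m * 'C(size z + m, m))%:R%:E * itint mu m (fun y => h (z ++ y)).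

Lemma section_op_ge0 c h z : (forall s, 0 <= h s) -> 0 <= section_op c h z.
Proof.
move=> h0; apply: sume_ge0 => m _; rewrite mule_ge0 ?natE_ge0//.
by apply: itint_ge0 => s; exact: h0.
Qed.

Lemma mseq_section_op c h : mseq h -> (forall s, 0 <= h s) -> mseq (section_op c h).
Proof.
move=> mh h0; apply: mseq_sum => m _ n.
under eq_fun do rewrite size_tuple.
by apply: measurable_funeM; exact: (mseq_itint mu m mh h0).
Qed.

Lemma symmetric_section_op c h : symmetric h -> symmetric (section_op c h).
Proof.
move=> sh s t st; rewrite /section_op (perm_size st); apply: eq_bigr => m _; congr (_ * _).
by apply: eq_itint => y _; apply: sh; rewrite perm_cat2r.
Qed.

Lemma sym_kernel_section_op c h : sym_kernel h -> sym_kernel (section_op c h).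
Proof.
move=> [h0 mh sh hK]; split.
- by move=> s; exact: section_op_ge0.
- exact: mseq_section_op.
- exact: symmetric_section_op.
move=> s Ks; rewrite /section_op big1// => m _.
rewrite (eq_itint mu (G := fun=> 0)) ?itint0 ?mule0// => y _.
by rewrite hK// size_cat ltn_addr.
Qed.

Lemma sym_kernelD h h' : sym_kernel h -> sym_kernel h' -> sym_kernel (fun s => h s + h' s).
Proof.
move=> [h0 mh sh hK] [h0' mh' sh' hK']; split.
- by move=> s; rewrite adde_ge0.
- exact: mseqD.
- by move=> s t st; rewrite (sh _ _ st) (sh' _ _ st).
- by move=> s Ks; rewrite hK// hK'// adde0.
Qed.

Lemma section_opD c h h' z : sym_kernel h -> sym_kernel h' ->
  section_op c (fun s => h s + h' s) z = section_op c h z + section_op c h' z.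
Proof.
move=> [h0 mh sh hK] [h0' mh' sh' hK']; rewrite /section_op -big_split; apply: eq_bigr => m _.
rewrite itintD//; [|exact: mseq_catl|exact: mseq_catl].
by rewrite ge0_muleDr//; apply: itint_ge0.
Qed.

Lemma section_op_addc c c' h z : sym_kernel h ->
  section_op (fun m => c m + c' m)%N h z = section_op c h z + section_op c' h z.
Proof.
move=> [h0 _ _ _]; rewrite /section_op -big_split; apply: eq_bigr => m _.
by rewrite mulnDl natrD EFinD ge0_muleDl ?natE_ge0.
Qed.

Lemma section_op_id h z : sym_kernel h -> section_op (fun m => m == 0%N) h z = h z.
Proof.
move=> _; rewrite /section_op big_ord_recl big1 => [|i _]; last by rewrite lift0 mul0n mul0e.
by rewrite /= addn0 bin0 mul1n mul1e cats0 adde0.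
Qed.

(** Coefficients of the product of two exponential generating functions; they govern the composition
    of power series in D. *)
Definition conv (c c' : nat -> nat) n := (\sum_(m < n.+1) 'C(n, m) * c m * c' (n - m))%N.

(** Both sides are the trinomial coefficient (r + m + n)! / (r! m! n!). *)
Lemma bin_add r m n : ('C(r + m, m) * 'C(r + m + n, n) = 'C(m + n, m) * 'C(r + (m + n), m + n))%N.
Proof.
have e1 := bin_fact (leq_addl r m); have e2 := bin_fact (leq_addl (r + m) n).
have e3 := bin_fact (leq_addr n m); have e4 := bin_fact (leq_addl r (m + n)).
rewrite !addnK in e1 e2 e4; rewrite addKn in e3.
apply/eqP; rewrite -(eqn_pmul2r (fact_gt0 m)) -(eqn_pmul2r (fact_gt0 n)) -(eqn_pmul2r (fact_gt0 r)).
apply/eqP; transitivity ((r + m + n)`!); last by rewrite addnA in e4 *; nia.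
by rewrite -e2 -e1; nia.
Qed.

Lemma triangular_sum (a : nat -> nat -> \bar R) : (forall m n, (K < m + n)%N -> a m n = 0) ->
  \sum_(m < K.+1) \sum_(n < K.+1) a m n = \sum_(n < K.+1) \sum_(m < n.+1) a m (n - m)%N.
Proof.
move=> aK.
transitivity (\sum_(m < K.+1) \sum_(n < K.+1 | (m <= n)%N) a m (n - m)%N).
  apply: eq_bigr => m _.
  have mK : (m <= K.+1)%N by exact: ltnW.
  transitivity (\sum_(m <= n < K.+1) a m (n - m)%N); last first.
    rewrite big_geq_mkord; apply: eq_bigl => n; by rewrite /=.
  rewrite -{2}[nat_of_ord m]add0n big_addn.
  under [RHS]eq_bigr do rewrite addnK.
  rewrite -(big_mkord xpredT (a m)) (@big_cat_nat _ _ _ (K.+1 - m))//=; last exact: leq_subr.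
  rewrite [X in _ + X]big_nat_cond [X in _ + X]big1 ?adde0// => n.
  by rewrite andbT => /andP[Kn _]; apply: aK; lia.
rewrite (exchange_big_dep xpredT)//=; apply: eq_bigr => n _.
rewrite (big_ord_widen_cond K.+1 xpredT (fun m => a m (n - m)%N))//.
Qed.

(** Multiplication of power series in D, with coefficients normalized by factorials. Truncation at K
    loses nothing, since [h] vanishes at lists longer than K. *)
Lemma section_op_comp c c' h z : sym_kernel h ->
  section_op c (section_op c' h) z = section_op (conv c c') h z.
Proof.
move=> [h0 mh sh hK].
pose X n := 'C(size z + n, n)%:R%:E * itint mu n (fun y => h (z ++ y)).
have X0 n : 0 <= X n by rewrite mule_ge0 ?natE_ge0//; apply: itint_ge0.
have XK n : (K < n)%N -> X n = 0.
  move=> Kn; rewrite /X (eq_itint mu (G := fun=> 0)) ?itint0 ?mule0// => y yn.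
  by rewrite hK// size_cat yn; lia.
transitivity (\sum_(m < K.+1) \sum_(n < K.+1) (c m * c' n * 'C(m + n, m))%:R%:E * X (m + n)%N).
  apply: eq_bigr => m _; rewrite /section_op.
  rewrite (eq_itint mu (G := fun y => \sum_(n < K.+1) (c' n * 'C(size z + m + n, n))%:R%:E *
      itint mu n (fun y' => h ((z ++ y) ++ y')))); last first.
    by move=> y ym; rewrite size_cat ym.
  have mh' n : mseq (fun y => itint mu n (fun y' => h ((z ++ y) ++ y'))).
    by move: (mseq_itint mu n (mseq_catl z mh) (fun s => h0 _)) => H q; have := H q;
      apply: eq_measurable_fun => t _; apply: eq_itint => y _; rewrite catA.
  rewrite itint_sum; last 2 first.
  - by move=> n _; apply: mseqM => //; exact: mseq_cst.
  - by move=> n y _; rewrite mule_ge0 ?natE_ge0//; apply: itint_ge0.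
  rewrite ge0_sume_distrr => [|n _]; last first.
    by apply: itint_ge0 => y; rewrite mule_ge0 ?natE_ge0//; apply: itint_ge0.
  apply: eq_bigr => n _; rewrite itintZl ?natE_ge0//; last first.
    by move=> y; apply: itint_ge0.
  rewrite /X itint_add !muleA -!EFinM -!natrM; congr (_%:R%:E * _).
    by rewrite mulnACA bin_add mulnA.
  by apply: eq_itint => y _; apply: eq_itint => y' _; rewrite catA.
rewrite (triangular_sum (a := fun m n => (c m * c' n * 'C(m + n, m))%:R%:E * X (m + n)%N)) => [|m n mn]; last first.
  by rewrite XK ?mule0.
apply: eq_bigr => n _; rewrite /conv big_distrl natr_sum -sumEFin ge0_sume_distrl => [|m _]; last first.
  exact: natE_ge0.
apply: eq_bigr => m _; have mn : (m <= n)%N by rewrite -ltnS.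
by rewrite subnKC// muleA -EFinM -natrM; congr (_%:R%:E * _); rewrite mulnAC [RHS]mulnC; lia.
Qed.

(** Grouping by the order n = |z| + m of the integrated component turns exp D into the sum, over all
    components of [h], of their sections weighted as in the definition of the h_n. *)
Lemma section_op1E h z : sym_kernel h -> (size z <= K)%N ->
  section_op (fun=> 1%N) h z = \sum_(n < K.+1) 'C(n, size z)%:R%:E *
    itint mu (n - size z) (fun y => h (z ++ y)).
Proof.
move=> [h0 mh sh hK] zK; rewrite /section_op; set r := size z.
pose f m := (1 * 'C(r + m, m))%:R%:E * itint mu m (fun y => h (z ++ y)).
pose g n := 'C(n, r)%:R%:E * itint mu (n - r) (fun y => h (z ++ y)).
rewrite -(big_mkord xpredT f) -(big_mkord xpredT g).
rewrite (@big_cat_nat _ _ _ (K.+1 - r))//=; last exact: leq_subr.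
rewrite [X in _ + X]big_nat_cond [X in _ + X]big1 ?adde0; last first.
  move=> n; rewrite andbT => /andP[Kn _]; rewrite /f (eq_itint mu (G := fun=> 0)) ?itint0 ?mule0// => y yn.
  by rewrite hK// size_cat yn -/r; lia.
rewrite [RHS](@big_cat_nat _ _ _ r)//=; last by rewrite ltnW.
rewrite [X in _ = X + _]big_nat_cond [X in _ = X + _]big1 ?add0e; last first.
  by move=> n; rewrite andbT => /andP[_ nr]; rewrite /g bin_small// mul0e.
rewrite -{2}[r]add0n big_addn; apply: eq_bigr => n _.
rewrite /f /g addnK mul1n; congr (_%:R%:E * _).
by rewrite -(bin_sub (leq_addl n r)) addnK addnC.
Qed.

Lemma total_sum_ge0 h w : (forall s, 0 <= h s) -> 0 <= total_sum h w.
Proof. by move=> h0; apply: sume_ge0 => n _; exact: dsum_ge0. Qed.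

Lemma measurable_total_sum h : sym_kernel h -> measurable_fun setT (total_sum h).
Proof. by move=> [h0 mh _ _]; apply: emeasurable_sum => n; exact: measurable_dsumA. Qed.

Lemma total_sumD h h' w : sym_kernel h -> sym_kernel h' ->
  total_sum (fun s => h s + h' s) w = total_sum h w + total_sum h' w.
Proof.
move=> [h0 _ _ _] [h0' _ _ _]; rewrite /total_sum -big_split.
by apply: eq_bigr => n _; rewrite dsumD.
Qed.

Lemma expectation_total_sum h : sym_kernel h ->
  \int[P]_w total_sum h w = \sum_(n < K.+1) itint mu n h.
Proof.
move=> [h0 mh _ _]; rewrite ge0_integral_sum//.
- by apply: eq_bigr => n _; rewrite expectation_dsumA.
- by move=> n; exact: measurable_dsumA.
- by move=> n w _; exact: dsum_ge0.
Qed.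

(** Inner product of the Fock space, taken between the chaos kernels exp D F and exp D G of the two
    sums. *)
Definition chaos_inner F G := \sum_(r < K.+1) r`!%:R%:E *
  itint mu r (fun z => section_op (fun=> 1%N) F z * section_op (fun=> 1%N) G z).

(** Since 'C(k, r) times the falling factorial l ^_ r equals r! 'C(k, r) 'C(l, r), the double sum
    over the orders k and l factors, for each r, into the product of the two exponentials. *)
Lemma expectation_total_sum_mul F G : sym_kernel F -> sym_kernel G ->
  \int[P]_w (total_sum F w * total_sum G w) = chaos_inner F G.
Proof.
move=> kF kG; have [F0 mF sF FK] := kF; have [G0 mG sG GK] := kG.
have d0 n h w : (forall s, 0 <= h s) -> 0 <= dsum n h (A w) by exact: dsum_ge0.
transitivity (\int[P]_w \sum_(k < K.+1) \sum_(l < K.+1) (dsum k F (A w) * dsum l G (A w))).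
  apply: eq_integral => w _; rewrite ge0_sume_distrl => [|k _]; last exact: d0.
  by apply: eq_bigr => k _; rewrite ge0_sume_distrr => [//|l _]; exact: d0.
have mdd k l : measurable_fun setT (fun w => dsum k F (A w) * dsum l G (A w)).
  by apply: emeasurable_funM; exact: measurable_dsumA.
have dd0 k l w : 0 <= dsum k F (A w) * dsum l G (A w) by rewrite mule_ge0// d0.
rewrite ge0_integral_sum//; last 2 first.
- by move=> k; apply: emeasurable_sum.
- by move=> k w _; exact: sume_ge0.
transitivity (\sum_(k < K.+1) \sum_(l < K.+1) \sum_(r < K.+1)
    ('C(k, r) * l ^_ r)%:R%:E * joint_section mu k l F G r).
  apply: eq_bigr => k _; rewrite ge0_integral_sum//; apply: eq_bigr => l _.
  rewrite expectation_dsum_mul//.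
  rewrite (big_ord_widen K.+1 (fun r => ('C(k, r) * l ^_ r)%:R%:E * joint_section mu k l F G r))//.
  rewrite big_mkcond; apply: eq_bigr => r _; case: ifPn => //; rewrite -leqNgt => kr.
  by rewrite bin_small// mul0n mul0e.
rewrite /chaos_inner.
under eq_bigr do rewrite exchange_big.
rewrite exchange_big; apply: eq_bigr => r _ /=.
have rK : (r <= K)%N by rewrite -ltnS.
pose f h n z := 'C(n, r)%:R%:E * itint mu (n - r) (fun y => h (z ++ y)).
have f0 h n z : (forall s, 0 <= h s) -> 0 <= f h n z.
  by move=> h0; rewrite mule_ge0 ?natE_ge0//; exact: itint_ge0.
have mf h n : mseq h -> (forall s, 0 <= h s) -> mseq (f h n).
  by move=> mh h0; apply: mseqM; [exact: mseq_cst|exact: mseq_itint].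
have mff k l : mseq (fun z => f F k z * f G l z) by apply: mseqM; exact: mf.
have ff0 k l z : 0 <= f F k z * f G l z by rewrite mule_ge0// f0.
rewrite [X in _ = _ * X](eq_itint mu (G := fun z => \sum_(k < K.+1) \sum_(l < K.+1) f F k z * f G l z)).
  rewrite itint_sum; last 2 first.
  - by move=> k _; apply: mseq_sum.
  - by move=> k z _; exact: sume_ge0.
  rewrite ge0_sume_distrr => [|k _]; last by apply: itint_ge0 => z; exact: sume_ge0.
  apply: eq_bigr => k _; rewrite itint_sum// ge0_sume_distrr => [|l _]; last exact: itint_ge0.
  apply: eq_bigr => l _.
  have mJ : mseq (fun z => itint mu (k - r) (fun y => F (z ++ y)) * itint mu (l - r) (fun y => G (z ++ y))).
    by apply: mseqM; exact: mseq_itint.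
  have J0 z : 0 <= itint mu (k - r) (fun y => F (z ++ y)) * itint mu (l - r) (fun y => G (z ++ y)).
    by rewrite mule_ge0//; exact: itint_ge0.
  rewrite (eq_itint mu (G := fun z => ('C(k, r) * 'C(l, r))%:R%:E *
      (itint mu (k - r) (fun y => F (z ++ y)) * itint mu (l - r) (fun y => G (z ++ y))))).
    rewrite itintZl ?natE_ge0// muleA -EFinM -natrM -bin_ffact.
    by congr (_%:R%:E * _); rewrite [in RHS]mulnC mulnA.
  by move=> z _; rewrite /f muleACA -EFinM -natrM.
move=> z zr; rewrite !section_op1E ?zr//.
rewrite ge0_sume_distrl => [|k _]; last exact: (f0 F k z F0).
apply: eq_bigr => k _; rewrite ge0_sume_distrr => [//|l _].
exact: (f0 G l z G0).
Qed.

Lemma bin_sum_pascal n (e : nat -> nat) :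
  (\sum_(m < n.+2) 'C(n.+1, m) * e m = \sum_(m < n.+1) 'C(n, m) * (e m + e m.+1))%N.
Proof.
rewrite big_ord_recl bin0.
under eq_bigr => i _ do rewrite lift0 binS mulnDl.
rewrite big_split /= addnA; under [RHS]eq_bigr do rewrite mulnDr.
rewrite big_split /=; congr addn.
rewrite [RHS]big_ord_recl bin0; congr addn.
by rewrite big_ord_recr /= bin_small// mul0n addn0.
Qed.

(** The identity exp (- D) exp D = 1 in terms of coefficients, with the negative ones moved to the
    right: cosh D exp D = 1 + sinh D exp D. For n > 0 the even and the odd binomial coefficients
    have the same sum. *)
Lemma conv_even_1 n :
  conv (fun m => ~~ odd m) (fun=> 1%N) n = ((n == 0%N) + conv (fun m => odd m) (fun=> 1%N) n)%N.
Proof.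
rewrite /conv; under eq_bigr do rewrite muln1; under [in RHS]eq_bigr do rewrite muln1.
case: n => [|n]; first by rewrite !big_ord1.
rewrite (bin_sum_pascal n (fun m => ~~ odd m)) (bin_sum_pascal n (fun m => odd m)) add0n; apply: eq_bigr => m _; congr muln.
by rewrite /=; case: (odd m).
Qed.

Lemma convC c c' n : conv c c' n = conv c' c n.
Proof.
rewrite /conv (reindex_inj rev_ord_inj) /=; apply: eq_bigr => m _.
have mn : (m <= n)%N by rewrite -ltnS.
by rewrite subSS bin_sub// subKn// mulnAC.
Qed.

(** This is cosh D, and the next one sinh D; exp (- D) is their difference. *)
Definition even_op := section_op (fun m => ~~ odd m).
Definition odd_op := section_op (fun m => odd m).
Definition exp_op := section_op (fun=> 1%N).

Lemma eq_section_op c c' h z : c =1 c' -> section_op c h z = section_op c' h z.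
Proof. by move=> cc; apply: eq_bigr => m _; rewrite cc. Qed.

Lemma even_exp_op h z : sym_kernel h -> even_op (exp_op h) z = h z + odd_op (exp_op h) z.
Proof.
move=> kh; rewrite /even_op /odd_op /exp_op !section_op_comp//.
rewrite (eq_section_op _ _ conv_even_1) section_op_addc//.
by rewrite (@section_op_id h).
Qed.

Lemma exp_even_op h z : sym_kernel h -> exp_op (even_op h) z = h z + exp_op (odd_op h) z.
Proof.
move=> kh; rewrite /even_op /odd_op /exp_op !section_op_comp//.
rewrite (eq_section_op _ _ (convC _ _)) (eq_section_op _ _ conv_even_1) section_op_addc//.
by rewrite (@section_op_id h)//; congr (_ + _); apply: eq_section_op => n; exact: convC.
Qed.

End second_moment.

(** * Truncation *)

Section integral_bounds.
Context {R : realType} {d : measure_display} {T : measurableType d}.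
Variable mu : {sigma_finite_measure set T -> \bar R}.
Implicit Types F G h : seq T -> \bar R.

(** The function D is integrable, hence finite almost everywhere, and it suffices to compare F and G
    there. *)
Lemma itint_ae_eq n D F G : mseq D -> (forall s, 0 <= D s) -> itint mu n D < +oo ->
  mseq F -> mseq G -> (forall s, 0 <= F s) -> (forall s, 0 <= G s) ->
  (forall s, D s < +oo -> F s = G s) -> itint mu n F = itint mu n G.
Proof.
move=> mD D0 Doo mF mG F0 G0 FG; have [m mE] := power_measure_pack mu n.
have iD : m.-integrable setT (fun t : n.-tuple T => D t).
  apply/integrableP; split; first exact: mD.
  under eq_integral do rewrite gee0_abs//.
  by have := integral_power_measure mu n mD D0; rewrite mE => ->.
rewrite -!integral_power_measure// mE; apply: ge0_ae_eq_integral => //.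
- exact: mF.
- exact: mG.
apply: filterS (integrable_ae measurableT iD) => t h _; apply: FG.
by rewrite -ge0_fin_numE//; exact: h.
Qed.

Lemma boxf_const_le1 (B : set T) s : boxf (fun=> B) s <= 1 :> \bar R.
Proof.
elim: s => //= x s ih; apply: le_trans ih; rewrite -[leRHS]mul1e.
by rewrite lee_wpmul2r ?boxf_ge0// lee_fin indicE lern1; case: (_ \in _).
Qed.

Lemma boxf_cat (B : set T) s t :
  boxf (fun=> B) (s ++ t) = boxf (fun=> B) s * boxf (fun=> B) t :> \bar R.
Proof. by elim: s => [|x s ih] /=; rewrite ?mul1e// ih muleA. Qed.

Lemma itint_section_le (B : set T) (b : R) h n z : measurable B -> (0 <= b)%R ->
  mseq h -> (forall s, 0 <= h s) -> (forall s, h s <= b%:E * boxf (fun=> B) s) ->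
  itint mu n (fun y => h (z ++ y)) <= b%:E * \prod_(i < n) mu B.
Proof.
move=> mB b0 mh h0 hb; have mb : mseq (boxf (R := R) (fun=> B)) by apply: mseq_boxf.
rewrite -itint_boxf// -itintZl//; last by move=> s; exact: boxf_ge0.
apply: le_itint => //; first exact: mseq_catl.
  by apply: mseqM => //; exact: mseq_cst.
move=> s _; apply: le_trans (hb _) _; rewrite lee_wpmul2l// ?lee_fin// boxf_cat.
by rewrite -[leRHS]mul1e lee_wpmul2r// ?boxf_ge0// boxf_const_le1.
Qed.

Lemma prode_fin_num (I : Type) (r : seq I) (f : I -> \bar R) :
  (forall i, f i \is a fin_num) -> \prod_(i <- r) f i \is a fin_num.
Proof. by move=> ff; elim/big_ind : _ => // x y; exact: fin_numM. Qed.

(** Integrals over the box are at most b times powers of the finite number mu B. Only lists of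
    length at most K matter, and adding the bounds for all these lengths makes the constant
    independent of z. *)
Lemma section_op_bounded (c : nat -> nat) K (B : set T) (b : R) h :
  measurable B -> mu B < +oo -> (0 <= b)%R -> sym_kernel K h ->
  (forall s, h s <= b%:E * boxf (fun=> B) s) ->
  exists b' : R, (0 <= b')%R /\ forall z, section_op mu K c h z <= b'%:E.
Proof.
move=> mB Boo b0 kh hb; have [h0 mh sh hK] := kh.
have Bfin : mu B \is a fin_num by rewrite ge0_fin_numE.
pose v (r m : nat) := (c m * 'C(r + m, m))%:R%:E * (b%:E * \prod_(i < m) mu B).
have v0 r m : 0 <= v r m.
  by rewrite mule_ge0 ?natE_ge0// mule_ge0 ?lee_fin//; exact: prode_ge0.
have vfin r m : v r m \is a fin_num by rewrite !fin_numM// prode_fin_num.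
pose S := \sum_(r < K.+1) \sum_(m < K.+1) v r m.
have Sfin : S \is a fin_num.
  by apply/sum_fin_numP => r _ _; apply/sum_fin_numP => m _ _.
have S0 : 0 <= S by apply: sume_ge0 => r _; exact: sume_ge0.
exists (fine S); split; first exact: fine_ge0.
move=> z; rewrite fineK//; have [zK|Kz] := leqP (size z) K; last first.
  have [_ _ _ ->//] := sym_kernel_section_op mu c kh.
have zK' : (size z < K.+1)%N by [].
rewrite /S (bigD1 (Ordinal zK'))//= -[leLHS]adde0; apply: leeD; last first.
  by apply: sume_ge0 => r _; exact: sume_ge0.
apply: lee_sum => m _; rewrite /v lee_wpmul2l ?natE_ge0//.
exact: itint_section_le.
Qed.

End integral_bounds.

Section finite_mass.
Context {R : realType} {d : measure_display} {T : measurableType d}.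
Variable mu : {sigma_finite_measure set T -> \bar R}.
Implicit Types F G h : seq T -> \bar R.

Definition finite_mass h := forall n, itint mu n h < +oo.

Lemma itint_section_op c K n h : sym_kernel K h ->
  itint mu n (section_op mu K c h) =
  \sum_(m < K.+1) (c m * 'C(n + m, m))%:R%:E * itint mu (n + m) h.
Proof.
move=> [h0 mh sh hK].
rewrite (eq_itint mu (G := fun z => \sum_(m < K.+1) (c m * 'C(n + m, m))%:R%:E *
    itint mu m (fun y => h (z ++ y)))); last by move=> z <-.
rewrite itint_sum.
- apply: eq_bigr => m _; rewrite itintZl ?natE_ge0 ?itint_add//.
  + exact: mseq_itint.
  + by move=> s; exact: itint_ge0.
- by move=> m _; apply: mseqM; [exact: mseq_cst|exact: mseq_itint].
- by move=> m s _; rewrite mule_ge0 ?natE_ge0//; exact: itint_ge0.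
Qed.

Lemma finite_mass_section_op c K h : sym_kernel K h -> finite_mass h ->
  finite_mass (section_op mu K c h).
Proof.
move=> kh fh n; rewrite itint_section_op//; apply: lte_sum_pinfty => m _.
rewrite lte_mul_pinfty ?natE_ge0//.
Qed.

Lemma finite_massD F G : mseq F -> mseq G -> (forall s, 0 <= F s) -> (forall s, 0 <= G s) ->
  finite_mass F -> finite_mass G -> finite_mass (fun s => F s + G s).
Proof. by move=> mF mG F0 G0 fF fG n; rewrite itintD// lte_add_pinfty. Qed.

Lemma le_finite_mass F G : mseq F -> mseq G -> (forall s, 0 <= F s) ->
  (forall s, F s <= G s) -> finite_mass G -> finite_mass F.
Proof. by move=> mF mG F0 FG fG n; apply: le_lt_trans (fG n); exact: le_itint. Qed.

(** In each order one factor is integrable and the other is bounded. *)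
Lemma chaos_inner_lty K (b : R) F G : sym_kernel K F -> sym_kernel K G ->
  finite_mass F -> (forall z, exp_op mu K G z <= b%:E) -> chaos_inner mu K F G < +oo.
Proof.
move=> kF kG fF Gb.
have [eF0 mF _ _] := sym_kernel_section_op mu (fun=> 1%N) kF.
have [eG0 mG _ _] := sym_kernel_section_op mu (fun=> 1%N) kG.
have b0 : 0 <= b%:E by exact: le_trans (eG0 [::]) (Gb [::]).
apply: lte_sum_pinfty => r _; rewrite lte_mul_pinfty ?natE_ge0//.
apply: (@le_lt_trans _ _ (itint mu r (fun z => b%:E * exp_op mu K F z))).
  apply: le_itint => //.
  - exact: mseqM.
  - by apply: mseqM => //; exact: mseq_cst.
  - by move=> s; apply: mule_ge0; [exact: eF0|exact: eG0].
  - by move=> s _; rewrite muleC; apply: lee_wpmul2r; [exact: eF0|exact: Gb].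
rewrite itintZl// lte_mul_pinfty//.
by apply: (finite_mass_section_op (fun=> 1%N) kF fF).
Qed.

Lemma cvg_section_op_mass c K n (h : nat -> seq T -> \bar R) :
  (forall j, sym_kernel K (h j)) -> (forall m, itint mu m (h j) @[j --> \oo] --> 0) ->
  itint mu n (section_op mu K c (h j)) @[j --> \oo] --> 0.
Proof.
move=> kh ch; under eq_fun do rewrite itint_section_op//.
suff : (\sum_(m < K.+1) (c m * 'C(n + m, m))%:R%:E * itint mu (n + m) (h j)) @[j --> \oo] -->
    \sum_(m < K.+1) (c m * 'C(n + m, m))%:R%:E * (0 : \bar R).
  by rewrite [X in _ --> X]big1 => [//|m _]; rewrite mule0.
apply: cvg_nnesum => m _; last by apply: cvgeZl; [|exact: ch].
by apply: nearW => j; rewrite mule_ge0 ?natE_ge0//; apply: itint_ge0; have [] := kh j.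
Qed.

End finite_mass.

(** * Cutting kernels down to large sets *)

Section truncation.
Context {R : realType} {d : measure_display} {T : measurableType d}.
Variable mu : {sigma_finite_measure set T -> \bar R}.
Implicit Types F G h : seq T -> \bar R.

Lemma boxf_constE (B : set T) s :
  boxf (fun=> B) s = (all (fun x => x \in B) s)%:R%:E :> \bar R.
Proof.
elim: s => //= x s ->; rewrite indicE.
by case: (x \in B); rewrite ?mul1e// mul0e.
Qed.

Variables (K : nat) (u v : seq T -> \bar R) (B : nat -> set T).
Hypotheses (ku : sym_kernel K u) (kv : sym_kernel K v).
Hypotheses (mB : forall j, measurable (B j)) (ndB : forall i j, (i <= j)%N -> B i `<=` B j).
Hypothesis coverB : \bigcup_j B j = setT.

(** One cut for both u and v, so that cutting commutes with taking differences. It ignores the order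
    of the entries, which keeps symmetric kernels symmetric. *)
Definition trunc j s :=
  [&& u s <= j%:R%:E, v s <= j%:R%:E & all (fun x => x \in B j) s].
Definition cutin h j s := if trunc j s then h s else 0.
Definition cutout h j s := if trunc j s then 0 else h s.

Lemma measurable_trunc j n : measurable_fun [set: n.-tuple T] (fun t : n.-tuple T => trunc j t).
Proof.
have [_ mu' _ _] := ku; have [_ mv _ _] := kv.
apply: measurable_and; first by apply: measurable_fun_lee => //; exact: mu'.
apply: measurable_and; first by apply: measurable_fun_lee => //; exact: mv.
have mb : mseq (boxf (R := R) (fun=> B j)) by apply: mseq_boxf.
rewrite (_ : (fun _ => _) = (fun t : n.-tuple T => 1 <= boxf (R := R) (fun=> B j) t)).
  by apply: measurable_fun_lee => //; exact: mb.
by apply/funext => t; rewrite boxf_constE; case: all; rewrite ?lexx// lee_fin ler10.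
Qed.

Lemma mseq_cutin h j : mseq h -> mseq (cutin h j).
Proof. by move=> mh n; apply: measurable_fun_ifT => //; [exact: measurable_trunc|exact: mh]. Qed.

Lemma mseq_cutout h j : mseq h -> mseq (cutout h j).
Proof. by move=> mh n; apply: measurable_fun_ifT => //; [exact: measurable_trunc|exact: mh]. Qed.

Lemma trunc_perm j s t : perm_eq s t -> trunc j s = trunc j t.
Proof.
have [_ _ su _] := ku; have [_ _ sv _] := kv => st.
by rewrite /trunc (su _ _ st) (sv _ _ st) (perm_all _ st).
Qed.

Lemma sym_kernel_cutin h j : sym_kernel K h -> sym_kernel K (cutin h j).
Proof.
move=> [h0 mh sh hK]; split; rewrite /cutin.
- by move=> s; case: ifP.
- exact: mseq_cutin.
- by move=> s t st; rewrite (trunc_perm _ st) (sh _ _ st).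
- by move=> s Ks; rewrite hK// if_same.
Qed.

Lemma sym_kernel_cutout h j : sym_kernel K h -> sym_kernel K (cutout h j).
Proof.
move=> [h0 mh sh hK]; split; rewrite /cutout.
- by move=> s; case: ifP.
- exact: mseq_cutout.
- by move=> s t st; rewrite (trunc_perm _ st) (sh _ _ st).
- by move=> s Ks; rewrite hK// if_same.
Qed.

Lemma cutD h j s : cutin h j s + cutout h j s = h s.
Proof. by rewrite /cutin /cutout; case: ifP; rewrite ?adde0 ?add0e. Qed.

Lemma trunc_mono s i j : (i <= j)%N -> trunc i s -> trunc j s.
Proof.
move=> ij /and3P[ui vi Bi]; have ij' : i%:R%:E <= j%:R%:E :> \bar R by rewrite lee_fin ler_nat.
apply/and3P; split; [exact: le_trans ui ij'|exact: le_trans vi ij'|].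
by apply: sub_all Bi => x; rewrite !inE; exact: ndB.
Qed.

Lemma trunc_near s : u s < +oo -> v s < +oo -> exists j, trunc j s.
Proof.
have [u0 _ _ _] := ku; have [v0 _ _ _] := kv => us vs.
have bound (x : \bar R) : 0 <= x -> x < +oo -> exists j, x <= j%:R%:E.
  move=> x0 xoo; exists (Num.bound (fine x)).
  have xf : x \is a fin_num by rewrite ge0_fin_numE.
  by rewrite -[leLHS](fineK xf) lee_fin; apply/ltW/archi_boundP; exact: fine_ge0.
have [i ui] := bound _ (u0 s) us; have [j vj] := bound _ (v0 s) vs.
have [l Bl] : exists l, all (fun x => x \in B l) s.
  elim: s {us vs ui vj} => [|x s [l ih]]; first by exists 0%N.
  have [m _ Bmx] : (\bigcup_j B j) x by rewrite coverB.
  exists (maxn l m); apply/andP; split.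
    rewrite inE; by apply: ndB Bmx; rewrite leq_maxr.
  by apply: sub_all ih => y; rewrite !inE; apply: ndB; rewrite leq_maxl.
exists (maxn i (maxn j l)); apply/and3P; split.
- by apply: le_trans ui _; rewrite lee_fin ler_nat leq_maxl.
- by apply: le_trans vj _; rewrite lee_fin ler_nat; lia.
- by apply: sub_all Bl => y; rewrite !inE; apply: ndB; lia.
Qed.

(** Monotone convergence: having finite mass, u and v are finite almost everywhere, and where they
    are finite the cut is eventually inactive. *)
Lemma cvg_itint_cutin n h : mseq h -> (forall s, 0 <= h s) ->
  finite_mass mu u -> finite_mass mu v ->
  itint mu n (cutin h j) @[j --> \oo] --> itint mu n h.
Proof.
move=> mh h0 fu fv; have [m mE] := power_measure_pack mu n.
have [u0 mu' _ _] := ku; have [v0 mv _ _] := kv.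
have c0 j s : 0 <= cutin h j s by rewrite /cutin; case: ifP.
have ndc s i j : (i <= j)%N -> cutin h i s <= cutin h j s.
  by move=> ij; rewrite /cutin; case: ifPn => [/(trunc_mono ij) ->//|_]; case: ifP => // _.
have iE j : itint mu n (cutin h j) = \int[m]_(t in setT) cutin h j (t : n.-tuple T).
  by rewrite -mE integral_power_measure//; exact: mseq_cutin.
under eq_fun do rewrite iE.
suff -> : itint mu n h = \int[m]_(t in setT) limn (fun j => cutin h j (t : n.-tuple T)).
  apply: cvg_monotone_convergence => //.
  - by move=> j; exact: mseq_cutin.
  - by move=> t _ i j ij; exact: ndc.
pose l s := limn (fun j => cutin h j s).
have cl s : cutin h j s @[j --> \oo] --> l s.
  by apply: ereal_nondecreasing_is_cvgn => i j; exact: ndc.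
have l0 s : 0 <= l s by apply: lime_ge; [exact: cl|exact: nearW].
have ml : mseq l.
  move=> r; apply: (emeasurable_fun_cvg (fun j => fun t : r.-tuple T => cutin h j t)).
    by move=> j; exact: mseq_cutin.
  by move=> t _; exact: cl.
transitivity (itint mu n l); last first.
  by rewrite -integral_power_measure// mE.
apply: (itint_ae_eq (D := fun s => u s + v s)) => //.
- exact: mseqD.
- by move=> s; rewrite adde_ge0.
- by rewrite itintD// lte_add_pinfty.
move=> s uvs; have us : u s < +oo by apply: le_lt_trans uvs; rewrite leeDl.
have vs : v s < +oo by apply: le_lt_trans uvs; rewrite leeDr.
have [j tj] := trunc_near us vs.
apply/esym/cvg_lim => //; apply: cvg_near_cst; exists j => // i /= ji.
by rewrite /cutin (trunc_mono ji tj).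
Qed.

Lemma cvg_itint_cutout n h : mseq h -> (forall s, 0 <= h s) ->
  finite_mass mu u -> finite_mass mu v -> itint mu n h < +oo ->
  itint mu n (cutout h j) @[j --> \oo] --> 0.
Proof.
move=> mh h0 fu fv hoo.
have c0 j s : 0 <= cutin h j s by rewrite /cutin; case: ifP.
have c0' j s : 0 <= cutout h j s by rewrite /cutout; case: ifP.
have hfin : itint mu n h \is a fin_num by rewrite ge0_fin_numE//; exact: itint_ge0.
have le j : itint mu n (cutin h j) <= itint mu n h.
  by apply: le_itint => //; [exact: mseq_cutin|move=> s _; rewrite -(cutD h j s) leeDl].
have cfin j : itint mu n (cutin h j) \is a fin_num.
  by rewrite ge0_fin_numE ?itint_ge0//; apply: le_lt_trans (le j) hoo.
have E j : itint mu n (cutout h j) = itint mu n h - itint mu n (cutin h j).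
  have S := itintD mu n (mseq_cutin j mh) (c0 j) (mseq_cutout j mh) (c0' j).
  rewrite (eq_itint mu (G := h)) in S; last by move=> s _; exact: cutD.
  by apply/esym; rewrite S addeC addeA [X in X + _]addeC subee// add0e.
under eq_fun do rewrite E.
rewrite -(subee hfin); apply: cvgeB => //.
- by rewrite fin_num_adde_defl// fin_numN.
- exact: cvg_cst.
- exact: cvg_itint_cutin.
Qed.

End truncation.

(** * The square moment of a difference *)

Section fock.
Context {R : realType} {d : measure_display} {T : measurableType d}.
Variable mu : {sigma_finite_measure set T -> \bar R}.
Variable K : nat.
Implicit Types F G h : seq T -> \bar R.

Definition fock h := \sum_(r < K.+1) r`!%:R%:E * itint mu r h.

Lemma fock_ge0 h : (forall s, 0 <= h s) -> 0 <= fock h.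
Proof.
by move=> h0; apply: sume_ge0 => r _; rewrite mule_ge0 ?natE_ge0//; exact: itint_ge0.
Qed.

Lemma fockD F G : mseq F -> mseq G -> (forall s, 0 <= F s) -> (forall s, 0 <= G s) ->
  fock (fun s => F s + G s) = fock F + fock G.
Proof.
move=> mF mG F0 G0; rewrite /fock -big_split; apply: eq_bigr => r _.
by rewrite itintD// ge0_muleDr//; exact: itint_ge0.
Qed.

Lemma le_fock F G : mseq F -> mseq G -> (forall s, 0 <= F s) -> (forall s, F s <= G s) ->
  fock F <= fock G.
Proof.
move=> mF mG F0 FG; apply: lee_sum => r _; rewrite lee_wpmul2l ?natE_ge0//.
by apply: le_itint.
Qed.

Lemma eq_fock F G : (forall s, F s = G s) -> fock F = fock G.
Proof. by move=> FG; congr fock; exact/funext. Qed.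

(** A square of a difference that is total and never negative. It is meaningful only for finite x
    and y, and the algebraic identities below assume finiteness. *)
Definition sqdiff (x y : \bar R) : \bar R := ((fine x - fine y) ^+ 2)%:E.

Lemma sqdiff_ge0 x y : 0 <= sqdiff x y.
Proof. by rewrite lee_fin sqr_ge0. Qed.

Lemma measurable_sqdiff d' (S : measurableType d') (f g : S -> \bar R) :
  measurable_fun setT f -> measurable_fun setT g ->
  measurable_fun setT (fun s => sqdiff (f s) (g s)).
Proof.
move=> mf mg; apply/measurable_EFinP; apply: measurable_funX.
by apply: measurable_funB; apply: (measurableT_comp (f := fine)) => //; exact: fine_measurable.
Qed.

Lemma sqdiffE (x y : \bar R) : x \is a fin_num -> y \is a fin_num ->
  x * x + y * y = sqdiff x y + (x * y + y * x).
Proof.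
case: x y => [x||] [y||]// _ _; rewrite /sqdiff -?EFinM -?EFinD; congr _%:E => /=.
by ring.
Qed.

Lemma sqdiff_shift (x y r : \bar R) : x \is a fin_num -> y \is a fin_num ->
  r \is a fin_num -> sqdiff (x + r) (y + r) = sqdiff x y.
Proof.
case: x y r => [x||] [y||] [r||]// _ _ _; rewrite /sqdiff -?EFinD; congr _%:E => /=.
by ring.
Qed.

Lemma sqdiff_mixed (x y r : \bar R) : x \is a fin_num -> y \is a fin_num ->
  r \is a fin_num ->
  x * (x + r) + y * (y + r) = sqdiff x y + (x * (y + r) + y * (x + r)).
Proof.
case: x y r => [x||] [y||] [r||]// _ _ _; rewrite /sqdiff -?EFinM -?EFinD; congr _%:E => /=.
by ring.
Qed.

(** This is 2 (x - y) (x' - y') <= (x - y) ^ 2 + (x' - y') ^ 2, with the products expanded and the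
    negative terms moved. *)
Lemma le_sqdiff_mixed (x y x' y' : \bar R) : x \is a fin_num -> y \is a fin_num ->
  x' \is a fin_num -> y' \is a fin_num ->
  (x * x' + y * y') + (x * x' + y * y') <=
  sqdiff x y + sqdiff x' y' + ((x * y' + y * x') + (x * y' + y * x')).
Proof.
case: x y x' y' => [x||] [y||] [x'||] [y'||]// _ _ _ _.
rewrite /sqdiff -?EFinM -?EFinD lee_fin /=.
by have := sqr_ge0 ((x - y) - (x' - y'))%R; nra.
Qed.

End fock.

(** * Second moments when the chaos kernels are bounded *)

Section bounded_square_moment.
Context {R : realType} {d : measure_display} {T : measurableType d}.
Context {dO : measure_display} {Omega : measurableType dO} (P : probability Omega R).
Variable mu : {sigma_finite_measure set T -> \bar R}.
Variable A : Omega -> set T.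
Hypothesis measurable_dsumA : forall n (F : seq T -> \bar R), mseq F -> (forall s, 0 <= F s) ->
  measurable_fun setT (fun w => dsum n F (A w)).
Hypothesis expectation_dsumA : forall n (F : seq T -> \bar R), mseq F -> (forall s, 0 <= F s) ->
  \int[P]_w dsum n F (A w) = itint mu n F.
Variable K : nat.
Implicit Types F G h : seq T -> \bar R.

Lemma mule_exp_ge0 a b s : sym_kernel K a -> sym_kernel K b ->
  0 <= exp_op mu K a s * exp_op mu K b s.
Proof.
by move=> [a0 _ _ _] [b0 _ _ _]; apply: mule_ge0; exact: section_op_ge0.
Qed.

Lemma mseq_mule_exp a b : sym_kernel K a -> sym_kernel K b ->
  mseq (fun s => exp_op mu K a s * exp_op mu K b s).
Proof. by move=> [a0 ma _ _] [b0 mb _ _]; apply: mseqM; exact: mseq_section_op. Qed.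

(** For finite values the pointwise hypothesis says that [sg] is the product of the differences exp
    D a - exp D b and exp D a' - exp D b'; integrating it gives the polarized form of the square
    norm. *)
Lemma chaos_mixed a b a' b' (sg : seq T -> \bar R) :
  sym_kernel K a -> sym_kernel K b -> sym_kernel K a' -> sym_kernel K b' ->
  mseq sg -> (forall s, 0 <= sg s) ->
  (forall s, exp_op mu K a s * exp_op mu K a' s + exp_op mu K b s * exp_op mu K b' s =
    sg s + (exp_op mu K a s * exp_op mu K b' s + exp_op mu K b s * exp_op mu K a' s)) ->
  chaos_inner mu K a a' + chaos_inner mu K b b' =
  fock mu K sg + (chaos_inner mu K a b' + chaos_inner mu K b a').
Proof.
move=> ka kb ka' kb' msg sg0 E.
rewrite -![chaos_inner _ _ _ _]/(fock mu K (fun s => exp_op mu K _ s * exp_op mu K _ s)).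
have := mseq_mule_exp; have := mule_exp_ge0 => m0 mm.
rewrite -!fockD//; do ?[by exact: mm|by move=> s; exact: m0].
- exact: eq_fock.
- by apply: mseqD; exact: mm.
- by move=> s; rewrite adde_ge0// m0.
Qed.

Local Notation total := (total_sum (R := R) A K).
Local Notation Exp := (exp_op mu K).

Lemma total_sum_ae_fin h : sym_kernel K h -> finite_mass mu h ->
  {ae P, forall w, total h w \is a fin_num}.
Proof.
move=> kh fh; have [h0 _ _ _] := kh.
have th0 w : 0 <= total h w by exact: total_sum_ge0.
have mt : measurable_fun setT (total h) by exact: measurable_total_sum.
have it : P.-integrable setT (total h).
  apply/integrableP; split => //.
  under eq_integral do rewrite gee0_abs//.
  rewrite (expectation_total_sum (P := P) (mu := mu))//.
  by apply: lte_sum_pinfty => n _; exact: fh.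
by apply: filterS (integrable_ae measurableT it) => w; exact.
Qed.

(** The common remainder [rho] drops out of the difference of the two exponentials. Their
    boundedness makes all four chaos products finite, which permits cancelling the cross terms. *)
Lemma square_moment_bounded (a b t t' rho : seq T -> \bar R) (c : R) :
  sym_kernel K a -> sym_kernel K b -> finite_mass mu a -> finite_mass mu b ->
  (forall s, 0 <= t s) -> (forall s, 0 <= t' s) -> (forall s, 0 <= rho s) ->
  mseq t -> mseq t' ->
  (forall s, Exp a s = t s + rho s) -> (forall s, Exp b s = t' s + rho s) ->
  (forall s, Exp a s <= c%:E) -> (forall s, Exp b s <= c%:E) ->
  \int[P]_w sqdiff (total a w) (total b w) = fock mu K (fun s => sqdiff (t s) (t' s)) /\
  fock mu K (fun s => sqdiff (t s) (t' s)) < +oo.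
Proof.
move=> ka kb fa fb t0 t'0 r0 mt mt' at_ bt ac bc.
have [a0 _ _ _] := ka; have [b0 _ _ _] := kb.
have ta0 w : 0 <= total a w by exact: total_sum_ge0.
have tb0 w : 0 <= total b w by exact: total_sum_ge0.
have mta : measurable_fun setT (total a) by exact: measurable_total_sum.
have mtb : measurable_fun setT (total b) by exact: measurable_total_sum.
have mM : mseq (fun s => sqdiff (t s) (t' s)).
  by move=> n; apply: measurable_sqdiff; [exact: mt|exact: mt'].
set M := fock _ _ _.
have efin x y z : x + y <= z%:E -> 0 <= x -> 0 <= y ->
    (x \is a @fin_num R) * (y \is a @fin_num R).
  move=> xyz x0 y0; rewrite !ge0_fin_numE//; split.
    by apply: le_lt_trans (ltry z); apply: le_trans xyz; rewrite leeDl.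
  by apply: le_lt_trans (ltry z); apply: le_trans xyz; rewrite leeDr.
have aa : chaos_inner mu K a a < +oo by exact: (chaos_inner_lty ka ka fa ac).
have bb : chaos_inner mu K b b < +oo by exact: (chaos_inner_lty kb kb fb bc).
have ab : chaos_inner mu K a b < +oo by exact: (chaos_inner_lty ka kb fa bc).
have ba : chaos_inner mu K b a < +oo by exact: (chaos_inner_lty kb ka fb ac).
have ch0 x y : sym_kernel K x -> sym_kernel K y -> 0 <= chaos_inner mu K x y.
  by move=> kx ky; apply: fock_ge0 => s; exact: mule_exp_ge0.
have chaosE : chaos_inner mu K a a + chaos_inner mu K b b =
    M + (chaos_inner mu K a b + chaos_inner mu K b a).
  apply: chaos_mixed => // [s|s]; first exact: sqdiff_ge0.
  have := ac s; have := bc s.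
  rewrite at_ bt => /efin => /(_ (t'0 s) (r0 s)) fb' /efin => /(_ (t0 s) (r0 s)) fa'.
  by rewrite sqdiffE ?sqdiff_shift// ?fin_numD ?fa' ?fb'.
have Moo : M < +oo.
  apply: le_lt_trans (lte_add_pinfty aa bb); rewrite chaosE leeDl//.
  by rewrite adde_ge0// ch0.
split=> //.
have EE : \int[P]_w (total a w * total a w) + \int[P]_w (total b w * total b w) =
    \int[P]_w sqdiff (total a w) (total b w) +
    (\int[P]_w (total a w * total b w) + \int[P]_w (total b w * total a w)).
  rewrite -!ge0_integralD//; do ?[by move=> w _; rewrite ?adde_ge0 ?mule_ge0 ?sqdiff_ge0].
  - apply: ge0_ae_eq_integral => //; last first.
      have := total_sum_ae_fin ka fa; have := total_sum_ae_fin kb fb.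
      by apply: filterS2 => w wb wa _; exact: sqdiffE.
    + by move=> w _; rewrite adde_ge0 ?sqdiff_ge0// adde_ge0// mule_ge0.
    + by move=> w _; rewrite adde_ge0 ?mule_ge0.
    + apply: emeasurable_funD; first exact: measurable_sqdiff.
      by apply: emeasurable_funD; exact: emeasurable_funM.
    + by apply: emeasurable_funD; exact: emeasurable_funM.
  all: try exact: emeasurable_funM.
  all: try exact: measurable_sqdiff.
  by apply: emeasurable_funD; exact: emeasurable_funM.
have := EE; rewrite !(expectation_total_sum_mul (P := P) (mu := mu))// chaosE.
have fin : chaos_inner mu K a b + chaos_inner mu K b a \is a fin_num.
  by rewrite ge0_fin_numE ?lte_add_pinfty// adde_ge0// ch0.
by move=> /(congr1 (fun x => x - (chaos_inner mu K a b + chaos_inner mu K b a))); rewrite !addeK.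
Qed.

End bounded_square_moment.

(** * Passage from bounded to integrable chaos kernels *)

Section square_moment.
Context {R : realType} {d : measure_display} {T : measurableType d}.
Context {dO : measure_display} {Omega : measurableType dO} (P : probability Omega R).
Variable mu : {sigma_finite_measure set T -> \bar R}.
Variable A : Omega -> set T.
Hypothesis measurable_dsumA : forall n (F : seq T -> \bar R), mseq F -> (forall s, 0 <= F s) ->
  measurable_fun setT (fun w => dsum n F (A w)).
Hypothesis expectation_dsumA : forall n (F : seq T -> \bar R), mseq F -> (forall s, 0 <= F s) ->
  \int[P]_w dsum n F (A w) = itint mu n F.
Variables (K : nat) (p q : seq T -> \bar R) (B : nat -> set T).
Hypotheses (kp : sym_kernel K p) (kq : sym_kernel K q).
Hypotheses (fp : finite_mass mu p) (fq : finite_mass mu q).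
Hypotheses (mB : forall j, measurable (B j)) (ndB : forall i j, (i <= j)%N -> B i `<=` B j).
Hypotheses (coverB : \bigcup_j B j = setT) (Boo : forall j, mu (B j) < +oo).

Local Notation total := (total_sum (R := R) A K).
Local Notation Exp := (exp_op mu K).
Local Notation Even := (even_op mu K).
Local Notation Odd := (odd_op mu K).

Let kHp : sym_kernel K (Exp p) := sym_kernel_section_op mu _ kp.
Let kHq : sym_kernel K (Exp q) := sym_kernel_section_op mu _ kq.
Let fHp : finite_mass mu (Exp p) := finite_mass_section_op _ kp fp.
Let fHq : finite_mass mu (Exp q) := finite_mass_section_op _ kq fq.

Let kin h j (kh : sym_kernel K h) := sym_kernel_cutin kHp kHq mB j kh.
Let kout h j (kh : sym_kernel K h) := sym_kernel_cutout kHp kHq mB j kh.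
Local Notation inner := (cutin (Exp p) (Exp q) B).
Local Notation outer := (cutout (Exp p) (Exp q) B).

(* The difference of [a j] and [a' j] is [exp (- D)] applied to the truncated
   difference of [Exp p] and [Exp q]; that of [b j] and [b' j] is the
   remainder.  Splitting [exp (- D)] into even and odd parts keeps all four
   kernels nonnegative. *)
Let a j s := Even (inner (Exp p) j) s + Odd (inner (Exp q) j) s.
Let a' j s := Even (inner (Exp q) j) s + Odd (inner (Exp p) j) s.
Let b j s := Even (outer (Exp p) j) s + Odd (outer (Exp q) j) s.
Let b' j s := Even (outer (Exp q) j) s + Odd (outer (Exp p) j) s.
Let rho j s := Exp (Odd (inner (Exp p) j)) s + Exp (Odd (inner (Exp q) j)) s.

Let keo h h' : sym_kernel K h -> sym_kernel K h' -> sym_kernel K (fun s => Even h s + Odd h' s).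
Proof. by move=> kh kh'; apply: sym_kernelD; exact: sym_kernel_section_op. Qed.

Let ka j : sym_kernel K (a j). Proof. by apply: keo; exact: kin. Qed.
Let ka' j : sym_kernel K (a' j). Proof. by apply: keo; exact: kin. Qed.
Let kb j : sym_kernel K (b j). Proof. by apply: keo; exact: kout. Qed.
Let kb' j : sym_kernel K (b' j). Proof. by apply: keo; exact: kout. Qed.

(** From exp D cosh D = 1 + exp D sinh D. The remainder is symmetric in [h] and [h'], so it cancels
    in the difference of the two kernels obtained by exchanging them. *)
Let exp_even_odd h h' s : sym_kernel K h -> sym_kernel K h' ->
  Exp (fun z => Even h z + Odd h' z) s = h s + (Exp (Odd h) s + Exp (Odd h') s).
Proof.
move=> kh kh'; rewrite /exp_op section_opD; [|exact: sym_kernel_section_op..].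
have := exp_even_op mu s kh; rewrite /exp_op => ->.
by rewrite addeA.
Qed.

Let expa j s : Exp (a j) s = inner (Exp p) j s + rho j s.
Proof. by rewrite exp_even_odd//; exact: kin. Qed.

Let expa' j s : Exp (a' j) s = inner (Exp q) j s + rho j s.
Proof. by rewrite exp_even_odd; [rewrite /rho [X in _ + X]addeC|exact: kin..]. Qed.

Let finite_keo h h' : sym_kernel K h -> sym_kernel K h' -> finite_mass mu h -> finite_mass mu h' ->
  finite_mass mu (fun s => Even h s + Odd h' s).
Proof.
move=> kh kh' fh fh'.
have [e0 me _ _] := sym_kernel_section_op mu (fun m => ~~ odd m) kh.
have [g0 mg _ _] := sym_kernel_section_op mu (fun m => odd m) kh'.
by apply: finite_massD => //; exact: finite_mass_section_op.
Qed.

Let fin h j : sym_kernel K h -> finite_mass mu h -> finite_mass mu (inner h j).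
Proof.
move=> kh fh; have [h0 mh _ _] := kh; have [i0 mi _ _] := kin j kh.
by apply: (le_finite_mass mi mh i0 _ fh) => s; rewrite /cutin; case: ifP.
Qed.

Let fout h j : sym_kernel K h -> finite_mass mu h -> finite_mass mu (outer h j).
Proof.
move=> kh fh; have [h0 mh _ _] := kh; have [i0 mi _ _] := kout j kh.
by apply: (le_finite_mass mi mh i0 _ fh) => s; rewrite /cutout; case: ifP.
Qed.

Let fa j : finite_mass mu (a j).
Proof. by apply: finite_keo; [exact: kin|exact: kin|exact: fin|exact: fin]. Qed.
Let fa' j : finite_mass mu (a' j).
Proof. by apply: finite_keo; [exact: kin|exact: kin|exact: fin|exact: fin]. Qed.
Let fb j : finite_mass mu (b j).
Proof. by apply: finite_keo; [exact: kout|exact: kout|exact: fout|exact: fout]. Qed.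
Let fb' j : finite_mass mu (b' j).
Proof. by apply: finite_keo; [exact: kout|exact: kout|exact: fout|exact: fout]. Qed.

Let inner_le h j s : sym_kernel K h -> (trunc (Exp p) (Exp q) B j s -> h s <= j%:R%:E) ->
  inner h j s <= j%:R%:E * boxf (fun=> B j) s.
Proof.
move=> kh hj; rewrite /cutin; case: ifPn => [tr|_]; last by rewrite mule_ge0 ?boxf_ge0 ?natE_ge0.
by rewrite boxf_constE; have /and3P[_ _ ->] := tr; rewrite mule1 hj.
Qed.

(** The cut kernels are at most j and live on the box over [B j], of finite mass; [rho] arises from
    them by a single power series in D, hence is bounded too. *)
Let exp_bounded j : exists c : R, (forall s, Exp (a j) s <= c%:E) /\ (forall s, Exp (a' j) s <= c%:E).
Proof.
have j0 : (0 <= j%:R :> R)%R by exact: ler0n.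
have ip s : inner (Exp p) j s <= j%:R%:E * boxf (fun=> B j) s.
  by apply: inner_le => // /and3P[].
have iq s : inner (Exp q) j s <= j%:R%:E * boxf (fun=> B j) s.
  by apply: inner_le => // /and3P[].
have kip := kin j kHp; have kiq := kin j kHq.
have [r [r0 hr]] := section_op_bounded (conv (fun=> 1%N) (fun m => odd m)) (mB j) (Boo j) j0 kip ip.
have [r' [r'0 hr']] := section_op_bounded (conv (fun=> 1%N) (fun m => odd m)) (mB j) (Boo j) j0 kiq iq.
have rr s : rho j s <= (r + r')%:E.
  by rewrite EFinD /rho /exp_op /odd_op !section_op_comp// leeD.
have le1 h s : sym_kernel K h -> inner h j s <= j%:R%:E * boxf (fun=> B j) s -> inner h j s <= j%:R%:E.
  move=> _ /le_trans; apply; rewrite -[leRHS]mule1 lee_wpmul2l ?natE_ge0//.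
  exact: boxf_const_le1.
exists (j%:R + (r + r'))%R; split => s; rewrite ?expa ?expa' EFinD leeD//; exact: le1.
Qed.

Let square_moment_inner j :
  \int[P]_w sqdiff (total (a j) w) (total (a' j) w) =
    fock mu K (inner (fun s => sqdiff (Exp p s) (Exp q s)) j) /\
  fock mu K (inner (fun s => sqdiff (Exp p s) (Exp q s)) j) < +oo.
Proof.
have [c [ac a'c]] := exp_bounded j.
have [i0 mi _ _] := kin j kHp; have [i0' mi' _ _] := kin j kHq.
have sE : inner (fun s => sqdiff (Exp p s) (Exp q s)) j =
    (fun s => sqdiff (inner (Exp p) j s) (inner (Exp q) j s)).
  by apply/funext => s; rewrite /cutin; case: ifP => // _; rewrite /sqdiff /= subr0 expr0n.
rewrite sE; apply: (square_moment_bounded measurable_dsumA expectation_dsumA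
  (ka j) (ka' j) (fa j) (fa' j) i0 i0' _ mi mi' (expa j) (expa' j) ac a'c).
move=> s; apply: adde_ge0; apply: section_op_ge0 => z;
  by apply: section_op_ge0 => y; rewrite ?i0.
Qed.

(** This quantity is the mean of [total (b j)] plus [total (b' j)], which dominates the error of the
    approximation. It vanishes in the limit because the parts cut away lose their mass and exp (- D)
    involves finitely many integrations. *)
Let cvg_outer_mass : \sum_(n < K.+1) itint mu n (b j) + \sum_(n < K.+1) itint mu n (b' j)
  @[j --> \oo] --> 0.
Proof.
have cvg_op c n h : sym_kernel K h -> finite_mass mu h ->
    itint mu n (section_op mu K c (outer h j)) @[j --> \oo] --> 0.
  move=> kh fh; apply: cvg_section_op_mass => [j|m]; first exact: kout.
  have [h0 mh _ _] := kh.
  exact: (cvg_itint_cutout kHp kHq mB ndB coverB mh h0 fHp fHq (fh m)).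
have cvg_eo n h h' : sym_kernel K h -> sym_kernel K h' -> finite_mass mu h -> finite_mass mu h' ->
    itint mu n (fun s => Even (outer h j) s + Odd (outer h' j) s) @[j --> \oo] --> 0.
  move=> kh kh' fh fh'.
  have E j : itint mu n (fun s => Even (outer h j) s + Odd (outer h' j) s) =
      itint mu n (Even (outer h j)) + itint mu n (Odd (outer h' j)).
    have [e0 me _ _] := sym_kernel_section_op mu (fun m => ~~ odd m) (kout j kh).
    have [g0 mg _ _] := sym_kernel_section_op mu (fun m => odd m) (kout j kh').
    exact: itintD.
  under eq_fun do rewrite E.
  suff : itint mu n (Even (outer h j)) + itint mu n (Odd (outer h' j)) @[j --> \oo] --> (0 + 0 : \bar R).
    by rewrite [X in _ --> X]adde0.
  by apply: cvgeD => //; exact: cvg_op.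
have z : \sum_(n < K.+1) (0 : \bar R) = 0 by rewrite big1.
suff : \sum_(n < K.+1) itint mu n (b j) + \sum_(n < K.+1) itint mu n (b' j) @[j --> \oo] -->
    \sum_(n < K.+1) (0 : \bar R) + \sum_(n < K.+1) (0 : \bar R).
  by rewrite [X in _ --> X + X]z [X in _ --> X]adde0.
apply: cvgeD; first by rewrite z.
- apply: cvg_nnesum => n _; last exact: cvg_eo.
  by apply: nearW => j; apply: itint_ge0; have [] := kb j.
- apply: cvg_nnesum => n _; last exact: cvg_eo.
  by apply: nearW => j; apply: itint_ge0; have [] := kb' j.
Qed.

Let Xf := total_sum_ae_fin measurable_dsumA expectation_dsumA.

(** The cut part and the rest add up to exp D h, from which cosh D exp D = 1 + sinh D exp D recovers
    [h]. The added terms are symmetric in [h] and [h'], so they disappear from the difference of the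
    cases (p, q) and (q, p). *)
Let decompose h h' j w : sym_kernel K h -> sym_kernel K h' ->
  total h w + (total (Odd (Exp h)) w + total (Odd (Exp h')) w) =
  total (fun s => Even (inner (Exp h) j) s + Odd (inner (Exp h') j) s) w +
  total (fun s => Even (outer (Exp h) j) s + Odd (outer (Exp h') j) s) w.
Proof.
move=> kh kh'; have kH := sym_kernel_section_op mu (fun=> 1%N) kh.
have kH' := sym_kernel_section_op mu (fun=> 1%N) kh'.
have kO g : sym_kernel K g -> sym_kernel K (Odd g) by exact: sym_kernel_section_op.
rewrite -!total_sumD; [|by [apply: keo; exact: kin|apply: keo; exact: kout|exact: kO|
  exact: kh|apply: sym_kernelD; exact: kO]..].
congr total_sum; apply/funext => s.
rewrite addeACA -[Even _ s + _]section_opD; [|exact: kin|exact: kout].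
rewrite -[Odd _ s + Odd (outer _ _) s]section_opD; [|exact: kin|exact: kout].
have cE g : (fun z => inner g j z + outer g j z) = g by apply/funext => z; exact: cutD.
by rewrite !cE addeA; congr (_ + _); exact/esym/even_exp_op.
Qed.

Let tot0 h w : sym_kernel K h -> 0 <= total h w.
Proof. by move=> [h0 _ _ _]; exact: total_sum_ge0. Qed.

Let mtot h : sym_kernel K h -> measurable_fun setT (total h).
Proof. exact: measurable_total_sum. Qed.

Let fsq s := sqdiff (Exp p s) (Exp q s).

Let msq : mseq fsq.
Proof.
by have [_ mp _ _] := kHp; have [_ mq _ _] := kHq; move=> n; apply: measurable_sqdiff; [exact: mp|exact: mq].
Qed.

Let sq0 s : 0 <= fsq s. Proof. exact: sqdiff_ge0. Qed.

Let cvg_fock_inner : fock mu K (inner fsq j) @[j --> \oo] --> fock mu K fsq.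
Proof.
apply: cvg_nnesum => r _.
  apply: nearW => j; rewrite mule_ge0 ?natE_ge0//; apply: itint_ge0 => s.
  by rewrite /cutin; case: ifP.
apply: cvgeZl => //.
exact: (cvg_itint_cutin kHp kHq mB ndB coverB).
Qed.

Let kO h : sym_kernel K h -> sym_kernel K (Odd h).
Proof. exact: sym_kernel_section_op. Qed.

Let fO h : sym_kernel K h -> finite_mass mu h -> finite_mass mu (Odd h).
Proof. exact: finite_mass_section_op. Qed.

Let approximation j : {ae P, forall w,
  [/\ [/\ total p w \is a fin_num, total q w \is a fin_num,
          total (a j) w \is a fin_num & total (a' j) w \is a fin_num],
      total (b j) w \is a fin_num, total (b' j) w \is a fin_num &
      (fine (total p w) - fine (total q w) - (fine (total (a j) w) - fine (total (a' j) w)) =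
       fine (total (b j) w) - fine (total (b' j) w))%R]}.
Proof.
have aeI (Q Q' : Omega -> Prop) : {ae P, forall w, Q w} -> {ae P, forall w, Q' w} ->
    {ae P, forall w, Q w /\ Q' w} by apply: filterS2 => w; split.
have H1 := aeI _ _ (Xf kp fp) (Xf kq fq).
have H2 := aeI _ _ (Xf (ka j) (fa j)) (Xf (ka' j) (fa' j)).
have H3 := aeI _ _ (Xf (kb j) (fb j)) (Xf (kb' j) (fb' j)).
have H4 := aeI _ _ (Xf (kO kHp) (fO kHp fHp)) (Xf (kO kHq) (fO kHq fHq)).
have := aeI _ _ (aeI _ _ H1 H2) (aeI _ _ H3 H4).
apply: filterS => w [[[pf qf] [af a'f]] [[bf b'f] [of_ o'f]]]; split => //.
have := decompose j w kq kp; have := decompose j w kp kq.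
rewrite -/(a j) -/(a' j) -/(b j) -/(b' j).
move: pf qf af a'f bf b'f of_ o'f.
case: (total p w) => // x _; case: (total q w) => // y _.
case: (total (a j) w) => // z _; case: (total (a' j) w) => // z' _.
case: (total (b j) w) => // t _; case: (total (b' j) w) => // t' _.
case: (total (Odd (Exp p)) w) => // r _; case: (total (Odd (Exp q)) w) => // r' _.
by rewrite -!EFinD => -[e] [e']; move: e e' => /=; lra.
Qed.

(* With [U] the difference of the sums of [p] and [q] and [W] that of [a j]
   and [a' j], integrates [2 U W <= U ^ 2 + W ^ 2], with the products
   expanded and moved so that every integrand is nonnegative. *)
Let square_moment_ge : fock mu K fsq <= \int[P]_w sqdiff (total p w) (total q w).
Proof.
have c0 h h' : sym_kernel K h -> sym_kernel K h' -> 0 <= chaos_inner mu K h h'.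
  by move=> kh kh'; apply: fock_ge0 => s; exact: mule_exp_ge0.
suff le j : fock mu K (inner fsq j) <= \int[P]_w sqdiff (total p w) (total q w).
  rewrite -(cvg_lim _ cvg_fock_inner)//; apply: lime_le; last exact: nearW.
  by apply/cvg_ex; eexists; exact: cvg_fock_inner.
have [EW Moo] := square_moment_inner j; set M := fock mu K (inner fsq j) in EW Moo *.
have [c [ac a'c]] := exp_bounded j.
have mi : mseq (inner fsq j) by exact: (mseq_cutin kHp kHq mB).
have i0 s : 0 <= inner fsq j s by rewrite /cutin; case: ifP.
have M0 : 0 <= M by exact: fock_ge0.
have chaosE : chaos_inner mu K p (a j) + chaos_inner mu K q (a' j) =
    M + (chaos_inner mu K p (a' j) + chaos_inner mu K q (a j)).
  apply: chaos_mixed => // s.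
  (* Off the truncation set both exponentials of the approximating kernels reduce to [rho], and the
     two sides agree trivially. *)
  rewrite expa expa' /cutin; case: ifPn => [/and3P[up uq _]|_]; last first.
    by rewrite !add0e.
  have [p0 _ _ _] := kHp; have [q0 _ _ _] := kHq.
  have fin_le (x : \bar R) (r : R) : 0 <= x -> x <= r%:E -> x \is a fin_num.
    by move=> x0 xr; rewrite ge0_fin_numE//; apply: le_lt_trans xr (ltry _).
  have pfin := fin_le _ _ (p0 s) up; have qfin := fin_le _ _ (q0 s) uq.
  apply: sqdiff_mixed => //; apply: (fin_le _ c).
    have [r0 _ _ _] := sym_kernel_section_op mu (fun=> 1%N) (kO (kin j kHp)).
    have [r0' _ _ _] := sym_kernel_section_op mu (fun=> 1%N) (kO (kin j kHq)).
    by apply: adde_ge0; [exact: r0|exact: r0'].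
  apply: le_trans (ac s); rewrite expa leeDr//.
  by have [z0 _ _ _] := kin j kHp; exact: z0.
set D := chaos_inner mu K p (a' j) + chaos_inner mu K q (a j) in chaosE.
have D0 : 0 <= D by rewrite adde_ge0// c0.
have Dfin : D \is a fin_num.
  by rewrite ge0_fin_numE// lte_add_pinfty//; [exact: chaos_inner_lty kp (ka' j) fp a'c|
    exact: chaos_inner_lty kq (ka j) fq ac].
have Mfin : M \is a fin_num by rewrite ge0_fin_numE.
have mm h h' : sym_kernel K h -> sym_kernel K h' -> measurable_fun setT (fun w => total h w * total h' w).
  by move=> kh kh'; apply: emeasurable_funM; exact: mtot.
have m0 h h' w : sym_kernel K h -> sym_kernel K h' -> 0 <= total h w * total h' w.
  by move=> kh kh'; apply: mule_ge0; exact: tot0.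
have ms h h' : sym_kernel K h -> sym_kernel K h' -> measurable_fun setT (fun w => sqdiff (total h w) (total h' w)).
  by move=> kh kh'; apply: measurable_sqdiff; exact: mtot.
pose f1 w := total p w * total (a j) w + total q w * total (a' j) w.
pose f2 w := total p w * total (a' j) w + total q w * total (a j) w.
have mf1 : measurable_fun setT f1 by apply: emeasurable_funD; exact: mm.
have mf2 : measurable_fun setT f2 by apply: emeasurable_funD; exact: mm.
have f10 w : 0 <= f1 w by apply: adde_ge0; exact: m0.
have f20 w : 0 <= f2 w by apply: adde_ge0; exact: m0.
have int1 : \int[P]_w f1 w = M + D.
  rewrite ge0_integralD//; do ?[by move=> w _; exact: m0|by exact: mm].
  by rewrite -chaosE; congr (_ + _); exact: expectation_total_sum_mul.
have int2 : \int[P]_w f2 w = D.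
  rewrite ge0_integralD//; do ?[by move=> w _; exact: m0|by exact: mm].
  by congr (_ + _); exact: expectation_total_sum_mul.
have : \int[P]_w (f1 w + f1 w) <=
    \int[P]_w (sqdiff (total p w) (total q w) + sqdiff (total (a j) w) (total (a' j) w) + (f2 w + f2 w)).
  apply: ae_ge0_le_integral => //.
  - by move=> w _; rewrite adde_ge0.
  - exact: emeasurable_funD.
  - by move=> w _; rewrite adde_ge0// adde_ge0// sqdiff_ge0.
  - apply: emeasurable_funD; last exact: emeasurable_funD.
    by apply: emeasurable_funD; exact: ms.
  - apply: filterS (approximation j) => w [[pf qf af a'f] _ _ _] _.
    exact: le_sqdiff_mixed.
have mss : measurable_fun setT (fun w => sqdiff (total p w) (total q w) +
    sqdiff (total (a j) w) (total (a' j) w)) by apply: emeasurable_funD; exact: ms.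
have mff : measurable_fun setT (fun w => f2 w + f2 w) by exact: emeasurable_funD.
have ss0 w : 0 <= sqdiff (total p w) (total q w) + sqdiff (total (a j) w) (total (a' j) w).
  by rewrite adde_ge0// sqdiff_ge0.
have ff0 w : 0 <= f2 w + f2 w by rewrite adde_ge0.
rewrite ge0_integralD//.
rewrite [leRHS](ge0_integralD _ _ (fun w _ => ss0 w) _ (fun w _ => ff0 w))//.
rewrite [X in _ <= X + _]ge0_integralD//; do ?[by move=> w _; exact: sqdiff_ge0|by exact: ms].
rewrite [X in _ <= _ + X]ge0_integralD// int1 int2 EW.
(* With I the integral of the squared difference for p and q, this reads 2 (M + D) <= I + M + 2 D;
   as M and D are finite, M <= I follows. *)
rewrite -(fineK Mfin) -(fineK Dfin).
case: (\int[P]_w _) => [z||]; rewrite ?leey//.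
by rewrite -!EFinD !lee_fin; lra.
Qed.

(* If [Z] is [U] cut off outside [|U| <= c], then [Z ^ 2 <= W ^ 2 + 2 c |U - W|],
   and [|U - W|] tends to [0] in mean. *)
Let square_moment_le : \int[P]_w sqdiff (total p w) (total q w) <= fock mu K fsq.
Proof.
pose u w := (fine (total p w) - fine (total q w))%R.
have mu_ : measurable_fun setT u.
  by apply: measurable_funB; apply: (measurableT_comp (f := fine)); [exact: fine_measurable|exact: mtot|exact: fine_measurable|exact: mtot].
pose Z c w : \bar R := if (`|u w| <= c%:R)%R then (u w ^+ 2)%:E else 0.
have mZ c : measurable_fun setT (Z c).
  apply: measurable_fun_ifT => //.
  - by apply: measurable_fun_ler => //; exact: measurableT_comp.
  - by apply/measurable_EFinP; exact: measurable_funX.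
have Z0 c w : 0 <= Z c w by rewrite /Z; case: ifP; rewrite // lee_fin sqr_ge0.
have ndZ w : {homo Z ^~ w : c c' / (c <= c')%N >-> c <= c'}.
  move=> c c' cc'; rewrite /Z; case: ifPn => [uc|_]; last by case: ifP; rewrite // lee_fin sqr_ge0.
  by rewrite (le_trans uc)// ler_nat.
have limZ w : limn (Z ^~ w) = (u w ^+ 2)%:E.
  apply/cvg_lim => //; apply: cvg_near_cst; exists (Num.bound `|u w|) => // c /= uc.
  by rewrite /Z ifT// ltW// (lt_le_trans (archi_boundP _))// ler_nat.
suff le : forall n, \int[P]_w Z n w <= fock mu K fsq.
  have -> : \int[P]_w sqdiff (total p w) (total q w) = \int[P]_w limn (Z ^~ w).
    by apply: eq_integral => w _; rewrite limZ.
  have cv := cvg_monotone_convergence (mu := P) measurableT mZ (fun c w _ => Z0 c w) (fun w _ => ndZ w).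
  rewrite -(cvg_lim _ cv)//; apply: lime_le; last exact: nearW.
  by apply/cvg_ex; eexists; exact: cv.
move=> c; pose eps j := \sum_(n < K.+1) itint mu n (b j) + \sum_(n < K.+1) itint mu n (b' j).
suff le_eps : forall j, \int[P]_w Z c w <= fock mu K fsq + (2 * c%:R)%:E * eps j.
  have cv : fock mu K fsq + (2 * c%:R)%:E * eps j @[j --> \oo] --> fock mu K fsq + (2 * c%:R)%:E * 0.
    apply: cvgeD; [by rewrite mule0 fin_num_adde_defl|exact: cvg_cst|].
    by apply: cvgeZl => //; exact: cvg_outer_mass.
  rewrite -[leRHS]adde0 -[X in _ + X](mule0 (2 * c%:R)%:E) -(cvg_lim _ cv)//.
  apply: lime_ge; last exact: nearW.
  by apply/cvg_ex; eexists; exact: cv.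
move=> j; have [EW _] := square_moment_inner j.
have ms : measurable_fun setT (fun w => sqdiff (total (a j) w) (total (a' j) w)).
  by apply: measurable_sqdiff; exact: mtot.
have bb0 w : 0 <= total (b j) w + total (b' j) w by apply: adde_ge0; exact: tot0.
have mbb : measurable_fun setT (fun w => total (b j) w + total (b' j) w).
  by apply: emeasurable_funD; exact: mtot.
have c2 : 0 <= (2 * c%:R)%:E :> \bar R by rewrite lee_fin mulr_ge0.
apply: (@le_trans _ _ (\int[P]_w (sqdiff (total (a j) w) (total (a' j) w) +
    (2 * c%:R)%:E * (total (b j) w + total (b' j) w)))).
  apply: ae_ge0_le_integral => //.
  - by move=> w _; rewrite adde_ge0 ?sqdiff_ge0// mule_ge0.
  - by apply: emeasurable_funD => //; exact: measurable_funeM.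
  apply: filterS (approximation j) => w [_ bf b'f]; rewrite -/(u w) => e _.
  have := tot0 w (kb' j); have := tot0 w (kb j); move: bf b'f e.
  rewrite /Z /sqdiff; set v := (fine (total (a j) w) - fine (total (a' j) w))%R.
  case: (total (b j) w) => // t _; case: (total (b' j) w) => // t' _ /= e.
  rewrite !lee_fin => t0 t'0; rewrite -?EFinD -?EFinM -?EFinD.
  have c0 : (0 <= c%:R :> R)%R by [].
  case: ifPn => [|_]; rewrite lee_fin; last first.
    by rewrite addr_ge0 ?sqr_ge0// mulr_ge0// ?addr_ge0// mulr_ge0.
  rewrite ler_norml => /andP[u1 u2].
  (* Writing s = t - t', one has u ^ 2 = v ^ 2 + 2 u s - s ^ 2, and |u| <= c bounds u s by c (t +
     t'). *)
  have -> : v = (u w - (t - t'))%R by rewrite -e; ring.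
  have : (0 <= (t - t') ^+ 2)%R by exact: sqr_ge0.
  have : (0 <= t * (c%:R - u w))%R by rewrite mulr_ge0// subr_ge0.
  have : (0 <= t' * (c%:R + u w))%R by rewrite mulr_ge0//; lra.
  nra.
rewrite ge0_integralD//; last 3 first.
- by move=> w _; exact: sqdiff_ge0.
- by move=> w _; rewrite mule_ge0.
- exact: measurable_funeM.
rewrite EW ge0_integralZl// ge0_integralD//; do ?[by move=> w _; exact: tot0|by exact: mtot].
rewrite !(expectation_total_sum (P := P) (mu := mu))// leeD//.
apply: le_fock => //; first exact: (mseq_cutin kHp kHq mB).
  by move=> s; rewrite /cutin; case: ifP => // _; exact: sq0.
by move=> s; rewrite /cutin; case: ifP => // _; exact: sq0.
Qed.

Theorem square_moment : \int[P]_w sqdiff (total p w) (total q w) =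
  fock mu K (fun s => sqdiff (Exp p s) (Exp q s)).
Proof. by apply/eqP; rewrite eq_le square_moment_le square_moment_ge. Qed.

End square_moment.

(** * U-statistics *)

Section ustatistic.
Context {R : realType} {d : measure_display} {T : measurableType d}.
Context {dO : measure_display} {Omega : measurableType dO} (P : probability Omega R).
Variable mu : {sigma_finite_measure set T -> \bar R}.
Variable A : Omega -> set T.
Hypothesis measurable_dsumA : forall n (F : seq T -> \bar R), mseq F -> (forall s, 0 <= F s) ->
  measurable_fun setT (fun w => dsum n F (A w)).
Hypothesis expectation_dsumA : forall n (F : seq T -> \bar R), mseq F -> (forall s, 0 <= F s) ->
  \int[P]_w dsum n F (A w) = itint mu n F.
Variables (k : nat) (f : k.-tuple T -> R).
Hypotheses (f_sym : symmetric_kernel f).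
Hypothesis f_L1 : (power_measure mu k).-integrable setT (EFin \o f).

(** The two parts of f become kernels whose only nonzero order is k, so that K is taken to be k. *)
Let p : seq T -> \bar R := seqlift (EFin \o f)^\+.
Let q : seq T -> \bar R := seqlift (EFin \o f)^\-.

Let mf : measurable_fun setT (EFin \o f).
Proof. by case/integrableP: f_L1. Qed.

Let seqlift_sym (g : R -> \bar R) : symmetric (seqlift (g \o f)).
Proof.
move=> s t st; have [sk|sk] := eqVneq (size s) k; last first.
  by rewrite !seqlift0// -(perm_size st).
have tk : size t = k by rewrite -(perm_size st).
have [sig stE] := elimT (tuple_permP (s := Tuple (introT eqP sk)) (t := Tuple (introT eqP tk))) st.
rewrite -[s]/(tval (Tuple (introT eqP sk))) -[t]/(tval (Tuple (introT eqP tk))) !seqliftE /=.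
congr g; rewrite -(f_sym sig (Tuple (introT eqP tk))); congr f.
exact/val_inj.
Qed.

Let kp : sym_kernel k p.
Proof.
split=> [s|||s ks].
- exact: seqlift_ge0.
- by apply: mseq_seqlift; exact: measurable_funepos.
- have -> : p = seqlift ((fun x => maxe x%:E 0) \o f); last exact: seqlift_sym.
  by congr seqlift; apply/funext => x; rewrite funeposE.
- by rewrite /p seqlift0// neq_ltn ks orbT.
Qed.

Let kq : sym_kernel k q.
Proof.
split=> [s|||s ks].
- exact: seqlift_ge0.
- by apply: mseq_seqlift; exact: measurable_funeneg.
- have -> : q = seqlift ((fun x => maxe (- x%:E) 0) \o f); last exact: seqlift_sym.
  by congr seqlift; apply/funext => x; rewrite funenegE.
- by rewrite /q seqlift0// neq_ltn ks orbT.
Qed.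

Let itint_seqlift_neq n m (g : n.-tuple T -> \bar R) : m != n -> itint mu m (seqlift g) = 0.
Proof.
by move=> mn; rewrite (eq_itint mu (G := fun=> 0)) ?itint0// => s sm; rewrite seqlift0// sm.
Qed.

Let int_seqlift (g : k.-tuple T -> \bar R) : measurable_fun setT g -> (forall t, 0 <= g t) ->
  \int[power_measure mu k]_t g t = itint mu k (seqlift g).
Proof.
move=> mg g0.
rewrite -(integral_power_measure mu k (mseq_seqlift mg) (fun s => seqlift_ge0 s g0)).
have [m ->] := power_measure_pack mu k.
by apply: eq_integral => t _; rewrite seqliftE.
Qed.

Let finite_mass_seqlift (g : k.-tuple T -> \bar R) : measurable_fun setT g -> (forall t, 0 <= g t) ->
  \int[power_measure mu k]_t g t < +oo -> finite_mass mu (seqlift g).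
Proof.
move=> mg g0 goo n; have [->|nk] := eqVneq n k; last by rewrite itint_seqlift_neq.
by rewrite -int_seqlift.
Qed.

Let fin_pq : itint mu k p \is a fin_num /\ itint mu k q \is a fin_num.
Proof.
have [m mE] := power_measure_pack mu k.
have f_L1' : m.-integrable setT (EFin \o f) by rewrite -mE.
rewrite /p /q -!int_seqlift//; [|exact: measurable_funeneg|exact: measurable_funepos].
rewrite mE; split; [exact: integrable_pos_fin_num|exact: integrable_neg_fin_num].
Qed.

Let fp : finite_mass mu p.
Proof.
have [pf _] := fin_pq; apply: finite_mass_seqlift => //; first exact: measurable_funepos.
by rewrite int_seqlift//; [rewrite -ge0_fin_numE//; apply: itint_ge0; have [] := kp|exact: measurable_funepos].
Qed.

Let fq : finite_mass mu q.
Proof.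
have [_ qf] := fin_pq; apply: finite_mass_seqlift => //; first exact: measurable_funeneg.
by rewrite int_seqlift//; [rewrite -ge0_fin_numE//; apply: itint_ge0; have [] := kq|exact: measurable_funeneg].
Qed.

Let total_seqlift (g : k.-tuple T -> \bar R) w : total_sum A k (seqlift g) w = dsum k (seqlift g) (A w).
Proof.
rewrite /total_sum big_ord_recr /= big1 ?add0e// => n _.
rewrite (eq_dsum (G := fun=> 0)) ?dsum0// => s sn; rewrite seqlift0// sn.
by rewrite neq_ltn (ltn_ord n).
Qed.

Let X w := dsum k p (A w).
Let Y w := dsum k q (A w).
Let U w : R := fine (X w - Y w).

Let mX : measurable_fun setT X.
Proof. by have [p0 mp _ _] := kp; exact: measurable_dsumA. Qed.

Let mY : measurable_fun setT Y.
Proof. by have [q0 mq _ _] := kq; exact: measurable_dsumA. Qed.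

Let X0 w : 0 <= X w. Proof. by have [p0 _ _ _] := kp; exact: dsum_ge0. Qed.
Let Y0 w : 0 <= Y w. Proof. by have [q0 _ _ _] := kq; exact: dsum_ge0. Qed.

Let ae_fin : {ae P, forall w, X w \is a fin_num /\ Y w \is a fin_num}.
Proof.
have := total_sum_ae_fin measurable_dsumA expectation_dsumA kq fq.
have := total_sum_ae_fin measurable_dsumA expectation_dsumA kp fp.
by apply: filterS2 => w; rewrite !total_seqlift.
Qed.

Let integrable_XY : P.-integrable setT X /\ P.-integrable setT Y.
Proof.
have [pf qf] := fin_pq; have [p0 mp _ _] := kp; have [q0 mq _ _] := kq.
split; apply/integrableP; split => //; under eq_integral do rewrite gee0_abs//.
- by rewrite /X expectation_dsumA// -ge0_fin_numE//; exact: itint_ge0.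
- by rewrite /Y expectation_dsumA// -ge0_fin_numE//; exact: itint_ge0.
Qed.

Let mU : measurable_fun setT (EFin \o U).
Proof.
apply/measurable_EFinP; apply: (measurableT_comp (f := fine)); first exact: fine_measurable.
exact: emeasurable_funB.
Qed.

Let aeU : ae_eq P setT (fun w => X w - Y w) (EFin \o U).
Proof. by apply: filterS ae_fin => w [xf yf] _; rewrite /= fineK// fin_numB xf. Qed.

Lemma integrable_ustat : P.-integrable setT (EFin \o U).
Proof.
have [iX iY] := integrable_XY.
apply: (le_integrable measurableT mU _ (integrableB measurableT iX iY)) => w _ /=.
by rewrite /U; case: (X w - Y w) => [r||] /=; rewrite ?leey ?lexx.
Qed.

Let integral_pq : \int[power_measure mu k]_x (f x)%:E = itint mu k p - itint mu k q.
Proof.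
rewrite /p /q -!int_seqlift//; [|exact: measurable_funeneg|exact: measurable_funepos].
by have [m ->] := power_measure_pack mu k; rewrite [LHS]integralE.
Qed.

Lemma expectation_ustat : 'E_P[U] = \int[power_measure mu k]_x (f x)%:E.
Proof.
have [iX iY] := integrable_XY; have [p0 mp _ _] := kp; have [q0 mq _ _] := kq.
rewrite integral_pq unlock; transitivity (\int[P]_w (X w - Y w)).
  by apply/esym/ae_eq_integral => //; exact: emeasurable_funB.
by rewrite integralB// /X /Y !expectation_dsumA.
Qed.

Let second_moment : \int[P]_w (U w ^+ 2)%:E =
  fock mu k (fun s => sqdiff (exp_op mu k p s) (exp_op mu k q s)).
Proof.
(* An increasing exhaustion by sets of finite measure supplies the sets for the truncation. *)
have /sigma_finiteP[F [TF ndF Foo]] := sigma_finiteT mu.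
rewrite -(square_moment (P := P) (A := A) measurable_dsumA expectation_dsumA kp kq fp fq (B := F)); first last.
- by move=> j; have [] := Foo j.
- by rewrite -TF.
- by move=> i j ij; exact/subsetPset/ndF.
- by move=> j; have [] := Foo j.
have -> : total_sum A k p = X by apply/funext => w; exact: total_seqlift.
have -> : total_sum A k q = Y by apply/funext => w; exact: total_seqlift.
apply: ge0_ae_eq_integral => //.
- by apply/measurable_EFinP; apply: measurable_funX; exact/measurable_EFinP.
- exact: measurable_sqdiff.
- by move=> w _; rewrite lee_fin sqr_ge0.
- by move=> w _; exact: sqdiff_ge0.
apply: filterS ae_fin => w [xf yf] _; rewrite /sqdiff /U.
by rewrite -(fineK xf) -(fineK yf).
Qed.

(** For a kernel of the single order k only the term n = k survives, and exp D becomes the formula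
    that defines h_n. *)
Let section_seqlift (g : k.-tuple T -> \bar R) s : (size s <= k)%N -> sym_kernel k (seqlift g) ->
  exp_op mu k (seqlift g) s = 'C(k, size s)%:R%:E * itint mu (k - size s) (fun y => seqlift g (s ++ y)).
Proof.
move=> sk kg; rewrite /exp_op section_op1E// big_ord_recr /= big1 ?add0e// => n _.
have [ns|sn] := ltnP n (size s); first by rewrite bin_small// mul0e.
rewrite (eq_itint mu (G := fun=> 0)) ?itint0 ?mule0// => y yn; rewrite seqlift0//.
by rewrite size_cat yn subnKC// neq_ltn ltn_ord.
Qed.

(** [hkernel] integrates f as a whole and takes a real value, whereas the exponentials treat its two
    parts separately; they agree wherever both sections are finite, which is almost everywhere. *)
Let sq_L2norm_hkernel (n : 'I_k.+1) : sq_L2norm mu (hkernel mu f n) =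
  itint mu n (fun s => sqdiff (exp_op mu k p s) (exp_op mu k q s)).
Proof.
have nk : (n <= k)%N by rewrite -ltnS.
pose J h s := itint mu (k - n) (fun y => h (s ++ y)) : \bar R.
pose G s : \bar R := (('C(k, n)%:R * fine (J p s - J q s)) ^+ 2)%:E.
have [p0 mp _ _] := kp; have [q0 mq _ _] := kq.
have mJ h : mseq h -> (forall s, 0 <= h s) -> mseq (J h) by move=> mh h0; exact: mseq_itint.
have mG : mseq G.
  move=> m; apply/measurable_EFinP; apply: measurable_funX; apply: measurable_funM => //.
  apply: (measurableT_comp (f := fine)); first exact: fine_measurable.
  by apply: emeasurable_funB; exact: mJ.
have G0 s : 0 <= G s by rewrite lee_fin sqr_ge0.
transitivity (itint mu n G).
  rewrite -(integral_power_measure mu n mG G0) /sq_L2norm.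
  have [m ->] := power_measure_pack mu n; apply: eq_integral => x _.
  rewrite /G real_normK ?num_real// /hkernel; congr ((_ * fine _) ^+ 2)%:E.
  have EJ (g : k.-tuple T -> \bar R) : measurable_fun setT g -> (forall t, 0 <= g t) ->
      \int[power_measure mu (k - n)]_y g (tcast (subnKC (leq_ord n)) [tuple of x ++ y]) =
      J (seqlift g) x.
    move=> mg g0; have mc := mseq_catl x (mseq_seqlift mg).
    rewrite /J -(integral_power_measure mu _ mc (fun s => seqlift_ge0 _ g0)).
    have [m' ->] := power_measure_pack mu (k - n); apply: eq_integral => y _.
    by rewrite -seqliftE val_tcast.
  rewrite -!EJ//; [|exact: measurable_funeneg|exact: measurable_funepos].
  have [m' ->] := power_measure_pack mu (k - n); rewrite [LHS]integralE.
  by congr (_ - _); apply: eq_integral => y _; rewrite ?funeposE ?funenegE.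
have kHp := sym_kernel_section_op mu (fun=> 1%N) kp.
have kHq := sym_kernel_section_op mu (fun=> 1%N) kq.
have fHp := finite_mass_section_op (fun=> 1%N) kp fp.
have fHq := finite_mass_section_op (fun=> 1%N) kq fq.
have [Hp0 mHp _ _] := kHp; have [Hq0 mHq _ _] := kHq.
(* [G] has the right binomial coefficient and number of integrations only at length n; at other
   lengths it is replaced by the target, since the comparison is demanded at all lists. *)
pose G' s : \bar R := if size s == n then G s else sqdiff (exp_op mu k p s) (exp_op mu k q s).
have mG' : mseq G'.
  move=> m; rewrite /G'; under eq_fun do rewrite size_tuple.
  case: eqP => _; first exact: mG.
  by apply: measurable_sqdiff; [exact: mHp|exact: mHq].
rewrite (eq_itint mu (G := G')); last by move=> s sn; rewrite /G' sn eqxx.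
apply: (itint_ae_eq (D := fun s => exp_op mu k p s + exp_op mu k q s)) => //.
- exact: mseqD.
- by move=> s; apply: adde_ge0; [exact: Hp0|exact: Hq0].
- by rewrite itintD// lte_add_pinfty.
- by move=> m; apply: measurable_sqdiff; [exact: mHp|exact: mHq].
- by move=> s; rewrite /G'; case: ifP => // _; exact: sqdiff_ge0.
- by move=> s; exact: sqdiff_ge0.
move=> s Doo; rewrite /G'; case: eqP => // sn.
have ps : exp_op mu k p s < +oo by apply: le_lt_trans Doo; rewrite leeDl//; exact: Hq0.
have qs : exp_op mu k q s < +oo by apply: le_lt_trans Doo; rewrite leeDr//; exact: Hp0.
move: ps qs; rewrite /G /sqdiff !section_seqlift ?sn// -/(J p s) -/(J q s).
have Cgt0 : (0 < 'C(k, n)%:R :> R)%R by rewrite ltr0n bin_gt0.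
have Jp0 : 0 <= J p s by exact: itint_ge0.
have Jq0 : 0 <= J q s by exact: itint_ge0.
have fin (x : \bar R) : 0 <= x -> 'C(k, n)%:R%:E * x < +oo -> x \is a fin_num.
  case: x => [r||]// _.
  by rewrite gt0_muley ?lte_fin// ltxx.
move=> /(fin _ Jp0) /fineK <- /(fin _ Jq0) /fineK <-.
by rewrite -!EFinM -EFinB /= mulrBr.
Qed.

Lemma variance_ustat : U \in Lfun P 2%:E -> 'V_P[U] =
  \sum_(n < k.+1 | (1 <= n)%N) n`!%:R%:E * sq_L2norm mu (hkernel mu f n).
Proof.
move=> U2; have [pf qf] := fin_pq.
rewrite varianceE// expectation_ustat integral_pq unlock.
rewrite (_ : \int[P]_w _ = \int[P]_w (U w ^+ 2)%:E); last by apply: eq_integral => w _.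
(* The term of order 0 is the square of the expectation and cancels against it. *)
rewrite second_moment /fock big_ord_recl [RHS]big_mkcond [RHS]big_ord_recl /= add0e.
rewrite mul1e /sqdiff !section_seqlift// bin0 subn0 !mul1e.
rewrite -(fineK pf) -(fineK qf) /= addeAC -expr2 -EFinD subrr add0e.
by apply: eq_bigr => i _; congr (_ * _); exact/esym/(sq_L2norm_hkernel (lift ord0 i)).
Qed.

End ustatistic.

(** * Polish spaces *)

Section polish_base.
Context {R : realType} {X : ptopologicalType}.
Hypothesis X_polish : polish R X.

Lemma polish_countable_base : exists U : nat -> set X, (forall i, open (U i)) /\
  forall x (O : set X), nbhs x O -> exists l, U l x /\ U l `<=` O.
Proof.
have [[D cD dD] [dist [[dist0 distC dist_tri] nbhsE _]]] := X_polish.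
have /countable_injP[c cinj] := cD.
have open_ball y (e : R) : open [set z | (dist y z < e)%R].
  rewrite openE => z /= yz; apply/nbhsE; exists (e - dist y z)%R; first by rewrite subr_gt0.
  by move=> t /= zt; apply: le_lt_trans (dist_tri y z t) _; rewrite -ltrBrDl.
(* Balls of radius 1 / (j + 1) around the points of D with code i; by injectivity there is at most
   one such point, and the set is empty if there is none. *)
pose B (ij : nat * nat) := \bigcup_(y in [set y | D y /\ c y = ij.1])
  [set z | (dist y z < ij.2.+1%:R^-1)%R].
exists (fun i => B (odflt (0, 0)%N (unpickle i))); split => [i|x O].
  by apply: bigcup_open => y _; exact: open_ball.
move=> /nbhsE[e e0 eO].
(* Two points of a ball of radius 1 / (n + 1) are at distance less than 2 / (n + 1) < e, so such a
   ball stays in the e-ball around any of its points. *)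
pose n := Num.bound (2 / e)%R.
have ne : (2 * n.+1%:R^-1 < e)%R.
  rewrite ltr_pdivrMr// mulrC -ltr_pdivrMr//.
  apply: lt_trans (archi_boundP _) _; first by rewrite divr_ge0// ltW.
  by rewrite ltr_nat.
have [y [xy Dy]] : [set z | (dist x z < n.+1%:R^-1)%R] `&` D !=set0.
  apply: dD; last exact: open_ball.
  by exists x; rewrite /= (dist0 x x).2// invr_gt0.
exists (pickle (c y, n)); rewrite pickleK /=; split.
  by exists y => //=; rewrite distC.
move=> z [y' [Dy' cy']] /= y'z; apply: eO => /=.
have y'E : y' = y by apply: cinj; rewrite ?inE.
rewrite y'E in y'z; apply: le_lt_trans (dist_tri x y z) _.
by apply: lt_trans ne; rewrite mulr2n mulrDl mul1r; apply: ltrD.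
Qed.

Lemma polish_separated (x y : X) : x <> y ->
  exists O O', [/\ nbhs x O, nbhs y O' & O `&` O' = set0].
Proof.
move=> xy; have [_ [dist [[dist0 distC dist_tri] nbhsE _]]] := X_polish.
have dxy : (0 < dist x y)%R.
  rewrite lt_neqAle; apply/andP; split; first by apply/eqP => /esym /dist0.
  have := dist_tri x y x; rewrite (dist0 x x).2// (distC y x); lra.
pose e := (dist x y / 2)%R.
have e0 : (0 < e)%R by rewrite divr_gt0.
exists [set z | (dist x z < e)%R], [set z | (dist y z < e)%R]; split.
- by apply/nbhsE; exists e.
- by apply/nbhsE; exists e.
apply/seteqP; split => // z [] /= xz yz.
by have := dist_tri x z y; rewrite (distC z y) /e in xz yz *; lra.
Qed.

Variable mu : {measure set (borel X) -> \bar R}.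
Hypothesis mu_lf : locally_finite mu.

Lemma measurable_open_borel (O : set X) : open O -> measurable (O : set (borel X)).
Proof. by move=> oO; exact: sub_sigma_algebra. Qed.

(** Base sets of infinite measure are replaced by the empty set; as [mu] is locally finite, enough
    sets remain to form a base. The same family then serves every locally finite measure, in
    particular all realizations of the process. *)
Lemma polish_point_base : exists V : nat -> set (borel X), [/\ point_base V,
  forall i, mu (V i) < +oo &
  forall m : {measure set (borel X) -> \bar R}, locally_finite m -> base_finite V m].
Proof.
have [U [oU bU]] := polish_countable_base.
pose V i : set (borel X) := if mu (U i) < +oo then U i else set0.
have mU i : measurable (U i : set (borel X)) by exact: measurable_open_borel.
have bV x (O : set X) : nbhs x O -> exists l, V l x /\ V l `<=` O.
  move=> xO; have [W [oW xW] muW] := mu_lf x.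
  have [l [Ulx UlOW]] := bU x _ (filterI xO (open_nbhs_nbhs (conj oW xW))).
  have Vl : V l = U l.
    rewrite /V ifT//; apply: le_lt_trans muW; apply: le_measure; rewrite ?inE//.
      exact: measurable_open_borel.
    by move=> z /UlOW[].
  by exists l; rewrite Vl; split => // z /UlOW[].
have nV i x : V i x -> nbhs x (V i : set X).
  rewrite /V; case: ifP => // _ Uix; apply: open_nbhs_nbhs; split => //; exact: oU.
exists V; split.
- split.
  + by move=> i; rewrite /V; case: ifP.
  + move=> x y /polish_separated[W [W' [xW yW' WW']]].
    have [i [Vix ViW]] := bV _ _ xW; have [j [Vjy VjW']] := bV _ _ yW'.
    by exists i, j; split => //; exact: subsetI_eq0 ViW VjW' WW'.
  + by move=> x; have [i [Vix _]] := bV x setT filterT; exists i.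
  + by move=> x i j /nV xi /nV xj; exact: bV (filterI xi xj).
- by move=> i; rewrite /V; case: ifP => //; rewrite measure0.
- move=> m m_lf x; have [W [oW xW] mW] := m_lf x.
  have [l [Vlx VlW]] := bV x _ (open_nbhs_nbhs (conj oW xW)).
  exists l; split => //; apply: le_lt_trans mW; apply: le_measure; rewrite ?inE//.
    by rewrite /V; case: ifP.
  exact: measurable_open_borel.
Qed.

End polish_base.

Lemma non_atomic_point {R : realType} {d : measure_display} {T : measurableType d}
    (mu : {measure set T -> \bar R}) (x : T) : measurable [set x] ->
  non_atomic mu -> mu [set x] = 0.
Proof.
move=> mx na; apply/eqP/negPn/negP => mux.
apply: (na [set x]); split => //; first by rewrite lt0e mux measure_ge0.
move=> C mC /subset_set1[] ->; first by rewrite measure0.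
by rewrite ltxx.
Qed.

Lemma point_base_sigma_finite {R : realType} {d : measure_display} {T : measurableType d}
    (mu : {measure set T -> \bar R}) (V : nat -> set T) :
  point_base V -> (forall i, mu (V i) < +oo) -> sigma_finite setT mu.
Proof.
move=> [mV _ cV _] Voo; exists V => //.
by apply/seteqP; split => // x _; have [i Vix] := cV x; exists i.
Qed.

(** * Moments of U-statistics of a Poisson process *)

Unset Implicit Arguments.

Theorem proposition1 (R : realType) (X : ptopologicalType)
    (X_polish : polish R X)
    (mu : {measure set (borel X) -> \bar R})
    (mu_lf : locally_finite mu) (mu_na : non_atomic mu)
    (d : measure_display) (Omega : measurableType d) (P : probability Omega R)
    (eta : R.-ker Omega ~> borel X) (eta_poisson : poisson_process P mu eta)
    (k : nat) (k_ge1 : (1 <= k)%N)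
    (f : k.-tuple (borel X) -> R) (f_sym : symmetric_kernel f)
    (f_L1 : (power_measure mu k).-integrable setT (EFin \o f)) :
  let U : Omega -> R := fun w => Ustat f (eta w) in
  [/\ P.-integrable setT (EFin \o U),
      'E_P[U] = \int[power_measure mu k]_x (f x)%:E
    & U \in Lfun P 2%:E ->
      'V_P[U] = \sum_(n < k.+1 | (1 <= n)%N)
        (n`!)%:R%:E * sq_L2norm mu (hkernel mu f n)].
Proof.
have [eta_lf pois indep] := eta_poisson.
have [V [bV muV fV]] := polish_point_base X_polish mu_lf.
have mu_point x : mu [set x] = 0.
  by apply: non_atomic_point mu_na; exact: (measurable_point bV).
have sf := point_base_sigma_finite bV muV.
(* [nu] is [mu] equipped with its sigma-finiteness; the two are convertible, so that results for
   [nu] are results for [mu]. *)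
pose nu : {sigma_finite_measure set (borel X) -> \bar R} := as_sigma_finite sf.
have feta w : base_finite V (eta w) by apply: fV; have [] := eta_lf w.
have ieta w : integer_valued (eta w) by have [] := eta_lf w.
have mds := measurable_dsum_support bV feta ieta.
have eds : forall n (F : seq (borel X) -> \bar R), mseq F -> (forall s, 0 <= F s) ->
    \int[P]_w dsum n F (support (eta w)) = itint nu n F.
  exact: (expectation_dsum bV (mu := nu) muV feta ieta mu_point pois indep).
have f_L1' : (power_measure nu k).-integrable setT (EFin \o f) by exact: f_L1.
have UE : (fun w => Ustat f (eta w)) = (fun w => fine
    (dsum k (seqlift (EFin \o f)^\+) (support (eta w)) -
     dsum k (seqlift (EFin \o f)^\-) (support (eta w)))).
  apply/funext => w; rewrite /Ustat -!dsum_esum.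
  - by congr (fine (_ - _)); apply: eq_esum => t _; rewrite seqliftE.
  - by move=> s; exact: seqlift_ge0.
  - by move=> s; exact: seqlift_ge0.
rewrite /= UE; split.
- exact: (integrable_ustat mds eds f_sym f_L1').
- exact: (expectation_ustat mds eds f_sym f_L1').
- exact: (variance_ustat mds eds f_sym f_L1').
Qed.
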